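(* For every $k\in\mathbb{N}$, the domination polynomial $Dom$ is weakly distinguishing on the class $\mathcal{C}_k$ of graphs of genus at most $k$.
   Context: Graphs are finite, simple, labelled on $\{1,\dots,n\}$. The genus of a graph is the minimum genus of an orientable surface in which it embeds. A set $S\subseteq V(G)$ is dominating if every vertex is in $S$ or has a neighbour in $S$; $Dom(G;x)=\sum_S x^{|S|}$ over dominating sets. Two non-isomorphic graphs are $P$-mates if they have equal $P$; $U_{P,\mathcal{C}}(n)$ is the set of $G\in\mathcal{C}(n)$ (members on $\{1,\dots,n\}$) with no $P$-mate in $\mathcal{C}$; $P$ is weakly distinguishing on $\mathcal{C}$ if $|U_{P,\mathcal{C}}(n)|/|\mathcal{C}(n)|\to0$. *)

(* Defs.v *)
From HB Require Import structures.
From mathcomp Require Import all_boot all_order all_algebra.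
From mathcomp Require Import all_classical all_reals all_analysis.

Set Implicit Arguments.
Unset Strict Implicit.
Unset Printing Implicit Defensive.

Import Order.TTheory GRing.Theory Num.Theory.
Import numFieldNormedType.Exports.

Local Open Scope ring_scope.

(** * Finite simple labelled graphs; the vertex set is ['I_n]. *)

Record graph (n : nat) := Graph {
  edges : {set {set 'I_n}};
  edges_card2 : [forall e in edges, #|e| == 2%N] }.

HB.instance Definition _ (n : nat) := [isSub for @edges n].
HB.instance Definition _ (n : nat) := [Finite of graph n by <:].

Definition adj (n : nat) (G : graph n) (u v : 'I_n) : bool :=
  [set u; v]%SET \in edges G.

Definition isomorphic (n n' : nat) (G : graph n) (H : graph n') : Prop :=
  exists f : 'I_n -> 'I_n',
    bijective f /\ forall u v, adj H (f u) (f v) = adj G u v.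

(** * Domination polynomial *)

Definition dominating (n : nat) (G : graph n) (S : {set 'I_n}) : bool :=
  [forall v, (v \in S) || [exists u in S, adj G u v]].

Definition Dom (n : nat) (G : graph n) : {poly int} :=
  \sum_(S : {set 'I_n} | dominating G S) 'X^#|S|.

(** * Simplicial complexes and their realizations *)

Definition simplicial_complex (m : nat) (K : {set {set 'I_m}}) : Prop :=
  [/\ finset.set0 \notin K,
      forall v : 'I_m, [set v]%SET \in K
    & forall s t : {set 'I_m},
        t \in K -> s \subset t -> s != finset.set0 -> s \in K].

(* Points are given by barycentric coordinates. *)
Definition realization (R : realType) (m : nat) (K : {set {set 'I_m}}) :
    set 'rV[R]_m :=
  [set x : 'rV[R]_m | [/\ forall i, 0 <= x 0 i,
                          \sum_i x 0 i = 1
                        & finset (fun i : 'I_m => x 0 i != 0) \in K]]%classic.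

Arguments realization R {m} K.

(** * Closed orientable surfaces, given by triangulations *)

Section Surfaces.
Variables (m : nat) (K : {set {set 'I_m}}).

Definition triangle (a b c : 'I_m) : bool :=
  (#|[set a; b; c]%SET| == 3%N) && ([set a; b; c]%SET \in K).

Definition faces_of_size (d : nat) : {set {set 'I_m}} :=
  finset (fun s : {set 'I_m} => (s \in K) && (#|s| == d)).

(* Since every edge lies in exactly two triangles, the link of a vertex is a
   2-regular graph, so that it is a cycle if and only if it is connected. *)
Definition closed_surface : Prop :=
  [/\ simplicial_complex K,
      forall s, s \in K -> exists2 t, t \in faces_of_size 3 & s \subset t,
      forall e, e \in faces_of_size 2 ->
        #|finset (fun t : {set 'I_m} => (t \in faces_of_size 3) && (e \subset t))| = 2%N
    & forall v a b : 'I_m,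
        [set v; a]%SET \in faces_of_size 2 ->
        [set v; b]%SET \in faces_of_size 2 ->
        connect (triangle v) a b].

Definition connected_complex : Prop :=
  (0 < m)%N /\
  forall u v : 'I_m, connect (fun a b => [set a; b]%SET \in K) u v.

(* [o a b c] says that the triangle abc is positively oriented; the last
   condition says that the two triangles at an edge induce opposite directions
   on this edge. *)
Definition orientable : Prop :=
  exists o : 'I_m -> 'I_m -> 'I_m -> bool,
    [/\ forall a b c, o a b c -> triangle a b c,
        forall a b c, o a b c -> o b c a,
        forall a b c, triangle a b c -> o a b c (+) o a c b
      & forall a b c d, o a b c -> o a b d -> c = d].

Definition euler_characteristic : int :=
  #|faces_of_size 1|%:Z - #|faces_of_size 2|%:Z + #|faces_of_size 3|%:Z.

Definition orientable_surface_of_genus (g : nat) : Prop :=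
  [/\ closed_surface, connected_complex, orientable
    & euler_characteristic = 2 - 2 * g%:Z].

End Surfaces.

(** * Genus of a graph *)

(* The graph viewed as a complex of dimension at most 1. *)
Definition graph_complex (n : nat) (G : graph n) : {set {set 'I_n}} :=
  finset (fun s : {set 'I_n} => (#|s| == 1%N) || (s \in edges G)).

(* A continuous injection suffices, the realization of a graph being compact. *)
Definition embeds_in (R : realType) (n m : nat)
    (G : graph n) (K : {set {set 'I_m}}) : Prop :=
  exists f : 'rV[R]_n -> 'rV[R]_m,
    [/\ {within realization R (graph_complex G), continuous f},
        set_inj (realization R (graph_complex G)) f
      & f @` realization R (graph_complex G)
          `<=` realization R K]%classic.

Definition embeds_in_genus (R : realType) (n : nat) (G : graph n) (g : nat) :
    Prop :=
  exists (m : nat) (K : {set {set 'I_m}}),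
    orientable_surface_of_genus K g /\ embeds_in R G K.

Definition has_genus (R : realType) (n : nat) (G : graph n) (g : nat) : Prop :=
  embeds_in_genus R G g /\
  forall g' : nat, embeds_in_genus R G g' -> (g <= g')%N.

(** * Graph classes and weakly distinguishing polynomials *)

Definition graph_class : Type := forall n : nat, graph n -> Prop.
Definition graph_polynomial : Type := forall n : nat, graph n -> {poly int}.

Definition genus_at_most (R : realType) (k : nat) : graph_class :=
  fun n G => exists2 g : nat, (g <= k)%N & has_genus R G g.

Definition mates (P : graph_polynomial) (n n' : nat)
    (G : graph n) (H : graph n') : Prop :=
  ~ isomorphic G H /\ P n G = P n' H.

Definition members (C : graph_class) (n : nat) : {set graph n} :=
  finset (fun G : graph n => `[< C n G >]).

Definition unique_members (P : graph_polynomial) (C : graph_class) (n : nat) :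
    {set graph n} :=
  finset (fun G : graph n => (G \in members C n) &&
    `[< ~ exists (n' : nat) (H : graph n'), C n' H /\ mates P G H >]).

Definition weakly_distinguishing (R : realType)
    (P : graph_polynomial) (C : graph_class) : Prop :=
  ((fun n : nat => #|unique_members P C n|%:R / #|members C n|%:R : R)
     @ \oo --> (0 : R))%classic.

(* Main.v *)
(** Replace topology by combinatorics: a graph has genus at most k iff it is a minor,
    in the sense of disjoint connected branch sets joined by edges, of a combinatorial
    map (darts, an involution e, a face permutation f, vertices the orbits of e * f)
    of genus at most k.  A model is realized by contracting its branch sets, subdividing
    the map barycentrically into a simplicial complex and routing the edges of the graph
    along its edges.  Conversely, a continuous injection into a triangulated surface is
    discretized by cutting each triangle into N^2 small ones: the lattice points close
    to the image of a connected piece of the graph are connected in the lattice map, and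
    those close to far pieces are disjoint when N is large.

    The minor description shows that the class is closed under deleting and contracting
    edges and under adding leaves, and, by Euler's formula, that its graphs are
    uniformly sparse.  If a graph has an edge x1 x2 whose ends both carry leaves y1 and
    y2, then deleting x1 x2 changes no dominating set, which gives a mate.  Finally,
    graphs without such a structure are rare: a sparse graph has linearly many low
    degree vertices, four of which can be removed by bounded-to-one reductions, and
    reattaching them as a path y1 x1 x2 y2 at any of n vertices u yields about n times
    as many graphs in the class, each obtained only boundedly often. *)

Require Import Defs.
From mathcomp Require Import all_boot all_order all_algebra all_fingroup zify.

Set Implicit Arguments.
Unset Strict Implicit.
Unset Printing Implicit Defensive.

(** A map is cellular by its very definition, while a graph embedded in a surface need not be.
    Asking only for a minor of the map avoids this mismatch: a deletion touches nothing, a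
    contraction unites two branch sets, and no embedding has to be normalised. The obstacle in the
    count is to undo a reduction. Deleting a vertex of bounded degree s could lose about n^s
    neighbourhoods, so the two reductions used lose only one vertex y and bounded data: contracting
    x into y when both have bounded degree, which confines the old neighbours of x to those of y,
    and isolating x when y has the same neighbourhood. The factor n per freed vertex is balanced by
    the linearly many choices of x, so that the point u of reattachment is a pure gain. That
    linearly many x can be reduced is due to minors: distinct neighbourhoods inside a small set B
    either are cliques of a sparse graph, hence few, or yield new edges inside B by contraction,
    again few. Reattaching is boundedly many-to-one because a graph that differs from a pattern-free
    one at boundedly many vertices contains boundedly many copies of the pattern. *)

Module Adjacency.

Import Defs.

(** * Adjacency and neighbourhoods *)

Section Graphs.
Variable n : nat.
Implicit Types (G H : graph n) (r : rel 'I_n) (u v w x y z : 'I_n).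

Lemma adjC G u v : adj G u v = adj G v u.
Proof. by rewrite /adj setUC. Qed.

Lemma adjxx G u : adj G u u = false.
Proof.
apply/negP; rewrite /adj setUid => uG.
by have /forall_inP/(_ _ uG) := edges_card2 G; rewrite cards1.
Qed.

Lemma adj_neq G u v : adj G u v -> u != v.
Proof. by apply: contraTneq => ->; rewrite adjxx. Qed.

Lemma eq_graph G H : adj G =2 adj H -> G = H.
Proof.
move=> eqGH; apply: val_inj; apply/setP => e /=.
have [] := boolP (#|e| == 2%N) => [/cards2P[a [b [ab ->]]]|ne2]; first exact: eqGH.
have aux (J : graph n) : e \in edges J -> #|e| == 2.
  by have /forall_inP := edges_card2 J; apply.
by apply/idP/idP => /aux; rewrite (negbTE ne2).
Qed.

Definition rel_edges r := [set [set p.1; p.2] | p : 'I_n * 'I_n & (p.1 != p.2) && r p.1 p.2].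

Lemma rel_edges_card2 r : [forall e in rel_edges r, #|e| == 2%N].
Proof.
apply/forall_inP => e /imsetP[[u v] /=]; rewrite inE /= => /andP[uv _] ->.
by rewrite cards2 uv.
Qed.

(** [r] is symmetrised and its loops are dropped, so that the operations below may be given by
    one-sided formulas. *)
Definition of_rel r : graph n := Graph (rel_edges_card2 r).

Lemma set2_eq (T : finType) (u v a b : T) : u != v -> [set u; v] = [set a; b] ->
  u = a /\ v = b \/ u = b /\ v = a.
Proof.
move=> uv e; have /set2P ua : u \in [set a; b] by rewrite -e set21.
have /set2P va : v \in [set a; b] by rewrite -e set22.
by case: ua va uv => [->|->] [->|->]; rewrite ?eqxx //; [left|right].
Qed.

Lemma adj_of_rel r u v :
  adj (of_rel r) u v = (u != v) && (r u v || r v u).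
Proof.
apply/imsetP/andP => [[[a b]] /=|[uv]].
  rewrite inE /= => /andP[ab rab] /esym /(set2_eq ab)[] [<- <-]; first by rewrite ab rab.
  by rewrite eq_sym ab rab orbT.
by case/orP=> [ruv|rvu]; [exists (u, v); rewrite ?inE /= ?uv|exists (v, u); rewrite ?inE /= ?(eq_sym v) ?uv // setUC].
Qed.

Definition nb G v := [set u | adj G v u].

Lemma in_nb G u v : (u \in nb G v) = adj G v u.
Proof. by rewrite inE. Qed.

Lemma eq_graph_nb G H : nb G =1 nb H -> G = H.
Proof. by move=> e; apply: eq_graph => u v; rewrite -!in_nb e. Qed.

End Graphs.

End Adjacency.

(** * Edge operations on graphs, and the deletion that produces mates *)

Module EdgeOperations.

Import Defs.
Import Adjacency.

Section Ops.
Variable n : nat.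
Implicit Types (G H : graph n) (r : rel 'I_n) (u v w x y z : 'I_n).

Definition del_edge G x y : graph n :=
  of_rel (fun u v => adj G u v && ([set u; v] != [set x; y])).

(** Vertices are never deleted: all graphs stay on ['I_n], and the freed label is reused for the
    reattached path. *)
Definition isolate G x : graph n :=
  of_rel (fun u v => [&& adj G u v, u != x & v != x]).

Definition contract G x y : graph n :=
  of_rel (fun u v => [&& u != x, v != x & adj G u v || (u == y) && adj G x v]).

Definition add_edge G x y : graph n :=
  of_rel (fun u v => adj G u v || (u == x) && (v == y)).

Definition isolated G x := nb G x == set0.

Lemma nb_isolate G x v : nb (isolate G x) v = if v == x then set0 else nb G v :\ x.
Proof.
apply/setP=> u; rewrite in_nb adj_of_rel (adjC G u v).
have [->|vx] := eqVneq v x; first by rewrite !inE /= !andbF.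
rewrite !inE; have [->|ux] := eqVneq u x; rewrite ?andbF //= !andbT orbb.
by case: (boolP (adj G v u)) => [/adj_neq->//|]; rewrite andbF.
Qed.

Lemma nb_contract G x y v : x != y -> nb (contract G x y) v =
  if v == x then set0 else if v == y then (nb G y :|: nb G x) :\ x :\ y
  else if v \in nb G x then y |: (nb G v :\ x) else nb G v :\ x.
Proof.
move=> xy; have adjN a b : (a != b) && adj G a b = adj G a b.
  by case: (boolP (adj G a b)) => [/adj_neq->//|]; rewrite andbF.
apply/setP=> u; rewrite [LHS]in_nb.
have -> : adj (contract G x y) v u = [&& v != u, v != x, u != x &
    [|| adj G v u, (v == y) && adj G x u | (u == y) && adj G x v]].
  rewrite adj_of_rel (adjC G u v); case: eqP; case: eqP; case: eqP; case: eqP; rewrite ?andbF //=;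
  by case: (adj G v u); case: (adj G x u); case: (adj G x v).
have [->|vx] := eqVneq v x; first by rewrite inE /= !andbF.
have [->|vy] := eqVneq v y.
  rewrite !inE (eq_sym y u); have [->|uy] := eqVneq u y => //=.
  by rewrite orbF.
rewrite /= (fun_if (fun A : {set _} => u \in A)) !inE; have [->|ux] := eqVneq u x.
  by rewrite /= (negbTE xy) !andbF if_same.
have [->|uy] := eqVneq u y; rewrite /= ?vy.
  by case: (adj G x v); rewrite ?orbT ?orbF.
by rewrite orbF adjN if_same.
Qed.

Lemma nb_add_edge G x y v : x != y -> nb (add_edge G x y) v =
  if v == x then y |: nb G x else if v == y then x |: nb G y else nb G v.
Proof.
move=> xy; have adjN a b : (a != b) && adj G a b = adj G a b.
  by case: (boolP (adj G a b)) => [/adj_neq->//|]; rewrite andbF.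
apply/setP=> u; rewrite [LHS]in_nb adj_of_rel (adjC G u v).
have yx : (y == x) = false by rewrite eq_sym (negbTE xy).
have [->|vx] := eqVneq v x.
  rewrite !inE (eq_sym x u); have [->|ux] := eqVneq u x; first by rewrite adjxx (negbTE xy).
  by case: (adj G x u); case: (u == y); rewrite /= ?andbF.
have [->|vy] := eqVneq v y; last by rewrite !inE /= !andbF !orbF orbb adjN.
rewrite !inE /= ?andbT (eq_sym y u); have [->|ux] := eqVneq u x.
  by rewrite xy !orbT.
have := adjN y u; rewrite (eq_sym y u).
by case: (adj G y u); case: (u == y).
Qed.

Lemma adj_del_edge G x y u v :
  adj (del_edge G x y) u v = adj G u v && ([set u; v] != [set x; y]).
Proof.
rewrite adj_of_rel (adjC G v u) (setUC [set v]) orbb.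
by case: (boolP (adj G u v)) => [/adj_neq->//|]; rewrite andbF.
Qed.

Lemma Dom_del_edge G x y a b : adj G x y -> nb G a = [set x] -> nb G b = [set y] ->
  a != y -> b != x -> Dom (del_edge G x y) = Dom G.
Proof.
move=> Gxy Na Nb ay bx; rewrite /Dom; apply: eq_bigl => S.
(* S meets N[c] = {c, p}, so p stays dominated once pq is removed. *)
have aux p q c : [set p; q] = [set x; y] -> dominating G S -> nb G c = [set p] -> c != q ->
    (p \in S) || [exists u in S, adj (del_edge G x y) u p].
  move=> pq /forallP/(_ c) dS Nc cq; rewrite -implyNb; apply/implyP => pS.
  have cp : adj G c p by rewrite -in_nb Nc inE.
  have cS : c \in S.
    case/orP: dS => // /exists_inP[u uS]; rewrite adjC -in_nb Nc inE => /eqP up.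
    by rewrite up (negbTE pS) in uS.
  apply/exists_inP; exists c => //; rewrite adj_del_edge cp -pq /=.
  apply: contraNneq cq => /setP/(_ c); rewrite !inE eqxx /= => /esym.
  by rewrite (negbTE (adj_neq cp)).
apply/idP/idP => [/forallP dS|dS].
  apply/forallP => v; case/orP: (dS v) => [->//|/exists_inP[u uS]].
  rewrite adj_del_edge => /andP[uv _]; apply/orP; right; apply/exists_inP; by exists u.
apply/forallP => v; case/orP: (forallP dS v) => [->//|/exists_inP[u uS uv]].
have [e|ne] := eqVneq [set u; v] [set x; y]; last first.
  apply/orP; right; apply/exists_inP; exists u => //; by rewrite adj_del_edge uv.
have : v \in [set x; y] by rewrite -e !inE eqxx orbT.
rewrite !inE => /orP[/eqP->|/eqP->]; first exact: (aux _ y a).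
by apply: (aux _ x b) => //; rewrite setUC.
Qed.

(** An isomorphism would inject the oriented edges of [G] into those of a graph with fewer edges. *)
Lemma del_edge_not_isomorphic G x y : adj G x y -> ~ isomorphic G (del_edge G x y).
Proof.
move=> Gxy [f [bf fH]]; pose E (J : graph n) := [set p | adj J p.1 p.2].
have : #|E (del_edge G x y)| < #|E G|.
  apply: proper_card; apply/properP; split.
    by apply/subsetP => p; rewrite !inE adj_del_edge => /andP[].
  by exists (x, y); rewrite !inE //= adj_del_edge eqxx andbF.
rewrite ltnNge => /negP; apply.
have injf : injective (fun p : 'I_n * 'I_n => (f p.1, f p.2)).
  by move=> [u v] [u' v'] [] /(bij_inj bf)-> /(bij_inj bf)->.
rewrite -(card_imset (mem (E G)) injf); apply: subset_leq_card.
by apply/subsetP => p /imsetP[q]; rewrite !inE => Gq ->; rewrite fH.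
Qed.

End Ops.

End EdgeOperations.

(** * Reducible vertices in sparse classes of graphs *)

Module SparseGraphs.

Import Defs.
Import Adjacency EdgeOperations.

Lemma card_bigcup_leq (I T : finType) (F : I -> {set T}) b :
  (forall i, #|F i| <= b) -> #|\bigcup_i F i| <= b * #|I|.
Proof.
move=> Fb; rewrite mulnC -sum_nat_const.
elim/big_rec2: _ => [|i m A _ Am]; first by rewrite cards0.
by rewrite (leq_trans (leq_card_setU _ _))// leq_add ?Fb.
Qed.

(** The factor [k] allows a lower bound [a / k] on degrees without division. *)
Lemma double_count (X Y : finType) (A : {set X}) (B : {set Y}) (R : X -> Y -> bool) a k b :
  (forall x, x \in A -> a <= k * #|[set y in B | R x y]|) ->
  (forall y, y \in B -> #|[set x in A | R x y]| <= b) ->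
  a * #|A| <= k * b * #|B|.
Proof.
move=> RA RB; rewrite mulnC -sum_nat_const.
apply: (@leq_trans (\sum_(x in A) k * \sum_(y in B) R x y)).
  apply: leq_sum => x /RA; congr (_ <= k * _).
  by rewrite -big_mkcondr -sum1_card /=; apply: eq_bigl => y; rewrite inE.
rewrite -big_distrr /= exchange_big /= -mulnA leq_mul2l mulnC -sum_nat_const; apply/orP; right.
apply: leq_sum => y /RB; congr (_ <= b).
by rewrite -big_mkcondr -sum1_card /=; apply: eq_bigl => x; rewrite inE.
Qed.

Section Cliques.
Variable n : nat.
Implicit Types (G : graph n) (A Q : {set 'I_n}).

Definition degsum G A := \sum_(v in A) #|nb G v :&: A|.

Definition clique G Q := [forall u in Q, forall v in Q, (u != v) ==> adj G u v].

(** Degeneracy: by averaging, some [v] of [A] has at most [c] neighbours in [A], so at most [2 ^ c]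
    cliques contain [v], and the others lie in [A :\ v]. The final 1 counts the empty clique. *)
Lemma card_cliques G c A :
  (forall B : {set 'I_n}, B \subset A -> degsum G B <= c * #|B|) ->
  #|[set Q in powerset A | clique G Q]| <= 2 ^ c * #|A| + 1.
Proof.
elim: {A}#|A| {-2}A (leqnn #|A|) => [|m IH] A Am hA.
  move: Am hA; rewrite leqn0 cards_eq0 => /eqP-> _.
  rewrite cards0 muln0; apply: (@leq_trans #|[set set0 : {set 'I_n}]|); last by rewrite cards1.
  by apply: subset_leq_card; apply/subsetP => Q; rewrite !inE subset0 => /andP[].
have [A0|/set0Pn[a0 a0A]] := eqVneq A set0.
  by apply: IH; rewrite // A0 cards0.
have /exists_inP[v vA vc] : [exists v in A, #|nb G v :&: A| <= c].
  apply: contraT => /exists_inPn h; have := hA A (subxx _); rewrite leqNgt => /negP[].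
  rewrite (@leq_trans (\sum_(v in A) c.+1)) //.
    by rewrite sum_nat_const mulnC ltn_pmul2l // (cardD1 a0) a0A.
  by apply: leq_sum => v /h; rewrite -ltnNge.
pose F Q := v |: Q.
have /subset_leq_card : [set Q in powerset A | clique G Q] \subset
   [set F Q | Q in powerset (nb G v :&: A)] :|: [set Q in powerset (A :\ v) | clique G Q].
  apply/subsetP=> Q; rewrite !inE => /andP[QA cQ].
  have [vQ|vQ] := boolP (v \in Q); apply/orP; [left|right]; last first.
    by rewrite cQ andbT subsetD1 QA vQ.
  apply/imsetP; exists (Q :\ v); last by rewrite /F setD1K.
  rewrite powersetE; apply/subsetP => u; rewrite !inE => /andP[uv uQ].
  rewrite (subsetP QA _ uQ) andbT; move/forall_inP: cQ => /(_ v vQ)/forall_inP/(_ u uQ).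
  by rewrite eq_sym uv.
move/leq_trans; apply; apply: (leq_trans (leq_card_setU _ _)).
have Av : #|A| = #|A :\ v|.+1 by rewrite (cardsD1 v) vA.
have le1 : #|[set F Q | Q in powerset (nb G v :&: A)]| <= 2 ^ c.
  by rewrite (leq_trans (leq_imset_card _ _)) // card_powerset leq_exp2l.
have le2 : #|[set Q in powerset (A :\ v) | clique G Q]| <= 2 ^ c * #|A :\ v| + 1.
  apply: IH => [|B BA]; first by rewrite -ltnS -Av.
  by apply: hA; rewrite (subset_trans BA) // subsetDl.
rewrite Av mulnS; lia.
Qed.

End Cliques.

Section Class.
Variables (n c : nat) (C : {set graph n}).
Implicit Types (G H : graph n) (u v w x y z : 'I_n).
Hypothesis c_gt0 : 0 < c.
Hypothesis C_contract : forall G x y, G \in C -> adj G x y -> contract G x y \in C.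
Hypothesis C_isolate : forall G x, G \in C -> isolate G x \in C.
Hypothesis C_leaf : forall G x u, G \in C -> isolated G x -> x != u -> add_edge G x u \in C.
Hypothesis C_sparse : forall G A, G \in C -> degsum G A <= c * #|A|.

(* Contracting x into a neighbour creates a new edge inside B as long as N(x) is
   not a clique. *)
Lemma card_inj_nb G (U B : {set 'I_n}) : G \in C -> [disjoint U & B] ->
  {in U, forall x, nb G x \subset B} -> {in U &, injective (nb G)} ->
  #|U| + degsum G B <= (c + 2 ^ c) * #|B| + 1.
Proof.
elim: {U}#|U| {-2}U (erefl #|U|) G => [|m IH] U Um G GC dUB UB injU.
  by rewrite Um add0n mulnDl -addnA (leq_trans (C_sparse _ GC)) // leq_addr.
(* If all these neighbourhoods are cliques, they are distinct cliques inside [B], and [card_cliques]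
   applies. *)
have [cl|] := boolP [forall x in U, clique G (nb G x)].
  rewrite addnC mulnDl -addnA leq_add ?C_sparse //.
  rewrite -(card_in_imset injU) (leq_trans _ (@card_cliques _ G c B _)) //; last first.
    by move=> ? _; apply: C_sparse.
  apply: subset_leq_card; apply/subsetP => _ /imsetP[x xU ->].
  by rewrite inE powersetE UB //= (forall_inP cl).
rewrite negb_forall_in => /exists_inP[x xU].
rewrite negb_forall_in => /exists_inP[a ax]; rewrite negb_forall_in => /exists_inP[b bx].
rewrite negb_imply => /andP[ab nab]; rewrite !in_nb in ax bx.
have xa := adj_neq ax; have xb := adj_neq bx.
have aB : a \in B by apply: (subsetP (UB _ xU)); rewrite in_nb.
have bB : b \in B by apply: (subsetP (UB _ xU)); rewrite in_nb.
have xB : x \notin B by rewrite (disjointFr dUB).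
(* Neighbourhoods of [U] lie in [B], so no other vertex of [U] is adjacent to [x], and the
   contraction leaves their neighbourhoods alone. *)
have nbE v : v \in U :\ x -> nb (contract G x a) v = nb G v.
  rewrite !inE => /andP[vx vU]; rewrite nb_contract // (negbTE vx).
  have vB : v \notin B by rewrite (disjointFr dUB).
  have xv : x \notin nb G v by apply: contra xB; apply/subsetP/UB.
  rewrite ifN; last by apply: contraNneq vB => ->.
  rewrite ifN; last by rewrite in_nb adjC -in_nb.
  by apply/setDidPl; rewrite disjoint_sym disjoints1.
have := IH (U :\ x) _ (contract G x a); rewrite (cardsD1 x U) xU in Um *.
have lt : degsum G B < degsum (contract G x a) B.
  have le v : v \in B -> nb G v :&: B \subset nb (contract G x a) v :&: B.
    move=> vB; apply/subsetP => u; rewrite inE => /andP[uv uB]; rewrite inE uB andbT.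
    have vx : v != x by apply: contraNneq xB => <-.
    have ux : u != x by apply: contraNneq xB => <-.
    rewrite nb_contract // (negbTE vx).
    case: ifP => [/eqP va|_]; last by case: ifP; rewrite !inE ux in uv *; rewrite uv ?orbT.
    rewrite !inE ux in uv *; by rewrite -va uv andbT eq_sym (adj_neq uv).
  rewrite /degsum (bigD1 a) //= [X in _ < X](bigD1 a) //= -addSn leq_add //.
    apply: proper_card; rewrite properE le //=; apply/subsetPn; exists b.
      by rewrite inE bB nb_contract // eq_sym (negbTE xa) eqxx !inE bx orbT !andbT (eq_sym b a) (eq_sym b x) ab xb.
    by rewrite inE in_nb (negbTE nab).
  by apply: leq_sum => v /andP[vB _]; apply/subset_leq_card/le.
move=> IHx; apply: leq_trans (IHx _ _ _ _ _); first by rewrite add1n addSnnS leq_add2l.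
- by move: Um; rewrite add1n => -[].
- exact: C_contract.
- by rewrite (disjointWl _ dUB) // subsetDl.
- by move=> v vU; rewrite nbE //; apply: UB; move: vU; rewrite inE => /andP[].
- move=> v w vU wU; rewrite !nbE //; move: vU wU; rewrite !inE => /andP[_ vU] /andP[_ wU].
  exact: injU.
Qed.

(** Sparsity gives [D * #|B| <= c * n] for the set [B] of vertices of degree above [D], so that
    [(c + 2 ^ c) * #|B|], the main term of [card_inj_nb], is at most n / 8. *)
Let D := 8 * c * (c + 2 ^ c).

Definition light G x y := [&& adj G x y, #|nb G x| <= D & #|nb G y| <= D].
Definition twin G x y := [&& x != y, nb G x == nb G y & #|nb G x| <= D].
(** Only [x] is recorded, not [y]; this costs a factor n in the number of preimages. *)
Definition reduces G x H :=
  [exists y, light G x y && (H == contract G x y)] || [exists y, twin G x y && (H == isolate G x)].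

(** A vertex of degree at most [D] outside [L] has all its neighbours in [B], and those without a
    twin have distinct neighbourhoods. So [B] and [S :\: T] together hold at most n / 4 + 1
    vertices; [1 < n] absorbs the 1. *)
Lemma reducible_many G : 1 < n -> G \in C ->
  n <= 4 * #|[set x | [exists H in C, reduces G x H]]|.
Proof.
move=> n1 GC; pose B := [set v | D < #|nb G v|].
pose L := [set x | (x \notin B) && [exists y, (y \notin B) && adj G x y]].
pose S := [set x | (x \notin B) && (nb G x \subset B)].
pose T := [set x in S | [exists y, [&& y \in S, y != x & nb G x == nb G y]]].
have B8 : 8 * (c + 2 ^ c) * #|B| <= n.
  rewrite -(leq_pmul2l c_gt0) !mulnA (mulnC c 8) -/D.
  apply: leq_trans (_ : degsum G setT <= _); last first.
    by rewrite (leq_trans (C_sparse _ GC)) // cardsT card_ord.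
  rewrite /degsum (bigID (mem B)) /= (leq_trans _ (leq_addr _ _)) // mulnC -sum_nat_const.
  rewrite [X in _ <= X](eq_bigl (mem B)); last by move=> v; rewrite inE.
  by apply: leq_sum => v; rewrite inE setIT => /ltnW.
have U8 : #|S :\: T| <= (c + 2 ^ c) * #|B| + 1.
  apply: leq_trans (leq_addr (degsum G B) _) _; apply: card_inj_nb => //.
  - rewrite disjoints_subset; apply/subsetP => x; rewrite !inE.
    by case: (_ < _); rewrite ?andbF.
  - by move=> x; rewrite !inE => /andP[_ /andP[]].
  - move=> x y; rewrite 2!inE => /andP[]; rewrite inE => + xS; rewrite xS /=.
    move=> /existsPn/(_ y) + /[!inE] /andP[_ yS] exy.
    by rewrite !inE yS exy eqxx andbT /= negbK eq_sym => /eqP.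
have TL : T :|: L \subset [set x | [exists H in C, reduces G x H]].
  apply/subsetP=> x; rewrite in_setU [x \in [set _ | _]]inE => /orP[]; rewrite inE.
    move=> /andP[xS /existsP[y /and3P[yS yx exy]]]; apply/exists_inP.
    exists (isolate G x); first exact: C_isolate.
    apply/orP; right; apply/existsP; exists y; rewrite /twin eq_sym yx exy eqxx /= andbT.
    by move: xS; rewrite !inE -leqNgt => /andP[].
  move=> /andP[xB /existsP[y /andP[yB xy]]]; apply/exists_inP.
  exists (contract G x y); first exact: C_contract.
  apply/orP; left; apply/existsP; exists y.
  by move: xB yB; rewrite !inE -!leqNgt /light xy eqxx => -> ->.
have cov : [set: 'I_n] \subset B :|: (S :\: T) :|: (T :|: L).
  apply/subsetP => x _; rewrite in_setU [x \in B :|: _]in_setU.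
  have [//|xB] := boolP (x \in B); rewrite in_setU.
  have [xT|xT] := boolP (x \in T); first by rewrite orbT.
  rewrite in_setD xT /=; have [//|] := boolP (x \in S); rewrite inE xB /= => /subsetPn[y].
  rewrite in_nb => xy yB; rewrite /L inE xB /=; apply/existsP; exists y; by rewrite yB.
have := subset_leq_card cov; rewrite cardsT card_ord => h1.
have h2 := leq_trans h1 (leq_card_setU _ _).
have h3 := leq_card_setU B (S :\: T).
have h4 := subset_leq_card TL.
have h5 : #|B| <= (c + 2 ^ c) * #|B| by rewrite leq_pmull // addn_gt0 c_gt0.
rewrite -mulnA in B8.
have aux (m s t b u g r : nat) : 1 < m -> m <= s + t -> s <= b + u -> t <= r ->
  u <= g + 1 -> 8 * g <= m -> b <= g -> m <= 4 * r by clear; lia.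
exact: aux n1 h2 h3 h4 U8 B8 h5.
Qed.

(** A contraction is undone by two subsets of [nb H y], which has at most [2 * D] elements; the 1 is
    for the isolation of a twin, undone in one way. *)
Definition Mconst := (2 ^ (2 * D)) ^ 2 + 1.

Lemma card_reduces_pre x H : #|[set G | reduces G x H]| <= Mconst * n.
Proof.
pose A y := [set G | light G x y && (H == contract G x y)].
pose B y := [set G | twin G x y && (H == isolate G x)].
have sub : [set G | reduces G x H] \subset \bigcup_y (A y :|: B y).
  apply/subsetP => G; rewrite inE => /orP[]/existsP[y h]; apply/bigcupP; exists y => //;
  by rewrite !inE h ?orbT.
rewrite (leq_trans (subset_leq_card sub)) // -[X in _ * X]card_ord card_bigcup_leq // => y.
apply: leq_trans (leq_card_setU _ _) _; apply: leq_add.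
  have [->|/set0Pn[G0]] := eqVneq (A y) set0; first by rewrite cards0.
  move=> G0A; have := G0A; rewrite inE => /andP[/and3P[xy0 dx dy] _].
  have xy := adj_neq xy0.
  have NH G : G \in A y -> nb H y = (nb G y :|: nb G x) :\ x :\ y.
    rewrite inE => /andP[/and3P[a _ _] /eqP->].
    by rewrite nb_contract // eq_sym (negbTE xy) eqxx.
  have HD : #|nb H y| <= 2 * D.
    rewrite (NH G0) //.
    rewrite (leq_trans (subset_leq_card (subsetDl _ _))) //.
    rewrite (leq_trans (subset_leq_card (subsetDl _ _))) //.
    by rewrite (leq_trans (leq_card_setU _ _)) // mul2n -addnn leq_add.
  (* The old neighbourhoods of [x] and [y] determine [G]: any other vertex lost [x] and possibly
     gained [y], and [F] decides both. *)
  pose F G := (nb G x :\ y, nb G y :\ x).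
  have injF : {in A y &, injective F}.
    have key G v : G \in A y -> nb G v = if v == x then y |: (F G).1
        else if v == y then x |: (F G).2
        else if v \in (F G).1 then x |: (if v \in (F G).2 then nb H v else nb H v :\ y)
        else nb H v.
      rewrite inE => /andP[/and3P[a _ _] /eqP->]; rewrite /F /=.
      case: ifP => [/eqP->|vx]; first by rewrite setD1K // in_nb.
      case: ifP => [/eqP->|vy]; first by rewrite setD1K // in_nb adjC.
      rewrite nb_contract // vx vy !inE vx vy /=.
      have yv : (y \in nb G v) = adj G y v by rewrite in_nb adjC.
      have xv : (x \in nb G v) = adj G x v by rewrite in_nb adjC.
      case: (boolP (adj G x v)) => axv; last first.
        by apply/esym/setDidPl; rewrite disjoint_sym disjoints1 xv.
      case: ifP => ayv; apply/setP => w; rewrite !inE.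
        have [->|wx] := eqVneq w x; first by rewrite adjC axv.
        by have [->|//] := eqVneq w y; rewrite adjC ayv.
      have [->|wx] := eqVneq w x; first by rewrite adjC axv.
      by have [->|//] := eqVneq w y; rewrite adjC ayv.
    move=> G1 G2 G1A G2A e; apply: eq_graph_nb => v; by rewrite (key G1 v) // (key G2 v) // e.
  rewrite -(card_in_imset injF).
  apply: (@leq_trans #|setX (powerset (nb H y)) (powerset (nb H y))|); last first.
    by rewrite cardsX !card_powerset mulnn leq_exp2r // leq_exp2l.
  apply: subset_leq_card; apply/subsetP => _ /imsetP[G GA ->].
  rewrite inE !powersetE (NH G) //=; apply/andP; split; apply/subsetP=> w; rewrite !inE.
    by move=> /andP[-> a]; rewrite a orbT andbT eq_sym (adj_neq a).
  by move=> /andP[-> a]; rewrite a /= andbT eq_sym (adj_neq a).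
rewrite leqNgt; apply/card_gt1P => -[G1 [G2 [h1 h2 /negP[]]]]; apply/eqP/eq_graph_nb => v.
(* The isolated vertex recovers its neighbourhood from its twin [y], and every neighbour of [y]
   regains [x]. *)
have key G : G \in B y -> nb G v =
    if v == x then nb H y else if v \in nb H y then x |: nb H v else nb H v.
  rewrite inE => /andP[/and3P[xy /eqP e _] /eqP->]; rewrite !nb_isolate (eq_sym y) (negbTE xy).
  have xNy : x \notin nb G y by rewrite -e in_nb adjxx.
  have Ny : nb G y :\ x = nb G y by apply/setDidPl; rewrite disjoint_sym disjoints1.
  case: ifP => [/eqP->|vx]; first by rewrite Ny e.
  rewrite vx Ny -e in_nb; case: ifP => h; first by rewrite setD1K // in_nb adjC.
  by apply/esym/setDidPl; rewrite disjoint_sym disjoints1 in_nb adjC h.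
by rewrite (key G1) // (key G2).
Qed.

End Class.

End SparseGraphs.

(** * Pendant patterns and the effect of local changes on them *)

Module PendantStructures.

Import Defs.
Import Adjacency EdgeOperations SparseGraphs.

Section Change.
Variable n : nat.
Implicit Types (G H : graph n) (u v w x y z : 'I_n).

Definition changed G H := [set v | nb G v != nb H v].

Lemma changed_trans G H J : #|changed G J| <= #|changed G H| + #|changed H J|.
Proof.
apply: leq_trans (leq_card_setU _ _); apply/subset_leq_card/subsetP => v; rewrite !inE.
by have [->|] := eqVneq (nb G v) (nb H v).
Qed.

(** Only [x], [y] and the neighbours of [x] see a change. *)
Lemma card_changed_reduces c G x H : reduces c G x H ->
  #|changed G H| <= 8 * c * (c + 2 ^ c) + 2.
Proof.
have bound y : #|nb G x| <= 8 * c * (c + 2 ^ c) -> #|x |: (y |: nb G x)| <= 8 * c * (c + 2 ^ c) + 2.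
  move=> dx; rewrite (leq_trans (leq_card_setU _ _)) // cards1 addn2 ltnS.
  by rewrite (leq_trans (leq_card_setU _ _)) // cards1 ltnS.
case/orP=> /existsP[y /andP[/and3P[h1 h2 h3] /eqP->]].
  apply: leq_trans (bound y h2); apply/subset_leq_card/subsetP => v.
  rewrite !inE (nb_contract _ _ (adj_neq h1)); apply: contraR.
  rewrite !negb_or => /and3P[vx vy vNx]; rewrite (negbTE vx) (negbTE vy) inE (negbTE vNx).
  apply/eqP/esym/setDidPl; rewrite disjoint_sym disjoints1 in_nb adjC; exact: vNx.
apply: leq_trans (bound y h3); apply/subset_leq_card/subsetP => v.
rewrite !inE nb_isolate; apply: contraR.
rewrite !negb_or => /and3P[vx vy vNx]; rewrite (negbTE vx).
by apply/eqP/esym/setDidPl; rewrite disjoint_sym disjoints1 in_nb adjC.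
Qed.

(** Vertices freed earlier stay free, so that four reductions leave four isolated vertices. *)
Lemma isolated_reduces c G x H z : reduces c G x H -> isolated G z || (z == x) -> isolated H z.
Proof.
rewrite /isolated; case/orP=> /existsP[y /andP[/and3P[h1 h2 h3] /eqP->]].
  rewrite nb_contract ?(adj_neq h1) //; have [//|zx /=] := eqVneq z x; rewrite orbF.
  move=> /eqP z0; have [zy|zy] := eqVneq z y.
    by move: h1; rewrite adjC -in_nb -zy z0 inE.
  by rewrite ifN ?z0 ?set0D // in_nb adjC -in_nb z0 inE.
rewrite nb_isolate; have [//|zx /=] := eqVneq z x; rewrite orbF => /eqP->.
by rewrite set0D.
Qed.

(* The pattern: u - x1 - x2 with a leaf y1 hanging at x1 and a leaf y2 at x2. *)
Definition pendant G (t : 'I_n * 'I_n * 'I_n * 'I_n * 'I_n) :=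
  let: (x1, x2, y1, y2, u) := t in
  [&& uniq [:: x1; x2; y1; y2; u], nb G y1 == [set x1], nb G y2 == [set x2],
      nb G x2 == [set x1; y2] & nb G x1 == [set u; x2; y1]].

Definition pendants G := [set t | pendant G t].

(** [pendant] reads only the neighbourhoods of [x1], [x2], [y1], [y2], so each copy in [H] has one
    of them changed. From that vertex [x1] is found among 7 candidates, and the 3 neighbours of [x1]
    give 27 triples: 189 = 7 * 27. *)
Lemma card_pendants G H : pendants G = set0 -> #|pendants H| <= 189 * #|changed G H|.
Proof.
move=> G0; pose W := changed G H.
(* [x2], [y1], [y2] have degree at most 2, and [x1] is at most two steps away through such vertices:
   1 + 2 + 4 candidates. *)
pose S z := if #|nb H z| <= 2 then nb H z else set0.
pose g w := w |: (S w :|: \bigcup_(z in S w) S z).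
pose Z := [set x | (#|nb H x| == 3) && [exists w in W, x \in g w]].
have S2 z : #|S z| <= 2 by rewrite /S; case: ifP => // _; rewrite cards0.
have gW w : #|g w| <= 7.
  rewrite (leq_trans (leq_card_setU _ _)) // cards1 add1n ltnS.
  rewrite (leq_trans (leq_card_setU _ _)) // (leq_add (S2 w) (_ : _ <= 4)) //.
  apply: (@leq_trans (\sum_(z in S w) 2)); last by rewrite sum_nat_const (leq_mul (S2 w) (leqnn 2)).
  elim/big_rec2: _ => [|i m A _ Am]; first by rewrite cards0.
  by rewrite (leq_trans (leq_card_setU _ _))// leq_add ?S2.
have ZW : #|Z| <= 7 * #|W|.
  apply: (@leq_trans #|\bigcup_(w in W) g w|).
    apply/subset_leq_card/subsetP => x; rewrite inE => /andP[_ /exists_inP[w wW xw]].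
    by apply/bigcupP; exists w.
  rewrite mulnC -sum_nat_const.
  elim/big_rec2: _ => [|i m A _ Am]; first by rewrite cards0.
  by rewrite (leq_trans (leq_card_setU _ _))// leq_add.
pose E := [set q : 'I_n * ('I_n * 'I_n * 'I_n) | (q.1 \in Z) &&
   (q.2 \in setX (setX (nb H q.1) (nb H q.1)) (nb H q.1))].
have E27 : #|E| <= 27 * #|Z|.
  apply: (@leq_trans (\sum_(x in Z) 27)); last by rewrite sum_nat_const mulnC.
  rewrite -sum1_card (partition_big fst (mem Z)) /=; last by move=> q; rewrite inE => /andP[].
  apply: leq_sum => x xZ; rewrite sum1_card.
  have e3 : #|nb H x| = 3 by move: xZ; rewrite inE => /andP[/eqP].
  have <- : #|[set (x, t) | t in setX (setX (nb H x) (nb H x)) (nb H x)]| = 27.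
    by rewrite card_imset ?cardsX ?e3 // => ? ? [].
  apply: subset_leq_card; apply/subsetP => -[x' t]; rewrite unfold_in inE /= => /andP[/andP[_ h] /eqP e].
  by rewrite e in h *; apply: imset_f.
(* [y2] may be dropped: it is the neighbour of [x2] other than [x1]. *)
pose F (t : 'I_n * 'I_n * 'I_n * 'I_n * 'I_n) : 'I_n * ('I_n * 'I_n * 'I_n) :=
  let: (x1, x2, y1, y2, u) := t in (x1, (x2, y1, u)).
have injF : {in pendants H &, injective F}.
  move=> [[[[x1 x2] y1] y2] u] [[[[a1 a2] b1] b2] w]; rewrite !inE => h1 h2 [? ? ? ?]; subst.
  case/and5P: h1 => _ _ _ /eqP e _; case/and5P: h2 => un _ _ /eqP e' _.
  have : b2 \in nb H a2 by rewrite e' !inE eqxx orbT.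
  rewrite e !inE => /orP[/eqP ba|/eqP->//].
  by move: un; rewrite /= !inE ba eqxx ?orbT ?andbF.
rewrite -(card_in_imset injF) (@leq_trans #|E|) //; last first.
  rewrite (leq_trans E27) // -[189]/(27 * 7) -mulnA leq_pmul2l //.
apply/subset_leq_card/subsetP => _ /imsetP[[[[[x1 x2] y1] y2] u] ht ->].
have nG : ~~ pendant G (x1, x2, y1, y2, u).
  by apply/negP => h; have := in_set0 (x1, x2, y1, y2, u); rewrite -G0 inE h.
move: ht; rewrite inE => ht; case/and5P: (ht) => un /eqP e1 /eqP e2 /eqP e3 /eqP e4.
have c3 : #|nb H x1| == 3.
  rewrite e4 -setUA !cardsU1 !inE cards1; move: un; rewrite /= !inE !negb_or.
  move=> /andP[_ /andP[/and3P[x2y1 _ x2u]]] /andP[/andP[_ y1u] _].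
  by rewrite (eq_sym u x2) (negbTE x2u) (eq_sym u y1) (negbTE y1u) (negbTE x2y1).
have c2 : #|nb H x2| <= 2 by rewrite e3 cards2; case: eqP.
have [c1 c1'] : #|nb H y1| <= 2 /\ #|nb H y2| <= 2 by rewrite e1 e2 !cards1.
have m1 : x1 \in nb H x2 by rewrite e3 !inE eqxx.
have m2 : x1 \in nb H y1 by rewrite e1 inE.
have m3 : x2 \in nb H y2 by rewrite e2 inE.
rewrite inE /= !inE c3 -!in_nb e4 !inE !eqxx ?orbT !andbT /=.
have [] : [\/ x1 \in W, x2 \in W, y1 \in W | y2 \in W].
  apply/or4P; rewrite !inE; apply: contraR nG; rewrite !negb_or !negbK.
  move=> /and4P[/eqP f1 /eqP f2 /eqP f3 /eqP f4].
  by rewrite /pendant f1 f2 f3 f4.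
- by move=> h; apply/exists_inP; exists x1; rewrite // /g !inE eqxx.
- by move=> h; apply/exists_inP; exists x2; rewrite // /g !in_setU /S c2 m1 orbT.
- by move=> h; apply/exists_inP; exists y1; rewrite // /g !in_setU /S c1 m2 orbT.
move=> h; apply/exists_inP; exists y2; rewrite // /g !in_setU; apply/or3P/Or33/bigcupP.
by exists x2; rewrite /S ?c1' ?c2.
Qed.

(** Each of the four edges is added at a vertex that is still isolated, so closure under leaves
    covers every stage. *)
Definition attach G (t : 'I_n * 'I_n * 'I_n * 'I_n * 'I_n) :=
  let: (x1, x2, y1, y2, u) := t in
  add_edge (add_edge (add_edge (add_edge G x1 u) x2 x1) y1 x1) y2 x2.

Lemma nb_attach G x1 x2 y1 y2 u v : uniq [:: x1; x2; y1; y2; u] ->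
  all (isolated G) [:: x1; x2; y1; y2] ->
  nb (attach G (x1, x2, y1, y2, u)) v =
    if v == x1 then [set u; x2; y1] else if v == x2 then [set x1; y2]
    else if v == y1 then [set x1] else if v == y2 then [set x2]
    else if v == u then x1 |: nb G u else nb G v.
Proof.
rewrite /= !inE !negb_or !andbT => /and4P[/and4P[a1 a2 a3 a4] /and3P[a5 a6 a7] /andP[a8 a9] a10].
move=> /and4P[/eqP i1 /eqP i2 /eqP i3 /eqP i4].
have b1 := a1; have b2 := a2; have b3 := a3; have b4 := a4; have b5 := a5.
have b6 := a6; have b7 := a7; have b8 := a8; have b9 := a9; have b10 := a10.
rewrite eq_sym in b1; rewrite eq_sym in b2; rewrite eq_sym in b3; rewrite eq_sym in b4; rewrite eq_sym in b5;
rewrite eq_sym in b6; rewrite eq_sym in b7; rewrite eq_sym in b8; rewrite eq_sym in b9; rewrite eq_sym in b10.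
have nE := (negbTE a1, negbTE a2, negbTE a3, negbTE a4, negbTE a5, negbTE a6,
 negbTE a7, negbTE a8, negbTE a9, negbTE a10, negbTE b1, negbTE b2, negbTE b3, negbTE b4, negbTE b5, negbTE b6,
 negbTE b7, negbTE b8, negbTE b9, negbTE b10, eqxx).
rewrite !nb_add_edge // !nE i1 i2 i3 i4 !setU0.
have [->|v1] := eqVneq v x1.
  by rewrite !nE; apply/setP => w; rewrite !inE; case: (w == u); case: (w == x2); case: (w == y1).
have [->|v2] := eqVneq v x2; first by rewrite !nE setUC.
have [->|v3] := eqVneq v y1; first by rewrite !nE.
by [].
Qed.

End Change.

End PendantStructures.

(** * Counting pendant-free graphs by reduction and reattachment *)

Module Counting.

Import Defs.
Import Adjacency EdgeOperations SparseGraphs PendantStructures.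

Section Class2.
Variables (n c : nat) (C : {set graph n}).
Implicit Types (G H : graph n) (u v w x y z : 'I_n).
Hypothesis c_gt0 : 0 < c.
Hypothesis C_contract : forall G x y, G \in C -> adj G x y -> contract G x y \in C.
Hypothesis C_isolate : forall G x, G \in C -> isolate G x \in C.
Hypothesis C_leaf : forall G x u, G \in C -> isolated G x -> x != u -> add_edge G x u \in C.
Hypothesis C_sparse : forall G A, G \in C -> degsum G A <= c * #|A|.

Definition pendant_free := [set G in C | pendants G == set0].

Let d := 8 * c * (c + 2 ^ c) + 2.

(** The distance to a pendant-free graph is tracked along the reductions, since it bounds the number
    of pendants at the end. *)
Definition near j G := [exists G0 in pendant_free, #|changed G0 G| <= j].

(* Graphs reached from a pendant-free graph of C by freeing the vertices listed in
   the tuple, one at a time. *)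
Definition states i := [set p : graph n * i.-tuple 'I_n |
  [&& p.1 \in C, near (i * d) p.1, uniq p.2 & all (isolated p.1) p.2]].

(** A state has at least n / 8 successors: n / 4 reducible vertices, less the [i <= 3] already
    freed, where 3 is at most n / 8 by [24 <= n]. A successor has at most [Mconst c * n]
    predecessors. *)
Lemma card_states_step i : i <= 3 -> 24 <= n ->
  #|states i| <= 8 * Mconst c * #|states i.+1|.
Proof.
move=> i3 n24; have n_gt0 : 0 < n by apply: leq_trans n24.
pose R (p : graph n * i.-tuple 'I_n) (q : graph n * i.+1.-tuple 'I_n) :=
  reduces c p.1 (thead q.2) q.1 && (p.2 == [tuple of behead q.2]).
rewrite -(leq_pmul2l n_gt0).
have -> : n * (8 * Mconst c * #|states i.+1|) = 8 * (Mconst c * n) * #|states i.+1|.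
  by rewrite mulnC -!mulnA (mulnC n).
apply: (double_count (R := R)) => [[G t]|[H t]]; last first.
  move=> _; apply: leq_trans (card_reduces_pre c (thead t) H).
  have injf : {in [set x in states i | R x (H, t)] &, injective fst}.
    move=> [G1 t1] [G2 t2]; rewrite !inE /R /= => /andP[_ /andP[_ /eqP->]].
    by move=> /andP[_ /andP[_ /eqP->]] ->.
  rewrite -(card_in_imset injf); apply/subset_leq_card/subsetP => _ /imsetP[[G t'] + ->].
  by rewrite !inE /R /= => /andP[_ /andP[]].
rewrite inE /= => /and4P[GC /exists_inP[G0 G0P G0G] ut it].
pose X := [set x | [exists H in C, reduces c G x H]] :\: [set x in t].
have cX : n <= 8 * #|X|.
  have h1 := reducible_many c_gt0 C_contract C_isolate C_sparse (leq_trans (isT : 1 < 24) n24) GC.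
  have h2 : #|[set x | [exists H in C, reduces c G x H]]| <= #|X| + i.
    rewrite -(cardsID [set x in t]) addnC leq_add2l.
    rewrite (leq_trans (subset_leq_card (subsetIr _ _))) //.
    rewrite cardsE; apply: leq_trans (card_size _) _; by rewrite size_tuple.
  by move: h1 h2 i3 n24; clear; lia.
apply: leq_trans cX _; rewrite leq_mul2l /=.
(* One target per vertex suffices, as the freed vertices tell the successors apart; the default [G]
   is never taken on [X]. *)
pose f x := (odflt G [pick H in C | reduces c G x H], [tuple of x :: t]).
have injf : {in X &, injective f}.
  by move=> x y _ _ /(congr1 (fun p => thead p.2)); rewrite !theadE.
rewrite -(card_in_imset injf); apply/subset_leq_card/subsetP => _ /imsetP[x + ->].
rewrite !inE => /andP[xt /exists_inP[H0 H0C H0R]]; rewrite /R /f.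
case: pickP => [H /andP[HC HR]|/(_ H0)]; last by rewrite H0C H0R.
apply/and3P; split; [apply/and4P; split| |].
- exact: HC.
- apply/exists_inP; exists G0 => //; rewrite mulSn addnC.
  apply: leq_trans (changed_trans _ G _) _; apply: leq_add => //.
  exact: card_changed_reduces HR.
- by rewrite /= xt ut.
- rewrite /=; apply/andP; split; first by apply: (isolated_reduces HR); rewrite eqxx orbT.
  by apply/allP => z /(allP it) iz; apply: (isolated_reduces HR); rewrite iz.
- by rewrite theadE.
- by apply/eqP/val_inj.
Qed.

(** A state extends in [n - 4] ways. Conversely, the five vertices of the copy determine the state
    behind a graph, and the graph has few copies, being at distance at most [4 * d + 5] from a
    pendant-free one: the 5 counts the path and [u]. *)
Lemma card_states4 : (n - 4) * #|states 4| <= 189 * (4 * d + 5) * #|C|.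
Proof.
pose T t u := (tnth t (@Ordinal 4 0 isT), tnth t (@Ordinal 4 1 isT),
   tnth t (@Ordinal 4 2 isT), tnth t (@Ordinal 4 3 isT), u) : 'I_n * 'I_n * 'I_n * 'I_n * 'I_n.
pose R (p : graph n * 4.-tuple 'I_n) G := [exists u, (u \notin p.2) && (G == attach p.1 (T p.2 u))].
have tE (t : 4.-tuple 'I_n) : tval t = [:: tnth t (@Ordinal 4 0 isT); tnth t (@Ordinal 4 1 isT);
   tnth t (@Ordinal 4 2 isT); tnth t (@Ordinal 4 3 isT)].
  by case: t => [[|a [|b [|e [|f [|]]]]]].
have unT (t : 4.-tuple 'I_n) u : uniq t -> u \notin t ->
    uniq [:: tnth t (@Ordinal 4 0 isT); tnth t (@Ordinal 4 1 isT);
   tnth t (@Ordinal 4 2 isT); tnth t (@Ordinal 4 3 isT); u].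
  move=> ut uu; rewrite -[X in uniq X]/([:: _; _; _; _] ++ [:: u]) cats1 rcons_uniq -tE ut andbT.
  by move: uu; rewrite memtE tE.
have -> : 189 * (4 * d + 5) = 1 * (189 * (4 * d + 5)) by rewrite mul1n.
apply: (double_count (R := R)) => [[G t]|G GC].
  rewrite inE /= mul1n => /and4P[GC _ ut it].
  pose X := ~: [set u in t].
  have cX : #|X| = n - 4.
    by have := cardsC [set u in t]; rewrite cardsE (card_uniqP ut) size_tuple card_ord => h; rewrite -[LHS](addKn 4) h.
  have injf : {in X &, injective (fun u => attach G (T t u))}.
    move=> u w; rewrite !inE => uX wX /(congr1 (fun J => nb J (tnth t (@Ordinal 4 0 isT)))).
    have uu := unT _ _ ut uX; have uw := unT _ _ ut wX.
    rewrite !nb_attach ?(unT t) //; try by rewrite -tE.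
    rewrite eqxx => /setP/(_ u); rewrite !inE eqxx /= => /esym/orP[/orP[/eqP//|/eqP h]|/eqP h].
      by move: uu; rewrite /= h !inE eqxx ?orbT ?andbF.
    by move: uu; rewrite /= h !inE eqxx ?orbT ?andbF.
  rewrite -cX -(card_in_imset injf); apply/subset_leq_card/subsetP => _ /imsetP[u + ->].
  rewrite !inE => uX; apply/andP; split; last by apply/existsP; exists u; rewrite uX eqxx.
  have := unT _ _ ut uX; have := it; rewrite [X in all _ X]tE /T.
  move: (tnth t _) (tnth t _) (tnth t _) (tnth t _) => y2 y1 x2 x1 /= /and5P[i1 i2 i3 i4 _].
  rewrite !inE !negb_or !andbT => /and4P[/and4P[a1 a2 a3 a4] /and3P[a5 a6 a7] /andP[a8 a9] a10].
  have b1 : x2 != x1 by rewrite eq_sym. 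
  have b2 : y1 != x1 by rewrite eq_sym. 
  have b3 : y2 != x1 by rewrite eq_sym. 
  have b4 : y1 != x2 by rewrite eq_sym. 
  have b5 : y2 != x2 by rewrite eq_sym. 
  have b6 : y2 != y1 by rewrite eq_sym. 
  rewrite /attach; apply: C_leaf => //; first (apply: C_leaf => //; first (apply: C_leaf => //; first (by apply: C_leaf))).
  all: rewrite /isolated ?nb_add_edge //.
  all: rewrite ?(negbTE a1, negbTE a2, negbTE a3, negbTE a4, negbTE a5, negbTE a6,
    negbTE a7, negbTE a8, negbTE a9, negbTE a10, negbTE b1, negbTE b2, negbTE b3, negbTE b4, negbTE b5, negbTE b6) //.
(* The default in [F] is immaterial: for [p] in [B] below, a suitable [u] exists. *)
pose F (p : graph n * 4.-tuple 'I_n) := T p.2 (odflt (tnth p.2 (@Ordinal 4 0 isT)) [pick u | (u \notin p.2) && (G == attach p.1 (T p.2 u))]).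
set B := [set p in states 4 | _].
have BF p : p \in B -> exists2 u, u \notin p.2 & F p = T p.2 u /\ G = attach p.1 (T p.2 u).
  rewrite !inE => /andP[_ /existsP[u hu]]; rewrite /F; case: pickP => [w /andP[wt /eqP e]|/(_ u)].
    by exists w.
  by rewrite hu.
have Bs p : p \in B -> uniq p.2 /\ all (isolated p.1) p.2.
  by rewrite !inE => /andP[/and4P[]].
have injF : {in B &, injective F}.
  move=> p q pB qB; have [u up [-> Gp]] := BF _ pB; have [w wq [-> Gq]] := BF _ qB.
  have [uu1 i1] := Bs _ pB; have [uu2 i2] := Bs _ qB.
  case: p q Gp Gq up wq uu1 i1 uu2 i2 {pB qB} => [G1 t1] [G2 t2] /= Gp Gq up wq uu1 i1 uu2 i2 eT.
  have et : t1 = t2.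
    apply: val_inj => /=; rewrite (tE t1) (tE t2); move: eT; rewrite /T.
    by move=> [] -> -> -> -> _.
  subst t2; have eu : u = w by case: eT.
  (* Deleting the path undoes [attach]: the freed vertices had empty neighbourhoods, and elsewhere
     only [u] gained [x1]. *)
  subst w; congr pair; apply: eq_graph_nb => v.
  have un := unT _ _ uu1 up.
  have := Gq; rewrite Gp => /(congr1 (fun J => nb J v)).
  rewrite !nb_attach ?(unT t1) //; try by rewrite -tE.
  have it1 x : x \in t1 -> nb G1 x = set0 by move=> /(allP i1)/eqP.
  have it2 x : x \in t1 -> nb G2 x = set0 by move=> /(allP i2)/eqP.
  have [vt|vt] := boolP (v \in t1); first by move=> _; rewrite it1 // it2.
  move: (vt); rewrite memtE [tval _]tE !inE !negb_or => /and4P[/negbTE-> /negbTE-> /negbTE-> /negbTE->].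
  have [->|//] := eqVneq v u; set x := tnth t1 _ => /setP e.
  have xt1 : x \in t1 by apply: mem_tnth.
  apply/setP => z; have := e z; rewrite !inE.
  have [->|//] := eqVneq z x; rewrite ![adj _ _ x]adjC -!in_nb it1 // it2 //.
rewrite -(card_in_imset injF).
have [->|/set0Pn[p pB]] := eqVneq B set0; first by rewrite imset0 cards0.
have : p.1 \in C /\ near (4 * d) p.1 by move: pB; rewrite !inE => /andP[/and4P[]].
case=> _ /exists_inP[G0]; rewrite inE => /andP[_ /eqP G00] G0p.
apply: leq_trans (_ : #|pendants G| <= _).
  apply/subset_leq_card/subsetP => _ /imsetP[q qB ->].
  have [u uq [-> Gq]] := BF _ qB; have [uu iq] := Bs _ qB.
  have un := unT _ _ uu uq; rewrite inE /T /pendant un Gq.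
  rewrite !nb_attach //; try by rewrite -tE.
  move: un => /=; rewrite !inE !negb_or !andbT => /and4P[/and4P[a1 a2 a3 a4] /and3P[a5 a6 a7] /andP[a8 a9] a10].
  have b (x y : 'I_n) : x != y -> (x == y = false) * (y == x = false).
    by move=> h; rewrite (eq_sym y) (negbTE h).
  by rewrite !(b _ _ a1, b _ _ a2, b _ _ a3, b _ _ a5, b _ _ a6, b _ _ a8, eqxx).
apply: leq_trans (card_pendants _ G00) _; rewrite leq_mul2l /=.
apply: leq_trans (changed_trans G0 p.1 G) _; apply: leq_add => //.
have [u up [_ Gp]] := BF _ pB; have [uu ip] := Bs _ pB.
have un := unT _ _ uu up.
apply: (@leq_trans #|[set x in [:: tnth p.2 (@Ordinal 4 0 isT); tnth p.2 (@Ordinal 4 1 isT);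
   tnth p.2 (@Ordinal 4 2 isT); tnth p.2 (@Ordinal 4 3 isT); u]]|); last first.
  by rewrite cardsE (card_uniqP un).
apply/subset_leq_card/subsetP => v; rewrite !inE; apply: contraR; rewrite !negb_or.
rewrite Gp nb_attach //; last by rewrite -tE.
by move=> /and5P[/negbTE-> /negbTE-> /negbTE-> /negbTE-> /negbTE->].
Qed.

(** Pendant-free graphs are the states with an empty tuple; the four steps cost constants, and the
    reattachment brings the factor [n - 4]. *)
Theorem card_pendant_free : 24 <= n ->
  (n - 4) * #|pendant_free| <= (8 * Mconst c) ^ 4 * (189 * (4 * d + 5)) * #|C|.
Proof.
move=> n24; rewrite -mulnA; apply: leq_trans (leq_mul (leqnn _) card_states4).
rewrite mulnCA leq_mul2l; apply/orP; right.
apply: (@leq_trans #|states 0|).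
  pose f G : graph n * 0.-tuple 'I_n := (G, [tuple]).
  have injf : injective f by move=> ? ? [].
  rewrite -(card_imset _ injf); apply/subset_leq_card/subsetP => _ /imsetP[G GP ->].
  rewrite inE /= andbT; move: (GP); rewrite inE => /andP[-> _] /=.
  apply/exists_inP; exists G => //; rewrite leqn0 cards_eq0; apply/eqP/setP => v.
  by rewrite !inE eqxx.
have step i (h : i <= 3) := card_states_step h n24.
rewrite 4!expnS expn0 muln1 -!(mulnA (8 * _)).
apply: leq_trans (step 0 isT) _; rewrite leq_mul2l; apply/orP; right.
apply: leq_trans (step 1 isT) _; rewrite leq_mul2l; apply/orP; right.
apply: leq_trans (step 2 isT) _; rewrite leq_mul2l; apply/orP; right.
exact: step 3 isT.
Qed.

End Class2.

End Counting.

(** * Combinatorial maps and graph models in them *)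

Module Maps.

Import GroupScope.
Local Open Scope nat_scope.

Section Porbits.
Variable D : finType.
Implicit Types (s : {perm D}) (S : {set D}) (x y : D).

Definition cyc s := #|porbits s|.

(** A transposition splits a cycle through both points and joins two distinct cycles; the Euler
    counts under surgery below come from this. *)
Lemma cyc_mul_tperm s x y :
  cyc (tperm x y * s) + (x \notin porbit s y).*2 = cyc s + (x != y).
Proof. exact: porbits_mul_tperm. Qed.

Lemma stable_porbit s S x y : (forall z, z \in S -> s z \in S) ->
  x \in S -> y \in porbit s x -> y \in S.
Proof.
move=> sS xS /porbitP[i ->]; elim: i => [|i IH]; first by rewrite expg0 perm1.
by rewrite expgSr permM; apply: sS.
Qed.

Lemma perm_in_porbit s x : s x \in porbit s x.
Proof. by have := mem_porbit s 1 x; rewrite expg1. Qed.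

Lemma stable_inv s S x : (forall z, z \in S -> s z \in S) -> x \in S -> s^-1%g x \in S.
Proof.
move=> sS xS; apply: stable_porbit sS xS _.
by rewrite -porbitV perm_in_porbit.
Qed.

Lemma porbit_trans s x y z : y \in porbit s x -> z \in porbit s y -> z \in porbit s x.
Proof. by rewrite -eq_porbit_mem => /eqP ->. Qed.

Lemma porbit_stable s x z : z \in porbit s x -> s z \in porbit s x.
Proof. by move=> zx; apply: porbit_trans zx (perm_in_porbit _ _). Qed.

Lemma porbit_fix s x y : s x = x -> y \in porbit s x -> y = x.
Proof.
move=> sx /(@stable_porbit s [set x]); rewrite !inE => h; apply/eqP/h => //.
by move=> z /set1P->; rewrite sx inE.
Qed.

(* f is the face permutation, e reverses darts and e * f turns around the origin
   of a dart; the genus is read off from Euler's formula. *)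
Definition is_map (e f : {perm D}) (g : nat) : Prop :=
  [/\ 0 < #|D|, involutive e, forall x, e x != x,
      forall S : {set D}, S != set0 -> (forall x, x \in S -> e x \in S) ->
        (forall x, x \in S -> f x \in S) -> S = setT
    & 2 * (cyc (e * f)%g + cyc f) + 4 * g = #|D| + 4].

(** The edge of [d] is contracted but kept as a loop: [d] becomes a face of length 1 while the two
    ends merge, so vertices plus faces and the set of darts are unchanged. Branch sets can therefore
    remain the same sets of darts. *)
Lemma merge_vertices (e f : {perm D}) g d : is_map e f g -> e d \notin porbit (e * f)%g d ->
  exists f' : {perm D}, [/\ is_map e f' g, cyc (e * f')%g < cyc (e * f)%g,
    forall S, (forall x, x \in S -> (e * f')%g x \in S) -> forall x, x \in S -> (e * f)%g x \in S,
    forall x, x != (e * f)^-1%g d -> x != e d -> (e * f')%g x = (e * f)%g x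
   & (e * f')%g ((e * f)^-1%g d) = (e * f)%g (e d) /\ (e * f')%g (e d) = d].
Proof.
case=> D0 eK ex con euler ed; set n := (e * f)%g in ed *.
pose p := n^-1%g d; pose q := e d; pose f' := (tperm (f^-1%g d)%g d * f)%g.
have np : n p = d by rewrite /p permKV.
have ep : e p = f^-1%g d.
  by apply: (@perm_inj _ f); rewrite permKV -np /n permM.
have n'E : (e * f')%g = (tperm p q * n)%g.
  apply/permP => x; rewrite /f' /n !permM; congr (f _).
  by rewrite -ep (inj_tperm _ _ _ (@perm_inj _ e)) /q eK.
have pd : p \in porbit n d by rewrite /p -porbitV perm_in_porbit.
have pq : p \notin porbit n q.
  apply: contra ed => h; rewrite -/q porbit_sym; apply: porbit_trans h _.
  by rewrite porbit_sym.
have pneq : p != q by apply: contraNneq pq => ->; rewrite porbit_id.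
have cn : cyc (e * f')%g + 1 = cyc n.
  have := cyc_mul_tperm n p q; rewrite /= pq pneq -n'E; lia.
have fd : f^-1%g d != d.
  apply: contraNneq ed => h; have fdd : f d = d by rewrite -{1}h permKV.
  have e1 : n (e d) = d by rewrite /n permM eK.
  by rewrite porbit_sym -{1}e1 perm_in_porbit.
have cf : cyc f' = cyc f + 1.
  have := cyc_mul_tperm f (f^-1%g d) d; rewrite /= -/f' fd.
  have -> : f^-1%g d \in porbit f d by rewrite -porbitV perm_in_porbit.
  by rewrite /=; lia.
have pq' : p \in porbit (e * f')%g q.
  have := cyc_mul_tperm (e * f')%g p q; rewrite /= {1}n'E mulgA tperm2 mul1g pneq.
  by rewrite -cn -addnA => /eqP; rewrite eqn_add2l; case: (p \in _).
have n'p : (e * f')%g p = n q by rewrite n'E permM tpermL.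
have n'q : (e * f')%g q = n p by rewrite n'E permM tpermR.
have stab S : (forall x, x \in S -> (e * f')%g x \in S) -> forall x, x \in S -> n x \in S.
  move=> sS x xS; have [xp|xp] := eqVneq x p.
    rewrite xp -n'q; apply: (sS); rewrite xp in xS; apply: stable_porbit sS xS _.
    by rewrite porbit_sym.
  have [xq|xq] := eqVneq x q.
    by rewrite xq -n'p; apply: (sS); rewrite xq in xS; apply: stable_porbit sS xS _.
  by have := sS x xS; rewrite n'E permM tpermD // eq_sym.
exists f'; split=> //; last 1 first.
- by split; rewrite -/p -/q ?n'q.
- split=> //; last by move: euler cn cf; rewrite -/n; lia.
  move=> S S0 eS f'S; apply: con => // x xS.
  have := stab S _ (e x) (eS x xS); rewrite /n permM eK; apply.
  by move=> y yS; rewrite permM; apply/f'S/eS.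
- by lia.
- by move=> x xp xq; rewrite n'E permM tpermD // eq_sym.
Qed.

End Porbits.

Section Models.
Variables (D : finType) (n : nat).
Implicit Types (e f : {perm D}) (r : rel 'I_n) (A : {set 'I_n}) (B : 'I_n -> {set D}).

(* B u is the branch set of u; every vertex of the map is an orbit of e * f. *)
Definition model e f r A B : Prop :=
  [/\ forall u, u \in A -> B u != set0,
      forall u x, u \in A -> x \in B u -> (e * f)%g x \in B u,
      forall u v x, u \in A -> v \in A -> x \in B u -> x \in B v -> u = v,
      forall u (S : {set D}), u \in A -> S \subset B u -> S != set0 ->
        (forall x, x \in S -> (e * f)%g x \in S) ->
        (forall x, x \in S -> e x \in B u -> e x \in S) -> S = B u
    & forall u v, u \in A -> v \in A -> r u v -> exists2 x, x \in B u & e x \in B v].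

(** Each branch set is then a single vertex of the map, and no contraction is left to do. *)
Definition tight e f A B : Prop :=
  forall u x y, u \in A -> x \in B u -> y \in B u -> y \in porbit (e * f)%g x.

(** Induction on the number of vertices of the map: a branch set with several vertices contains,
    being connected, an edge between two of them, which [merge_vertices] contracts. *)
Lemma tighten e f g r A B : is_map e f g -> model e f r A B ->
  exists f', [/\ is_map e f' g, model e f' r A B & tight e f' A B].
Proof.
elim: {f}_.+1 {-2}f (ltnSn (cyc (e * f))) => // m IH f fm Mf modf.
have [/forall_inP t|] := boolP [forall u in A, [forall x in B u, B u \subset porbit (e * f)%g x]].
  exists f; split=> // u x y uA xu; apply/subsetP.
  by have /forall_inP := t u uA; apply.
rewrite negb_forall_in => /exists_inP[u uA]; rewrite negb_forall_in => /exists_inP[x xu nsub].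
case: (modf) => B0 Bn Bd Bc Br.
have Ox y : y \in porbit (e * f)%g x -> y \in B u.
  by apply: (@stable_porbit _ (e * f)%g (B u)) => // z; apply: Bn.
have /exists_inP[d dx /andP[edu edx]] :
    [exists d in porbit (e * f)%g x, (e d \in B u) && (e d \notin porbit (e * f)%g x)].
  apply: contraT => /exists_inPn h; case/negP: nsub.
  rewrite -(Bc u (porbit (e * f)%g x)) //; first by apply/subsetP.
  - by apply/set0Pn; exists x; apply: porbit_id.
  - by move=> y; apply: porbit_stable.
  - by move=> y /h; rewrite negb_and negbK => /orP[/negbTE->|].
have edd : e d \notin porbit (e * f)%g d.
  by apply: contra edx => /(porbit_trans dx).
have [f' [Mf' lt st oth [n'p n'q]]] := merge_vertices Mf edd.
have du := Ox d dx.
have pu : (e * f)^-1%g d \in B u by apply: stable_inv => // z; apply: Bn.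
apply: (IH f') => //; first by rewrite -ltnS (leq_trans _ fm).
split=> //.
- move=> v y vA yv; have [yp|yp] := eqVneq y ((e * f)^-1%g d).
    have uv : u = v by apply: (Bd u v ((e * f)^-1%g d)); rewrite -?yp // yp.
    by rewrite yp n'p -uv; apply: Bn.
  have [yq|yq] := eqVneq y (e d); last by rewrite oth //; apply: Bn.
  have uv : u = v by apply: (Bd u v y); rewrite // yq.
  by rewrite yq n'q -uv.
- by move=> v S vA SB S0 nS eS; apply: Bc => //; apply: st.
Qed.

(** As the map is connected, some uncovered vertex has an edge to a covered one and joins its branch
    set. Together with [tighten] this bounds the number of vertices of the map by [#|A|]. *)
Lemma cover e f g r A B : A != set0 -> is_map e f g -> model e f r A B ->
  exists2 B', model e f r A B' & forall x, exists2 u, u \in A & x \in B' u.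
Proof.
move=> /set0Pn[u0 u0A] Mf; elim: {B}_.+1 {-2}B (ltnSn #|~: \bigcup_(u in A) B u|) => // m IH B Bm modB.
case: (modB) => B0 Bn Bd Bc Br; case: (Mf) => D0 eK ex con _.
pose U := \bigcup_(u in A) B u.
have Un x : x \in U -> (e * f)%g x \in U.
  by move=> /bigcupP[u uA xu]; apply/bigcupP; exists u => //; apply: Bn.
have [/exists_inP[d dU edU]|/exists_inPn h] := boolP [exists d in U, e d \notin U]; last first.
  exists B => // x; have : x \in U; last by case/bigcupP=> u; exists u.
  have eU y : y \in U -> e y \in U by move=> /h; rewrite negbK.
  rewrite (con U) ?inE //; last by move=> y yU; have := Un (e y) (eU y yU); rewrite permM eK.
  by have /set0Pn[x0 x0u] := B0 _ u0A; apply/set0Pn; exists x0; apply/bigcupP; exists u0.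
have /bigcupP[u uA du] := dU.
pose O := porbit (e * f)%g (e d).
have OU x : x \in O -> x \notin U.
  move=> xO; apply: contra edU => xU; apply: stable_porbit Un xU _; by rewrite porbit_sym.
have OB x v : x \in O -> v \in A -> x \in B v = false.
  move=> xO vA; apply/negbTE; apply: contra (OU x xO) => xv; by apply/bigcupP; exists v.
pose B' v := if v == u then B u :|: O else B v.
have B'E v x : (x \in B' v) = (x \in B v) || (v == u) && (x \in O).
  by rewrite /B'; case: eqP => [->|]; rewrite ?inE ?orbF.
apply: (IH B').
  rewrite -ltnS; apply: leq_trans Bm; apply: proper_card; apply/properP; split.
    apply/subsetP => x; rewrite !inE; apply: contra => /bigcupP[v vA xv].
    by apply/bigcupP; exists v; rewrite // B'E xv.
  exists (e d); rewrite !inE // negbK; apply/bigcupP; exists u => //.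
  by rewrite B'E eqxx porbit_id orbT.
split.
- move=> v vA; have /set0Pn[x xv] := B0 v vA; apply/set0Pn; exists x; by rewrite B'E xv.
- move=> v x vA; rewrite !B'E => /orP[xv|/andP[-> xO]]; first by rewrite Bn.
  by rewrite orbC porbit_stable.
- move=> v w x vA wA; rewrite !B'E => /orP[xv|/andP[/eqP-> xO]] /orP[xw|/andP[/eqP-> xO']] //.
  + exact: Bd xv xw.
  + by rewrite OB in xv.
  + by rewrite OB in xw.
- move=> v S vA SB S0 nS eS; have [vu|vu] := eqVneq v u; last first.
    move: SB eS; rewrite /B' (negbTE vu) => SB eS; exact: Bc.
  subst v; apply/eqP; rewrite eqEsubset SB /=.
  (* A part that meets the new orbit contains it, hence [e d] and then [d], and so meets the old
     branch set. *)
  have keyO x : x \in S -> x \in O -> B' u \subset S.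
    move=> xS xO; have OS : O \subset S.
      apply/subsetP => y yO; apply: stable_porbit nS xS _.
      by apply: porbit_trans yO; rewrite porbit_sym.
    have dS : d \in S.
      rewrite -(eK d); apply: eS; rewrite ?eK ?B'E ?du //.
      by apply: (subsetP OS); apply: porbit_id.
    rewrite /B' eqxx subUset OS andbT -(Bc u (S :&: B u)) ?subsetIl ?subsetIr //.
    - by apply/set0Pn; exists d; rewrite inE dS.
    - by move=> y /setIP[yS yu]; rewrite inE nS // Bn.
    - by move=> y /setIP[yS yu] eyu; rewrite inE eyu andbT eS // B'E eyu.
  have /set0Pn[x xS] := S0; have := subsetP SB x xS; rewrite B'E eqxx /= => /orP[xu|]; last exact: keyO.
  have [/exists_inP[y yS yO]|/exists_inPn nO] := boolP [exists y in S, y \in O]; first exact: keyO yS yO.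
  have SBu : S = B u.
    apply: Bc => //; first by apply/subsetP => y yS; have := subsetP SB y yS; rewrite B'E eqxx /= (negbTE (nO y yS)) orbF.
    by move=> y yS eyu; apply: eS; rewrite // B'E eyu.
  have edS : e d \in S by apply: eS; rewrite ?SBu // B'E eqxx porbit_id orbT.
  by have := nO _ edS; rewrite porbit_id.
- move=> v w vA wA /(Br v w vA wA)[x xv xw]; exists x; by rewrite B'E ?xv ?xw.
Qed.

End Models.

End Maps.

(** * Detaching edges from a map *)

Module Detachment.

Import Maps.

Import GroupScope.
Local Open Scope nat_scope.

Section Detach.
Variables (D : finType) (e : {perm D}).
Hypothesis eK : involutive e.
Hypothesis e_neq : forall x, e x != x.
Implicit Types (s : {perm D}) (x y z : D) (X Y : {set D}).

(** [x] leaves its cycle and becomes a fixed point: with [s] turning around vertices, one end of the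
    edge of [x] is pulled off. *)
Definition detach s x : {perm D} := (tperm x (s^-1%g x) * s)%g.

Lemma detach_id s x : detach s x x = x.
Proof. by rewrite permM tpermL permKV. Qed.

Lemma detachE s x y : y != x -> detach s x y = if s y == x then s x else s y.
Proof.
move=> yx; rewrite permM; have [sy|sy] := eqVneq (s y) x.
  by rewrite -{2}sy permK tpermR.
rewrite tpermD // 1?eq_sym //.
by apply: contraNneq sy => ->; rewrite permKV.
Qed.

Lemma detach_porbit s x y z : y != x -> z != x ->
  (z \in porbit (detach s x) y) = (z \in porbit s y).
Proof.
move=> yx zx; apply/idP/idP => [|].
  apply: stable_porbit (porbit_id _ _) => w; have [->|wx] := eqVneq w x.
    by rewrite detach_id.
  move=> wy; rewrite detachE //; case: ifP => [/eqP e1|_]; last exact: porbit_stable.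
  by apply: porbit_stable; rewrite -e1; apply: porbit_stable.
move=> zy; pose b := s^-1%g x \in porbit (detach s x) y.
(* The converse needs a set stable under [s]: the orbit, with [x] put back if its predecessor lies
   there. *)
pose S := [set w | (w \in porbit (detach s x) y) || b && (w == x)].
have: z \in S; last by rewrite inE (negbTE zx) andbF orbF.
apply: stable_porbit zy; last by rewrite inE porbit_id.
have sx : b -> s x \in porbit (detach s x) y.
  move=> /[dup] hb /porbit_stable; have [e1|ne] := eqVneq (s^-1%g x) x.
    by have := hb; rewrite /b e1 porbit_sym => /(porbit_fix (detach_id _ _)) yx'; rewrite yx' eqxx in yx.
  by rewrite detachE // permKV eqxx.
move=> w; rewrite !inE => /orP[wy|/andP[hb /eqP->]]; last by rewrite sx.
have [wx|wx] := eqVneq w x.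
  by move: wy; rewrite wx porbit_sym => /(porbit_fix (detach_id _ _)) yx'; rewrite yx' eqxx in yx.
have [swx|swx] := eqVneq (s w) x.
  have hb : b by rewrite /b; have -> : s^-1%g x = w by rewrite -swx permK.
  by rewrite hb orbT.
by have := porbit_stable wy; rewrite detachE // (negbTE swx) => ->.
Qed.

Lemma card_detach s x : cyc (detach s x) = cyc s + (s x != x).
Proof.
have := cyc_mul_tperm s x (s^-1%g x).
rewrite /= -/(detach s x) porbit_sym -porbitV perm_in_porbit /= addn0 => ->.
by rewrite -(inj_eq (@perm_inj _ s) x) permKV.
Qed.

(** Detaching acts on the faces by one transposition as well, since [e] conjugates transpositions to
    transpositions. *)
Lemma detach_face s x :
  (e * detach s x)%g = (tperm (e x) ((e * s)^-1%g x) * (e * s))%g :> {perm D}.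
Proof.
have -> : (e * s)^-1%g x = e (s^-1%g x).
  by apply: (@perm_inj _ (e * s)%g); rewrite permKV permM eK permKV.
apply/permP => y; rewrite /detach !permM; congr (s _).
by rewrite (inj_tperm _ _ _ (@perm_inj _ e)) !eK.
Qed.

Lemma card_detach_face s x : cyc (e * s) <= cyc (e * detach s x) + 1.
Proof.
have := cyc_mul_tperm (e * s) (e x) ((e * s)^-1%g x); rewrite /= -detach_face.
by case: eqVneq => [->|_]; rewrite ?porbit_id /=; first lia; case: (e x \in _) => /=; lia.
Qed.

(** If [e x] is already alone, both sides of the edge lie on one face, and detaching [x] splits this
    face unless [x] is alone too. *)
Lemma card_detach_face_leaf s x : s (e x) = e x ->
  cyc (e * detach s x) = cyc (e * s) + (s x != x).
Proof.
move=> sex; have := cyc_mul_tperm (e * s) (e x) ((e * s)^-1%g x); rewrite /= -detach_face.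
have -> : e x \in porbit (e * s) ((e * s)^-1%g x).
  have h1 := perm_in_porbit (e * s) ((e * s)^-1%g x); rewrite permKV in h1.
  have h2 := perm_in_porbit (e * s) x; rewrite permM sex in h2.
  exact: porbit_trans h1 h2.
rewrite /= addn0 => ->; congr (_ + nat_of_bool (~~ _)).
by rewrite -(inj_eq (@perm_inj _ (e * s)%g)) permKV permM eK.
Qed.

Variable s0 : {perm D}.

Definition norb Y := #|[set porbit s0 y | y in Y]|.

(** Detaching both ends of an edge raises vertices plus faces by at least 2, its number of darts,
    unless a vertex of [s0] loses its last dart; the terms in [norb] pay for these exceptions. *)
Lemma detach_edges X : (forall x, x \in X -> e x \in X) ->
  exists s, [/\ forall x, x \notin X -> s x = x,
    forall x y, x \in X -> y \in X -> (y \in porbit s x) = (y \in porbit s0 x)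
    & cyc s0 + cyc (e * s0) + #|~: X| + 2 * norb X
      <= cyc s + cyc (e * s) + 2 * norb setT].
Proof.
move=> eX.
have main m : forall Y s, #|Y :\: X| <= m -> X \subset Y -> (forall x, x \in Y -> e x \in Y) ->
    (forall x, x \notin Y -> s x = x) ->
    (forall x y, x \in Y -> y \in Y -> (y \in porbit s x) = (y \in porbit s0 x)) ->
    cyc s0 + cyc (e * s0) + #|~: Y| + 2 * norb Y
      <= cyc s + cyc (e * s) + 2 * norb setT ->
  exists s, [/\ forall x, x \notin X -> s x = x,
    forall x y, x \in X -> y \in X -> (y \in porbit s x) = (y \in porbit s0 x)
    & cyc s0 + cyc (e * s0) + #|~: X| + 2 * norb X
      <= cyc s + cyc (e * s) + 2 * norb setT].
  elim: m => [|m IH] Y s Ym XY eY I1 I2 I3.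
    have YX : Y = X.
      by apply/eqP; rewrite eqEsubset XY andbT -setD_eq0 -cards_eq0 -leqn0.
    by subst Y; exists s.
  have [YX|/set0Pn[x]] := eqVneq (Y :\: X) set0.
    have YX' : Y = X by apply/eqP; rewrite eqEsubset XY andbT -setD_eq0 YX.
    by subst Y; exists s.
  rewrite inE => /andP[xX xY].
  have exX : e x \notin X by apply: contra xX => /eX; rewrite eK.
  have exY := eY x xY.
  have exx := e_neq x; have xex : x != e x by rewrite eq_sym.
  pose s1 := detach s (e x); pose s2 := detach s1 x; pose Y' := Y :\: [set x; e x].
  have Y'P y : y \in Y' = [&& y != x, y != e x & y \in Y] by rewrite !inE negb_or andbA.
  have s1ex : s1 (e x) = e x by rewrite detach_id.
  have c1 : cyc s1 = cyc s + (s (e x) != e x) by rewrite card_detach.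
  have c2 : cyc s2 = cyc s1 + (s1 x != x) by rewrite card_detach.
  have f1 : cyc (e * s) <= cyc (e * s1) + 1 by rewrite card_detach_face.
  have f1' : s x = x -> cyc (e * s1) = cyc (e * s) + (s (e x) != e x).
    by move=> sx; rewrite card_detach_face_leaf // eK.
  have f1'' : s (e x) = e x -> s1 = s.
    move=> sx; rewrite /s1 /detach; have -> : s^-1%g (e x) = e x by rewrite -{1}sx permK.
    by rewrite tperm1 mul1g.
  have f2 : cyc (e * s2) = cyc (e * s1) + (s1 x != x).
    by rewrite card_detach_face_leaf.
  have cY : #|~: Y'| = #|~: Y| + 2.
    have -> : ~: Y' = ~: Y :|: [set x; e x] by rewrite /Y' setCD.
    rewrite cardsU cards2 xex (_ : _ :&: _ = set0) ?cards0 ?subn0 //.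
    apply/setP => y; rewrite !inE; apply/negbTE; apply/negP => /andP[yY /orP[]/eqP yx];
    by rewrite yx ?xY ?exY in yY.
  have nle : norb Y' <= norb Y by apply/subset_leq_card/imsetS/subsetDl.
  (* With no dart of [Y'] left in the orbit of [x], the vertex of [x] is lost from [norb]. *)
  have nlt : (forall y, y \in Y' -> y \notin porbit s x) -> norb Y' < norb Y.
    move=> h; apply: proper_card; rewrite properE imsetS ?subsetDl //=.
    apply/subsetPn; exists (porbit s0 x); first exact: imset_f.
    apply/negP => /imsetP[y yY' /eqP]; rewrite eq_porbit_mem porbit_sym.
    have yY : y \in Y by move: yY'; rewrite Y'P => /and3P[].
    by rewrite -I2 // (negbTE (h y yY')).
  have bad (S : {set D}) : S \subset [set x; e x] -> x \in S -> (forall y, y \in S -> s y \in S) ->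
      norb Y' < norb Y.
    move=> SS xS sS; apply: nlt => y; rewrite Y'P => /and3P[yx yex _]; apply/negP => yy.
    have := subsetP SS y (stable_porbit sS xS yy); by rewrite !inE (negbTE yx) (negbTE yex).
  apply: (IH Y' s2).
  - rewrite -ltnS; apply: leq_trans Ym; apply: proper_card; apply/properP; split.
      by apply: setSD; apply: subsetDl.
    by exists x; rewrite !inE ?xX ?eqxx.
  - apply/subsetP => y yX; rewrite Y'P (subsetP XY) // andbT.
    by apply/andP; split; [apply: contraNneq xX => <- | apply: contraNneq exX => <-].
  - move=> y; rewrite !Y'P => /and3P[yx yex yY]; rewrite eY // andbT; apply/andP; split.
      by apply: contraNneq yex => <-; rewrite eK.
    by rewrite (inj_eq (@perm_inj _ e)).
  - move=> y; have [->|yx] := eqVneq y x; first by rewrite detach_id.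
    have s1y : y != e x -> y \notin Y -> s1 y = y.
      by move=> yex yY; rewrite /s1 detachE // I1 // (negbTE yex).
    rewrite Y'P yx /= detachE //; have [->|yex] := eqVneq y (e x).
      by rewrite s1ex (negbTE exx).
    by move=> /= yY; rewrite s1y // (negbTE yx).
  - move=> y z; rewrite !Y'P => /and3P[yx yex yY] /and3P[zx zex zY].
    by rewrite !detach_porbit // I2.
  (* Generic case: detaching [e x] gives one vertex and costs at most one face, then detaching [x]
     gives one of each. The other cases are ends that are already alone and a vertex made of [x] and
     [e x] only. *)
  have step : 2 + (cyc s + cyc (e * s)) + 2 * norb Y' <=
     cyc s2 + cyc (e * s2) + 2 * norb Y.
    have [sex|sex] := eqVneq (s (e x)) (e x).
      move: c1 c2 f2; rewrite (f1'' sex) sex eqxx /=; have [sx|sx] := eqVneq (s x) x => /=; last by lia.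
      have := bad [set x]; rewrite inE eqxx sub1set !inE eqxx /= => /(_ isT isT) h.
      have : norb Y' < norb Y by apply: h => y /set1P->; rewrite sx inE.
      by lia.
    move: c1 c2 f2; rewrite sex; have [sx|sx] := eqVneq (s1 x) x => /=; last by lia.
    have [sx'|sx'] := eqVneq (s x) x; first by have := f1' sx'; rewrite sex /=; lia.
    have s1xE : s1 x = if s x == e x then s (e x) else s x by rewrite /s1 detachE.
    have : norb Y' < norb Y; last by lia.
    move: sx; rewrite s1xE; case: eqP => [sxe sexx|_ sxx]; last by rewrite sxx eqxx in sx'.
    apply: (bad [set x; e x]); rewrite ?subxx ?inE ?eqxx //.
    by move=> y /set2P[]->; rewrite ?sxe ?sexx !inE eqxx ?orbT.
  by rewrite cY; lia.
apply: (main _ setT s0 (leqnn _)) => //; rewrite ?subsetT //.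
  by move=> x; rewrite inE.
by rewrite setCT cards0 addn0.
Qed.
End Detach.

End Detachment.

(** * The edge bound from Euler's formula *)

Module SparseMaps.

Import Maps Detachment.

Import GroupScope.
Local Open Scope nat_scope.

Section EdgeBound.
Variables (D : finType) (n : nat).
Implicit Types (e f : {perm D}) (r : rel 'I_n) (A : {set 'I_n}) (B : 'I_n -> {set D}).

Lemma sum_porbits (s : {perm D}) (w : D -> nat) :
  \sum_x w x = \sum_(O in porbits s) \sum_(x in O) w x.
Proof.
rewrite (partition_big_imset (porbit s)) /=; apply: eq_bigr => O /imsetP[x0 _ ->].
by apply: eq_bigl => x; rewrite eq_porbit_mem porbit_sym.
Qed.

(* The faces of the graph spanned by the darts in X have length at least 3, except
   for those of length 2 coming from isolated edges. *)
Lemma card_faces e (s : {perm D}) (X : {set D}) N : (forall x, e x != x) -> involutive e ->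
  (forall x, x \in X -> e x \in X) -> (forall x, x \notin X -> s x = x) ->
  (forall x, x \in X -> e x \notin porbit s x) ->
  (forall x y, x \in X -> y \in X -> y \in porbit s x -> e y \in porbit s (e x) -> x = y) ->
  #|[set porbit s x | x in X]| <= N ->
  6 * cyc (e * s) <= 2 * #|X| + 3 * #|~: X| + 2 * N.
Proof.
move=> ex eK eX sX loop par cN.
pose f : {perm D} := (e * s)%g.
(* The weights give every face at least 6: three darts of [X] at 2, or the two darts of a detached
   edge at 3. A face of two darts of [X] misses 2, which [Q] supplies. *)
pose w x := if x \in X then 2 else 3.
pose Q := [set porbit f x | x in [set x in X | s x == x]].
have sXX x : x \in X -> s x \in X.
  by apply: contraTT => sx; rewrite -(perm_inj (sX _ sx)).
have fX x : (f x \in X) = (x \in X).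
  apply/idP/idP; rewrite permM => h; last by apply/sXX/eX.
  rewrite -(eK x); apply: eX; apply: contraTT h => h; by rewrite sX.
have cQ : #|Q| <= N.
  apply: leq_trans cN.
  apply: (@leq_trans #|[set x in X | s x == x]|); first exact: leq_imset_card.
  have inj : {in [set x in X | s x == x] &, injective (porbit s)}.
    move=> x y; rewrite !inE => /andP[_ /eqP sx] /andP[_ /eqP sy] /eqP.
    by rewrite eq_porbit_mem => /(porbit_fix sy).
  rewrite -(card_in_imset inj); apply/subset_leq_card/imsetS.
  by apply/subsetP => x; rewrite inE => /andP[].
have wO O : O \in porbits f -> 6 <= \sum_(x in O) w x + 2 * (O \in Q).
  move=> /imsetP[x _ ->].
  have mem2 : f x \in porbit f x := perm_in_porbit _ _.
  have f1 : f x != x.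
    rewrite permM; have [xX|xX] := boolP (x \in X); last first.
      rewrite sX ?ex //; by apply: contra xX => /eX; rewrite eK.
    apply: contraTneq (loop _ xX) => h; rewrite negbK porbit_sym -{1}h.
    exact: perm_in_porbit.
  have c2 : 2 <= #|porbit f x|.
    apply: leq_trans (subset_leq_card (_ : [set x; f x] \subset _)).
      by rewrite cards2 eq_sym f1.
    by apply/subsetP => y /set2P[]->; rewrite ?porbit_id.
  have wE : \sum_(y in porbit f x) w y = w x * #|porbit f x|.
    rewrite mulnC -sum_nat_const; apply: eq_bigr => y yx; rewrite /w.
    have -> // : (y \in X) = (x \in X).
    have [xX|xX] := boolP (x \in X).
      by apply: stable_porbit xX yx => z; rewrite fX.
    apply/negbTE; rewrite -in_setC; apply: stable_porbit (_ : x \in _) yx; last by rewrite inE.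
    by move=> z; rewrite !inE fX.
  rewrite wE /w; have [xX|xX] := boolP (x \in X); last by lia.
  have [c3|c3] := leqP 3 #|porbit f x|; first by lia.
  suff -> : porbit f x \in Q by lia.
  have ffx : f (f x) = x.
    have OE : porbit f x = [set x; f x].
      apply/esym/eqP; rewrite eqEcard cards2 eq_sym f1; apply/andP; split; last by lia.
      by apply/subsetP => y /set2P[]->; rewrite ?porbit_id.
    have : f (f x) \in [set x; f x] by rewrite -OE; apply: porbit_stable.
    by rewrite !inE (inj_eq perm_inj) (negbTE f1) orbF => /eqP.
  have fxX : f x \in X by rewrite fX.
  have fxe : f x = e x.
    have h1 : e (f x) \in porbit s x.
      have := perm_in_porbit s (e (f x)); have -> : s (e (f x)) = x by rewrite -[RHS]ffx [in RHS]permM.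
      by rewrite porbit_sym.
    have h2 : f x \in porbit s (e x) by rewrite permM perm_in_porbit.
    by apply/esym/par; rewrite ?eK //; apply: eX.
  apply: imset_f; rewrite inE xX /=; apply/eqP.
  by rewrite -[RHS]ffx [in RHS]permM fxe eK.
have := sum_porbits f w.
have -> : \sum_x w x = 2 * #|X| + 3 * #|~: X|.
  rewrite (bigID (mem X)) /= mulnC -sum_nat_const mulnC -sum_nat_const; congr (_ + _).
    by apply: eq_bigr => x; rewrite /w => ->.
  by apply: eq_big => [x|x]; rewrite ?inE // /w => /negbTE->.
move=> ->; apply: (@leq_trans (\sum_(O in porbits f) \sum_(x in O) w x + 2 * #|Q|)); last first.
  by rewrite leq_add2l leq_mul2l cQ.
have -> : 2 * #|Q| = \sum_(O in porbits f) 2 * (O \in Q).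
  rewrite -big_distrr /= -big_mkcondr /= -sum1_card; congr (2 * _); apply: eq_bigl => O.
  by rewrite andb_idl // => /imsetP[x _ ->]; apply: imset_f.
by rewrite -big_split /= mulnC -sum_nat_const; apply: leq_sum.
Qed.

(** After [cover] and [tighten], the map has at most [#|A|] vertices. One edge is kept per adjacent
    pair and the others are detached; the kept edges have no loops or parallels, so [card_faces] and
    Euler's formula bound them. *)
Lemma model_sparse e f g r A B : is_map e f g -> model e f r A B ->
  symmetric r -> irreflexive r ->
  \sum_(u in A) #|[set v in A | r u v]| <= (20 + 12 * g) * #|A|.
Proof.
have [->|A0] := eqVneq A set0; first by rewrite big_set0.
move=> Mf /(cover A0 Mf)[{}B /(tighten Mf)[{}f [{}Mf modB tB]] cB] rC rI.
case: (Mf) => D0 eK ex con euler; case: modB => B0 Bn Bd Bc Br.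
pose s0 : {perm D} := (e * f)%g.
have es0 : (e * s0)%g = f by apply/permP => x; rewrite !permM eK.
have A_gt0 : 0 < #|A| by rewrite card_gt0.
pose P u v := [pred x | (x \in B u) && (e x \in B v)].
have [x0 _] : exists x0 : D, true by case/card_gt0P: D0 => x _; exists x.
pose ch u v := odflt x0 [pick x | P u v x].
have chP u v : u \in A -> v \in A -> r u v -> ch u v \in B u /\ e (ch u v) \in B v.
  move=> uA vA ruv; rewrite /ch; case: pickP => [x /andP[]//|h].
  by have [x xu xv] := Br u v uA vA ruv; have := h x; rewrite /= xu xv.
(* The dart is chosen for the increasing pair and reversed otherwise, which makes [X] closed under
   [e]. *)
pose c (p : 'I_n * 'I_n) := if p.1 < p.2 then ch p.1 p.2 else e (ch p.2 p.1).
pose E := [set p | [&& p.1 \in A, p.2 \in A & r p.1 p.2]].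
pose X := c @: E.
have cP p : p \in E -> c p \in B p.1 /\ e (c p) \in B p.2.
  rewrite inE => /and3P[p1 p2 rp]; rewrite /c; case: ifP => _; first exact: chP.
  rewrite eK; have rp' : r p.2 p.1 by rewrite rC.
  by have [? ?] := chP _ _ p2 p1 rp'.
have EA p : p \in E -> p.1 \in A /\ p.2 \in A by rewrite inE => /and3P[].
have injc : {in E &, injective c}.
  move=> p q pE qE pq; have [p1 p2] := cP p pE; have [q1 q2] := cP q qE.
  have [? ?] := EA p pE; have [? ?] := EA q qE.
  rewrite [p]surjective_pairing [q]surjective_pairing; congr pair.
    by apply: Bd p1 _; rewrite // pq.
  by apply: Bd p2 _; rewrite // pq.
have eX x : x \in X -> e x \in X.
  move=> /imsetP[[u v] pE ->]; apply/imsetP; exists (v, u).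
    by move: pE; rewrite !inE /= rC => /and3P[-> -> ->].
  rewrite /c /=; case: ltngtP => //= uv; rewrite ?eK //.
  move: pE; rewrite inE /=; have -> : u = v by apply: val_inj.
  by rewrite rI !andbF.
have cX : #|X| = \sum_(u in A) #|[set v in A | r u v]|.
  rewrite card_in_imset // -sum1_card.
  rewrite (eq_bigr (fun u => \sum_(v in [set v in A | r u v]) 1)); last by move=> u _; rewrite sum1_card.
  rewrite pair_big_dep /=; apply: eq_bigl => -[u v]; by rewrite !inE.
rewrite -cX.
have [s [sX sP ineq]] := @detach_edges D e eK ex s0 X eX.
have NA Y : norb s0 Y <= #|A|.
  apply: leq_trans (_ : #|[set porbit s0 (odflt x0 [pick x in B u]) | u in A]| <= _); last exact: leq_imset_card.
  apply/subset_leq_card/subsetP => _ /imsetP[y _ ->]; have [u uA yu] := cB y.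
  apply/imsetP; exists u => //; apply/eqP; rewrite eq_porbit_mem.
  by case: pickP => [z zu|/(_ y)]; [apply: tB zu yu | rewrite yu].
have XA x : x \in X -> exists u v, [/\ u \in A, v \in A, x \in B u, e x \in B v & u != v].
  move=> /imsetP[[u v] pE ->]; have [? ?] := EA _ pE; have [? ?] := cP _ pE.
  exists u, v; split=> //; apply: contraTneq pE => /= ->; by rewrite inE /= rI !andbF.
have orbB u x y : u \in A -> x \in B u -> y \in porbit s0 x -> y \in B u.
  by move=> uA xu; apply: stable_porbit xu => z; apply: Bn.
have Xpar x y : x \in X -> y \in X -> y \in porbit s x -> e y \in porbit s (e x) -> x = y.
  move=> xX yX; rewrite !sP ?eX // => xy exy.
  case/imsetP: (xX) xy exy => p pE -> xy exy; case/imsetP: (yX) xy exy => q qE -> xy exy.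
  have [p1 p2] := cP p pE; have [q1 q2] := cP q qE.
  have [? ?] := EA p pE; have [? ?] := EA q qE; congr c.
  rewrite [p]surjective_pairing [q]surjective_pairing; congr pair.
    by apply: (Bd _ _ (c q)) => //; apply: orbB xy.
  by apply: (Bd _ _ (e (c q))) => //; apply: orbB exy.
have Xloop x : x \in X -> e x \notin porbit s x.
  move=> xX; rewrite sP ?eX //; have [u [v [uA vA xu xv uv]]] := XA x xX.
  apply: contra uv => /(orbB u x _ uA xu) exu; apply/eqP; exact: Bd exu xv.
have norbX : #|[set porbit s x | x in X]| <= #|A|.
  apply: leq_trans (NA X).
  pose h (O : {set D}) := odflt x0 [pick x in O :&: X].
  have hP O : O \in [set porbit s x | x in X] -> h O \in X /\ O = porbit s (h O).
    move=> /imsetP[x xX ->]; rewrite /h; case: pickP => [y|/(_ x)]; last first.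
      by rewrite inE porbit_id xX.
    by rewrite inE => /andP[yx yX]; split=> //; apply/eqP; rewrite eq_porbit_mem porbit_sym.
  rewrite -(@card_in_imset _ _ (fun O => porbit s0 (h O))); last first.
    move=> O1 O2 /hP[h1 E1] /hP[h2 E2] /eqP; rewrite eq_porbit_mem -sP // => h12.
    by rewrite E1 E2; apply/eqP; rewrite eq_porbit_mem.
  apply/subset_leq_card/subsetP => _ /imsetP[O /hP[hX _] ->]; exact: imset_f.
have cs : cyc s <= #|~: X| + #|A|.
  apply: leq_trans (_ : #|[set porbit s x | x in ~: X] :|: [set porbit s x | x in X]| <= _).
    apply/subset_leq_card/subsetP => _ /imsetP[x _ ->]; rewrite inE.
    by case: (boolP (x \in X)) => xX; apply/orP; [right|left]; apply: imset_f; rewrite ?inE.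
  rewrite (leq_trans (leq_card_setU _ _)) // leq_add // leq_imset_card //.
have cf := card_faces ex eK eX sX Xloop Xpar norbX.
have cXX := cardsC X; have NT := NA setT.
rewrite es0 in ineq; rewrite -/s0 in euler.
(* In six times [ineq] the terms in [#|~: X|] cancel, and 20 = 12 + 6 + 2 comes from [NT], [cs] and
   [cf]. *)
have h : #|X| <= 20 * #|A| + 12 * g by lia.
apply: leq_trans h _; rewrite mulnDl leq_add2l; nia.
Qed.

End EdgeBound.

End SparseMaps.

(** * Barycentric subdivision of a map *)

Module Subdivision.

Import Maps Detachment SparseMaps.

Import GroupScope.
Local Open Scope nat_scope.

Lemma card_porbits_const (D : finType) (s : {perm D}) k :
  (forall x, #|porbit s x| = k) -> k * cyc s = #|D|.
Proof.
move=> sk; rewrite -sum1_card (sum_porbits s) mulnC -sum_nat_const.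
by apply: eq_bigr => O /imsetP[x _ ->]; rewrite sum1_card sk.
Qed.

Lemma card_porbits_label (D T : finType) (s : {perm D}) (l : D -> T) :
  (forall x, l (s x) = l x) -> (forall x y, l x = l y -> y \in porbit s x) ->
  cyc s = #|[set l x | x in D]|.
Proof.
move=> ls lP; have lO x y : y \in porbit s x -> l y = l x.
  move=> yx; suff : y \in [set z | l z == l x] by rewrite inE => /eqP.
  by apply: stable_porbit yx; rewrite ?inE // => z; rewrite !inE ls.
pose F t := [set y | l y == t].
have Fl x : F (l x) = porbit s x.
  apply/setP => y; rewrite inE; apply/eqP/idP => [/esym/lP //|]; exact: lO.
have injF : {in [set l x | x in D] &, injective F}.
  move=> _ _ /imsetP[x _ ->] /imsetP[y _ ->] /setP/(_ x).
  by rewrite !inE eqxx => /esym/eqP.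
rewrite -(card_in_imset injF) /cyc; congr #|pred_of_set _|; apply/setP => O.
apply/imsetP/imsetP => [[x _ ->]|[_ /imsetP[x _ ->] ->]]; last by exists x.
by exists (l x); rewrite ?imset_f.
Qed.

Lemma porbit_map (D D' : finType) (s : {perm D}) (s' : {perm D'}) (h : D -> D') x y :
  (forall z, h (s z) \in porbit s' (h z)) -> y \in porbit s x -> h y \in porbit s' (h x).
Proof.
move=> hs yx; have : y \in [set z | h z \in porbit s' (h x)]; last by rewrite inE.
apply: stable_porbit yx; last by rewrite inE porbit_id.
by move=> z; rewrite !inE => zx; apply: porbit_trans zx (hs z).
Qed.

Section Subdivision.
Variables (D : finType) (e f : {perm D}) (g : nat).
Hypothesis Mf : is_map e f g.

Let eK : involutive e. Proof. by case: Mf. Qed.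
Let ex x : e x != x. Proof. by case: Mf. Qed.

(* A flag (d, b) of the map is a triangle of the barycentric subdivision: its
   corners are the edge and the left face of d, and the origin of d (b = true) or
   its end (b = false).  The third component tells the sides apart. *)
Definition sdart : finType := (D * bool * option bool)%type.

(** For [None], [Some true], [Some false] the sides run from origin to edge, edge to face, face to
    origin when [b] is true, and from edge to end, end to face, face to edge otherwise. *)
Definition sd_e_fun (x : sdart) : sdart := let: (d, b, o) := x in
  match b, o with
  | true, None => (e d, false, None) | false, None => (e d, true, None)
  | true, Some true => (d, false, Some false) | false, Some false => (d, true, Some true)
  | true, Some false => (f^-1%g d, false, Some true) | false, Some true => (f d, true, Some false)
  end.

Lemma sd_eK_fun : involutive sd_e_fun.
Proof. by case=> [[d []] [[]|]] /=; rewrite ?eK ?permK ?permKV. Qed.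

Definition sd_e : {perm sdart} := perm (inv_inj sd_eK_fun).

Definition sd_f_fun (x : sdart) : sdart := let: (d, b, o) := x in
  (d, b, match o with None => Some true | Some true => Some false | _ => None end).

Lemma sd_f_inj : injective sd_f_fun.
Proof. by case=> [[d b] [[]|]] [[d' b'] [[]|]] //= [-> ->]. Qed.

Definition sd_f : {perm sdart} := perm sd_f_inj.

Definition sdE x : sd_e x = sd_e_fun x := permE _ x.
Definition sdF x : sd_f x = sd_f_fun x := permE _ x.

(** Names the origin of a dart: [None], [Some true] and [Some false] stand for an old vertex, edge
    or face. *)
Definition sd_label (x : sdart) : option bool * {set D} := let: (d, b, o) := x in
  match b, o with
  | true, None => (None, porbit (e * f)%g d) | false, Some true => (None, porbit (e * f)%g (e d))
  | true, Some true | false, None => (Some true, porbit e d)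
  | _, Some false => (Some false, porbit f d)
  end.

Lemma sd_n x : (sd_e * sd_f)%g x = let: (d, b, o) := x in
  match b, o with
  | true, None => (e d, false, Some true) | false, None => (e d, true, Some true)
  | true, Some true => (d, false, None) | false, Some false => (d, true, Some false)
  | true, Some false => (f^-1%g d, false, Some false) | false, Some true => (f d, true, None)
  end.
Proof. by rewrite permM sdE sdF; case: x => [[d []] [[]|]]. Qed.

Lemma sd_label_n x : sd_label ((sd_e * sd_f)%g x) = sd_label x.
Proof.
rewrite sd_n; case: x => [[d []] [[]|]] //=; congr pair; apply/eqP; rewrite ?eq_porbit_mem ?eK //.
- by rewrite -porbitV perm_in_porbit.
- exact: porbit_id.
- by have := perm_in_porbit (e * f) (e d); rewrite permM eK.
- exact: perm_in_porbit.
Qed.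

(** Each dart shares its orbit with a base dart of one of three kinds; turning around an old vertex,
    edge or face moves these along [e * f], [e] or the inverse of [f]. *)
Lemma sd_label_orbit x y : sd_label x = sd_label y -> y \in porbit (sd_e * sd_f) x.
Proof.
pose s : {perm sdart} := (sd_e * sd_f)%g.
have st z : s z \in porbit s z := perm_in_porbit _ _.
have ts z w : w \in porbit s z -> s w \in porbit s z by apply: porbit_stable.
have nVE d : (f (e d), true, None) \in porbit s (d, true, None).
  by have := ts _ _ (st (d, true, None)); rewrite /s !sd_n.
have VEn d d' : d' \in porbit (e * f) d -> (d', true, None) \in porbit s (d, true, None).
  by apply: (porbit_map (h := fun d => (d, true, None) : sdart)) => z; rewrite permM.
have VF d : (d, false, Some true) \in porbit s (e d, true, None).
  by have := st (e d, true, None); rewrite /s sd_n eK.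
have EFe d : (e d, true, Some true) \in porbit s (d, true, Some true).
  by have := ts _ _ (st (d, true, Some true)); rewrite /s !sd_n.
have EFn d d' : d' \in porbit e d -> (d', true, Some true) \in porbit s (d, true, Some true).
  by apply: (porbit_map (h := fun d => (d, true, Some true) : sdart)).
have EV d : (d, false, None) \in porbit s (d, true, Some true).
  by have := st (d, true, Some true); rewrite /s sd_n.
have FE d : (d, false, Some false) \in porbit s (d, true, Some false).
  by rewrite porbit_sym; have := st (d, false, Some false); rewrite /s sd_n.
have FVn d d' : d' \in porbit f d -> (d', true, Some false) \in porbit s (d, true, Some false).
  rewrite -porbitV; apply: (porbit_map (h := fun d => (d, true, Some false) : sdart)) => z.
  by have := ts _ _ (st (z, true, Some false)); rewrite /s !sd_n.
pose base (z : sdart) : sdart := let: (d, b, o) := z in match b, o with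
  | true, None => (d, true, None) | false, Some true => (e d, true, None)
  | true, Some true | false, None => (d, true, Some true) | _, Some false => (d, true, Some false) end.
have bP z : z \in porbit s (base z) by case: z => [[d []] [[]|]] //=; apply: porbit_id.
have key : base y \in porbit s (base x) -> y \in porbit s x.
  move=> h; have h1 : x \in porbit s (base x) := bP x; rewrite porbit_sym in h1.
  exact: porbit_trans (porbit_trans h1 h) (bP y).
move=> e1; apply: key; move: e1.
case: x => [[d []] [[]|]]; case: y => [[d' []] [[]|]] //= [] /esym/eqP; rewrite eq_porbit_mem;
  first [exact: VEn | exact: EFn | exact: FVn].
Qed.

Lemma card_sd_f_porbit x : #|porbit sd_f x| = 3.
Proof.
have f3 : sd_f (sd_f (sd_f x)) = x by rewrite !sdF; case: x => [[d b] [[]|]].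
have -> : porbit sd_f x = [set x; sd_f x; sd_f (sd_f x)].
  apply/setP => y; apply/idP/idP => [|].
    by apply: stable_porbit; [move=> z; rewrite !inE => /orP[/orP[]|] /eqP->; rewrite ?f3 eqxx ?orbT|rewrite !inE eqxx].
  rewrite !inE => /orP[/orP[]|] /eqP->; rewrite ?porbit_id ?perm_in_porbit //.
  by apply/porbit_stable/perm_in_porbit.
rewrite -setUA !cardsU1 !inE cards1 !sdF; case: x {f3} => [[d b] [[]|]] /=;
  by rewrite !xpair_eqE /= !andbF.
Qed.

Lemma card_involutive_porbit x : #|porbit e x| = 2.
Proof.
have -> : porbit e x = [set x; e x].
  apply/setP => y; apply/idP/idP => [|].
    by apply: stable_porbit; [move=> z; rewrite !inE => /orP[] /eqP->; rewrite ?eK eqxx ?orbT|rewrite !inE eqxx].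
  by rewrite !inE => /orP[] /eqP->; rewrite ?porbit_id ?perm_in_porbit.
by rewrite cards2 eq_sym ex.
Qed.

Lemma cyc_sd_n : cyc (sd_e * sd_f) = cyc (e * f) + cyc e + cyc f.
Proof.
rewrite (card_porbits_label sd_label_n sd_label_orbit).
pose I k (s : {perm D}) : {set option bool * {set D}} := [set (k, O) | O in porbits s].
have cI k s : #|I k s| = cyc s by rewrite card_imset // => ? ? [].
have kI k k' s s' : k != k' -> I k s :&: I k' s' = set0.
  move=> kk; apply/setP => z; rewrite !inE; apply/negbTE/negP => /andP[/imsetP[O _ ->] /imsetP[O' _ [kk' _]]].
  by rewrite kk' eqxx in kk.
have -> : [set sd_label x | x in sdart] = I None (e * f)%g :|: I (Some true) e :|: I (Some false) f.
  apply/setP => z; apply/imsetP/idP => [[[[d []] [[]|]] _ ->] /=|].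
  - by rewrite !inE imset_f ?orbT ?imset_f.
  - by rewrite !inE [X in _ || X]imset_f ?orbT ?imset_f.
  - by rewrite !inE imset_f ?imset_f.
  - by rewrite !inE imset_f ?imset_f.
  - by rewrite !inE [X in _ || X]imset_f ?orbT ?imset_f.
  - by rewrite !inE imset_f ?orbT ?imset_f.
  rewrite !inE => /orP[/orP[]|] /imsetP[_ /imsetP[d _ ->] ->].
  - by exists (d, true, None).
  - by exists (d, true, Some true).
  - by exists (d, true, Some false).
by rewrite !cardsU setIUl !kI // setU0 !cards0 !subn0 !cI.
Qed.

(** With V, E, F for the old map, the new one has V + E + F vertices, [2 * #|D|] triangles and
    [6 * #|D|] darts, hence the same Euler characteristic. *)
Lemma sd_map : is_map sd_e sd_f g.
Proof.
case: Mf => D0 _ _ con euler; split.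
- by rewrite !card_prod card_bool card_option card_bool; lia.
- by move=> x; rewrite !sdE sd_eK_fun.
- move=> [[d b] o]; rewrite sdE /=; case: b; case: o => [[]|] //=; by rewrite !xpair_eqE /= ?andbF.
- move=> S /set0Pn[x xS] eS fS.
  have fl d b o o' : (d, b, o) \in S -> (d, b, o') \in S.
    move=> h; have h1 := fS _ h; have h2 := fS _ h1; move: h h1 h2; rewrite !sdF /=.
    by case: o => [[]|]; case: o' => [[]|].
  have fl2 d b b' o o' : (d, b, o) \in S -> (d, b', o') \in S.
    move=> h; case: b b' h => [] [] h; try exact: fl h.
      by have := eS _ (fl _ _ _ (Some true) h); rewrite sdE => /fl.
    by have := eS _ (fl _ _ _ (Some false) h); rewrite sdE => /fl.
  have T : [set d | (d, true, None) \in S] = setT.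
    apply: con => [|d|d]; rewrite ?inE.
    - by apply/set0Pn; case: x xS => [[d b] o] /fl2 h; exists d; rewrite inE.
    - by move=> /eS; rewrite sdE => /fl2.
    - by move=> /fl2 h; have := eS _ (h false (Some true)); rewrite sdE => /fl2.
  apply/setP => -[[d b] o]; rewrite inE; have := in_setT d; rewrite -T inE; exact: fl2.
have c2 := card_porbits_const card_involutive_porbit.
have c3 := card_porbits_const card_sd_f_porbit.
have cn := cyc_sd_n; have cD : #|sdart| = 6 * #|D|.
  by rewrite !card_prod card_bool card_option card_bool; lia.
rewrite cD in c3 *; lia.
Qed.

End Subdivision.

End Subdivision.

(** * Making room for a leaf *)

Module LeafAddition.

Import Maps Detachment SparseMaps Subdivision.

Import GroupScope.
Local Open Scope nat_scope.

Section Leaf.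
Variables (D : finType) (e f : {perm D}) (g n : nat) (r r' : rel 'I_n)
  (A : {set 'I_n}) (B : 'I_n -> {set D}) (u x : 'I_n).
Hypotheses (Mf : is_map e f g) (Am : model e f r A B) (At : tight e f A B).
Hypotheses (rI : irreflexive r) (uA : u \in A) (xA : x \notin A).
Hypothesis r'A : forall a b, a \in A -> b \in A -> r' a b -> r a b.
Hypothesis r'x : forall a, a \in A -> r' x a || r' a x -> a = u.
Hypothesis r'I : r' x x = false.

(* In the barycentric subdivision v keeps its vertices and takes the midpoints of
   the edges that lead to larger vertices; x is put on a face at u. *)
Lemma leaf_model : exists B', model (sd_e Mf) (sd_f D) r' (x |: A) B'.
Proof.
have [B0 Bn Bd _ Br] := Am; have [D0 eK ex con euler] := Mf.
have /set0Pn[d0 d0u] := B0 u uA.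
pose Q v d := (d \in B v) && [exists w in A, (v < w) && (e d \in B w)].
pose Bv v : {set sdart D} := [set y | let: (d, b, o) := y in match b, o with
  | true, None => d \in B v | false, Some true => e d \in B v
  | true, Some true | false, None => Q v d || Q v (e d)
  | _, Some false => false end].
pose Bx : {set sdart D} := [set y | sd_label e f y == (Some false, porbit f d0)].
pose B' v := if v == x then Bx else Bv v.
have vx v : v \in A -> v == x = false by move=> vA; apply: contraNF xA => /eqP<-.
have B'A v : v \in A -> B' v = Bv v by move=> vA; rewrite /B' vx.
have B'x : B' x = Bx by rewrite /B' eqxx.
have Bf v d : v \in A -> (f d \in B v) = (e d \in B v).
  move=> vA; apply/idP/idP => h; last by have := Bn v (e d) vA h; rewrite permM eK.
  have h1 : e d = (e * f)^-1%g (f d) by apply: (@perm_inj _ (e * f)%g); rewrite permKV permM eK.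
  by rewrite h1; apply: stable_inv => // z; apply: Bn.
have QQ v w d : v \in A -> w \in A -> Q v d || Q v (e d) -> Q w d || Q w (e d) -> v = w.
  move=> vA wA; have QP z d' : z \in A -> Q z d' -> d' \in B z /\ exists w', [/\ w' \in A, z < w' & e d' \in B w'].
    by move=> zA /andP[dz /exists_inP[w' wA' /andP[zw ew]]]; split=> //; exists w'.
  move=> /orP[] /(QP _ _ vA)[h1 [a [aA va ha]]] /orP[] /(QP _ _ wA)[h2 [b [bA wb hb]]].
  - exact: Bd h1 h2.
  - rewrite eK in hb; have ? := Bd _ _ _ aA wA ha h2; have ? := Bd _ _ _ bA vA hb h1; subst; lia.
  - rewrite eK in ha; have ? := Bd _ _ _ aA wA ha h2; have ? := Bd _ _ _ bA vA hb h1; subst; lia.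
  - exact: Bd h1 h2.
have Bvn v y : v \in A -> y \in Bv v -> (sd_e Mf * sd_f D)%g y \in Bv v.
  move=> vA; rewrite sd_n !inE; case: y => [[d []] [[]|]] //=; rewrite ?eK //.
  - by rewrite Bf.
  - by rewrite orbC.
exists B'; split.
- move=> v; rewrite !inE => /orP[/eqP->|vA]; apply/set0Pn.
    by exists (d0, true, Some false); rewrite B'x inE.
  by have /set0Pn[d dv] := B0 v vA; exists (d, true, None); rewrite B'A // inE.
- move=> v y; rewrite !inE => /orP[/eqP->|vA]; first by rewrite B'x !inE sd_label_n.
  by rewrite B'A //; apply: Bvn.
- move=> v w y; rewrite !inE => /orP[/eqP->|vA] /orP[/eqP->|wA] //; rewrite ?B'x ?B'A //.
  + by rewrite !inE; case: y => [[d []] [[]|]].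
  + by rewrite !inE; case: y => [[d []] [[]|]].
  + rewrite !inE; case: y => [[d []] [[]|]] //.
    * exact: QQ.
    * exact: Bd.
    * exact: Bd.
    * exact: QQ.
- move=> v S; rewrite !inE => /orP[/eqP->|vA].
    rewrite B'x => SB /set0Pn[y yS] nS _; apply/eqP; rewrite eqEsubset SB; apply/subsetP => z.
    have := subsetP SB y yS; rewrite !inE => /eqP h1 /eqP h2.
    by apply: (stable_porbit nS yS); apply: sd_label_orbit; rewrite h1 h2.
  rewrite B'A // => SB /set0Pn[y yS] nS eS.
  have nS' z : z \in S -> _ := nS z.
  have eV d : d \in B v -> Q v d || Q v (e d) -> (d, true, None) \in S = ((e d, false, None) \in S).
    move=> dv Qd; apply/idP/idP => h; have := eS _ h; rewrite sdE /= ?eK; apply; rewrite inE //.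
    by rewrite eK orbC.
  have nn d b o : (d, b, o) \in S -> (let: (d, b, o) := (d, b, o) in
    match b, o with
    | true, None => (e d, false, Some true) | false, None => (e d, true, Some true)
    | true, Some true => (d, false, None) | false, Some false => (d, true, Some false)
    | true, Some false => (f^-1%g d, false, Some false) | false, Some true => (f d, true, None)
    end) \in S by move=> /nS; rewrite sd_n.
  (* Every part of [Bv v] contains a dart at the old vertex of [v], since a midpoint is linked to
     its end in [B v]. Tightness then yields all of [Bv v]. *)
  have [d1 d1v d1S] : exists2 d, d \in B v & (d, true, None) \in S.
    have := subsetP SB y yS; rewrite inE; case: y yS => [[d []] [[]|]] //= yS.
    + case: (boolP (d \in B v)) => [dv Qd|dv].
        exists d => //; rewrite eV //; have := nn _ _ _ (nn _ _ _ (nn _ _ _ yS)); by rewrite /= ?eK.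
      rewrite {1}/Q (negbTE dv) /= => Qd; have edv : e d \in B v by case/andP: Qd.
      exists (e d) => //; rewrite eV // ?Qd // eK; exact: (nn _ _ _ yS).
    + by exists d.
    + by move=> edv; exists (f d); [rewrite Bf | have := nn _ _ _ yS].
    + case: (boolP (d \in B v)) => [dv Qd|dv].
        exists d => //; rewrite eV //; have := nn _ _ _ (nn _ _ _ yS); by rewrite /= ?eK.
      rewrite {1}/Q (negbTE dv) /= => Qd; have edv : e d \in B v by case/andP: Qd.
      by exists (e d) => //; rewrite eV // ?Qd // eK.
  have VS d : d \in B v -> (d, true, None) \in S.
    move=> dv; apply: stable_porbit nS d1S _; apply: sd_label_orbit => /=.
    by congr pair; apply/eqP; rewrite eq_porbit_mem porbit_sym; apply: At d1v dv.
  have QS d : Q v d -> [/\ (d, true, Some true) \in S, (e d, true, Some true) \in S,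
      (d, false, None) \in S & (e d, false, None) \in S].
    move=> Qd; have dv : d \in B v by case/andP: Qd.
    have h1 : (e d, false, None) \in S by rewrite -eV ?Qd ?VS.
    have := nn _ _ _ h1; rewrite /= eK => h2; have h3 := nn _ _ _ h2.
    by have h4 := nn _ _ _ h3.
  apply/eqP; rewrite eqEsubset SB; apply/subsetP => -[[d []] [[]|]]; rewrite inE //.
  + by move=> /orP[/QS[]|/QS[]] //; rewrite eK.
  + exact: VS.
  + by move=> /VS/nn; rewrite /= eK.
  + by move=> /orP[/QS[]|/QS[]] //; rewrite eK.
- have efd0 : e (f^-1%g d0) \in B u by rewrite -Bf // permKV.
  move=> a b; rewrite !inE => /orP[/eqP->|aA] /orP[/eqP->|bA]; first by rewrite r'I.
  (* The centre of the face of [d0] belongs to [x] alone and is adjacent to the origin of [d0], a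
     vertex of [u]. *)
  + move=> h; have -> : b = u by apply: r'x => //; rewrite h.
    rewrite B'x B'A //; exists (d0, true, Some false); first by rewrite inE.
    by rewrite sdE /= inE.
  + move=> h; have -> : a = u by apply: r'x => //; rewrite h orbT.
    rewrite B'x B'A //; exists (f^-1%g d0, false, Some true); first by rewrite inE.
    by rewrite sdE /= inE /= permKV.
  + move=> /(r'A aA bA) rab; have [d da db] := Br a b aA bA rab; rewrite !B'A //.
    have [ab|ba|/val_inj ab] := ltngtP a b; last by rewrite ab rI in rab.
      exists (d, false, None); rewrite ?sdE !inE //= /Q da; apply/orP; left; apply/exists_inP.
      by exists b; rewrite // ab.
    exists (d, true, None); rewrite ?sdE !inE //= /Q db eK; apply/orP; left; apply/exists_inP.
    by exists a; rewrite // ba.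
Qed.

End Leaf.

End LeafAddition.

(** * Triangular maps as simplicial surfaces *)

Module LabelledComplexes.

Import Defs.
Import Adjacency Maps Detachment SparseMaps Subdivision.

Import GroupScope.
Local Open Scope nat_scope.

Lemma card_fibers (D T : finType) (h : D -> T) k :
  (forall x, #|[set y | h y == h x]| = k) -> k * #|[set h x | x in D]| = #|D|.
Proof.
move=> hk; rewrite -[RHS]sum1_card mulnC -sum_nat_const (partition_big_imset h) /=.
apply: eq_bigr => _ /imsetP[x _ ->]; rewrite -(hk x) -sum1_card.
by apply: eq_bigl => y; rewrite inE.
Qed.

Lemma cards3 (T : finType) (a b c : T) : a != b -> b != c -> c != a -> #|[set a; b; c]| = 3.
Proof.
by move=> ab bc ca; rewrite -setUA !cardsU1 !inE cards1 (negbTE ab) (eq_sym a c) (negbTE ca) (negbTE bc).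
Qed.

Section Triangulation.
Variables (D : finType) (e f : {perm D}) (g m : nat) (l : D -> 'I_m).
Hypothesis Mf : is_map e f g.
Hypothesis f3 : forall x, f (f (f x)) = x.
Hypothesis ln : forall x, l ((e * f)%g x) = l x.
Hypothesis lorb : forall x y, l x = l y -> y \in porbit (e * f) x.
Hypothesis lsurj : forall v, exists x, l x = v.
Hypothesis l_neq : forall x, l (e x) != l x.
Hypothesis l_inj : forall x y, l x = l y -> l (e x) = l (e y) -> x = y.
Hypothesis l_opp : forall x, l (f (f (e x))) != l (f (f x)).

(** The hypotheses make the map simplicial: triangular faces, vertices named by [l], no loops
    ([l_neq]), no parallel edges ([l_inj]), and different third corners on the two sides of an edge
    ([l_opp]). *)
Definition edge_of x : {set 'I_m} := [set l x; l (f x)].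
Definition triangle_of x : {set 'I_m} := [set l x; l (f x); l (f (f x))].
Definition map_complex : {set {set 'I_m}} :=
  [set [set v] | v : 'I_m] :|: [set edge_of x | x : D] :|: [set triangle_of x | x : D].

Let eK : involutive e. Proof. by case: Mf. Qed.

Lemma l_f x : l (f x) = l (e x).
Proof. by rewrite -(ln (e x)) permM eK. Qed.

Lemma l_neq1 x : l x != l (f x). Proof. by rewrite l_f eq_sym l_neq. Qed.
Lemma l_neq2 x : l (f (f x)) != l x. Proof. by have := l_neq1 (f (f x)); rewrite f3. Qed.

Lemma card_edge_of x : #|edge_of x| = 2.
Proof. by rewrite cards2 l_neq1. Qed.

Lemma card_triangle_of x : #|triangle_of x| = 3.
Proof. by rewrite cards3 ?l_neq1 ?l_neq2. Qed.

Lemma triangle_of_f x : triangle_of (f x) = triangle_of x.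
Proof.
by apply/setP => v; rewrite !inE f3; case: (v == l x); case: (v == l (f x)); case: (v == _).
Qed.

Lemma edge_of_e x : edge_of (e x) = edge_of x.
Proof. by rewrite /edge_of !l_f eK setUC. Qed.

Lemma edge_of_inj x y : edge_of x = edge_of y -> x = y \/ x = e y.
Proof.
move=> /(set2_eq (l_neq1 x)) [] [h1 h2]; [left|right]; apply: l_inj => //.
  by rewrite -!l_f.
- by rewrite h1 l_f.
by rewrite eK -l_f.
Qed.

(** Otherwise [f (f x)] is the reverse of [y], and the two triangles at this edge share their third
    corner, against [l_opp]. *)
Lemma not_reversed x y : l x = l y -> l (f x) = l (f (f y)) -> l (f (f x)) = l (f y) -> False.
Proof.
move=> h1 h2 h3; have e1 : f (f x) = e y.
  by apply: l_inj; rewrite ?eK -?l_f ?f3.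
by have := l_opp y; rewrite -e1 f3 h2 eqxx.
Qed.

Lemma mem_triangle_of v x : v \in triangle_of x ->
  exists2 y, y \in [set x; f x; f (f x)] & v = l y /\ triangle_of y = triangle_of x.
Proof.
rewrite !inE => /orP[/orP[]|] /eqP->.
- by exists x; rewrite ?inE ?eqxx.
- by exists (f x); rewrite ?triangle_of_f // !inE eqxx orbT.
- by exists (f (f x)); rewrite ?triangle_of_f // !inE eqxx !orbT.
Qed.

Lemma triangle_of_inj x y : triangle_of x = triangle_of y -> y \in [set x; f x; f (f x)].
Proof.
move=> xy; have : l y \in triangle_of x by rewrite xy !inE eqxx.
case/mem_triangle_of => z zx [lz zE].
suff -> : y = z by [].
have : l (f y) \in triangle_of z by rewrite zE xy !inE eqxx orbT.
have : l (f (f y)) \in triangle_of z by rewrite zE xy !inE eqxx !orbT.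
rewrite !inE -lz => /orP[/orP[]|] /eqP h2 /orP[/orP[]|] /eqP h1;
  try (by have := l_neq1 y; rewrite h1 eqxx); try (by have := l_neq2 y; rewrite h2 eqxx).
- by have := l_neq1 (f y); rewrite h1 h2 eqxx.
- by case: (not_reversed lz h1 h2).
- by apply: l_inj; rewrite -?l_f.
- by have := l_neq1 (f y); rewrite h1 h2 eqxx.
Qed.

Lemma sub_triangle_of (s : {set 'I_m}) x : s \subset triangle_of x -> #|s| = 2 ->
  exists2 y, s = edge_of y & triangle_of y = triangle_of x.
Proof.
move=> sx /eqP/cards2P[a [b [ab se]]]; subst s.
have := subsetP sx b (set22 _ _); have := subsetP sx a (set21 _ _).
case/mem_triangle_of => y _ [ya <-]; case/mem_triangle_of => z; rewrite !inE => /orP[/orP[]|] /eqP-> [zb _].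
- by rewrite ya zb eqxx in ab.
- by exists y; rewrite // /edge_of -ya zb.
- by exists (f (f y)); rewrite ?triangle_of_f // /edge_of f3 -zb -ya setUC.
Qed.

Lemma map_complexP s : s \in map_complex ->
  [\/ exists v, s = [set v], exists x, s = edge_of x | exists x, s = triangle_of x].
Proof.
rewrite !inE => /orP[/orP[]|] /imsetP[x _ ->].
- by apply: Or31; exists x. - by apply: Or32; exists x. - by apply: Or33; exists x.
Qed.

Lemma edge_of_in x : edge_of x \in map_complex.
Proof. by rewrite in_setU in_setU (imset_f edge_of) ?orbT. Qed.

Lemma triangle_of_in x : triangle_of x \in map_complex.
Proof. by rewrite in_setU (imset_f triangle_of) ?orbT. Qed.

Lemma faces1 : faces_of_size map_complex 1 = [set [set v] | v : 'I_m].
Proof.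
apply/setP => s; rewrite inE; apply/andP/imsetP => [[/map_complexP[] [v ->]]|[v _ ->]].
- by exists v.
- by rewrite card_edge_of.
- by rewrite card_triangle_of.
by rewrite cards1 !inE imset_f.
Qed.

Lemma faces2 : faces_of_size map_complex 2 = [set edge_of x | x : D].
Proof.
apply/setP => s; rewrite inE; apply/andP/imsetP => [[/map_complexP[] [v ->]]|[v _ ->]].
- by rewrite cards1.
- by exists v.
- by rewrite card_triangle_of.
by rewrite card_edge_of edge_of_in.
Qed.

Lemma faces3 : faces_of_size map_complex 3 = [set triangle_of x | x : D].
Proof.
apply/setP => s; rewrite inE; apply/andP/imsetP => [[/map_complexP[] [v ->]]|[v _ ->]].
- by rewrite cards1.
- by rewrite card_edge_of.
- by exists v.
by rewrite card_triangle_of triangle_of_in.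
Qed.

Lemma triangleP a b c : reflect (exists x, [set a; b; c] = triangle_of x) (triangle map_complex a b c).
Proof.
apply: (iffP andP) => [[c3 inK]|[x e1]]; last by rewrite e1 card_triangle_of triangle_of_in.
have : [set a; b; c] \in faces_of_size map_complex 3 by rewrite inE inK.
by rewrite faces3 => /imsetP[x _ ->]; exists x.
Qed.

(** The conditions are inherited from the map: a vertex is one orbit of [e * f], so its link is
    connected, and running along [f] orients the triangles coherently. *)
Lemma map_complex_surface : orientable_surface_of_genus map_complex g.
Proof.
have [D0 _ ex con euler] := Mf.
have triE x : triangle map_complex (l x) (l (f x)) (l (f (f x))) by apply/triangleP; exists x.
split.
- split.
  + split.
    * by apply/negP => /map_complexP[] [v h]; [have := cards1 v|have := card_edge_of v|have := card_triangle_of v]; rewrite -h cards0.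
    * by move=> v; rewrite !inE imset_f.
    * move=> s t tK st s0; have s_gt0 : 0 < #|s| by rewrite card_gt0.
      have [c1|c1] := eqVneq #|s| 1.
        by move/eqP/cards1P: c1 => [v ->]; rewrite !inE imset_f.
      have [ct|ct] := leqP #|t| #|s|.
        by have -> : s = t by apply/eqP; rewrite eqEcard st.
      case/map_complexP: tK => [] [x tE]; subst t.
      - by move: ct; rewrite cards1; lia.
      - by move: ct; rewrite card_edge_of; lia.
      move: ct; rewrite card_triangle_of => ct.
      have [|y -> _] := sub_triangle_of st; first by lia.
      exact: edge_of_in.
  + have tri x : triangle_of x \in faces_of_size map_complex 3 by rewrite faces3 imset_f.
    move=> s /map_complexP[] [x ->].
    * have [y <-] := lsurj x; exists (triangle_of y); first exact: tri.
      by rewrite sub1set !inE eqxx.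
    * by exists (triangle_of x); [apply: tri | apply: subsetUl].
    * by exists (triangle_of x); first exact: tri.
  + move=> s; rewrite faces2 => /imsetP[x _ ->].
    have -> : finset (fun t : {set 'I_m} => (t \in faces_of_size map_complex 3) && (edge_of x \subset t))
      = [set triangle_of x; triangle_of (e x)].
      rewrite faces3; apply/setP => t; rewrite inE in_set2; apply/andP/orP => [[/imsetP[y _ ->] xt]|[] /eqP->].
      - have [y' /edge_of_inj h <-] := sub_triangle_of xt (card_edge_of x).
        by case: h => ->; rewrite ?eK; [left|right].
      - by split; [apply: imset_f | apply: subsetUl].
      - by split; [apply: imset_f | rewrite -edge_of_e; apply: subsetUl].
    rewrite cards2; case: eqP => // h; have := triangle_of_inj h; rewrite !inE.
    case/orP=> [/orP[]|] /eqP h1; first by have := ex x; rewrite h1 eqxx.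
      by have := l_neq2 x; rewrite l_f -h1 eK eqxx.
    by have := l_neq1 (f x); rewrite -h1 l_f eqxx.
  + move=> v a b; rewrite !faces2.
    have dart w : [set v; w] \in [set edge_of x | x : D] -> exists2 x, l x = v & l (f x) = w.
      move=> /imsetP[x _ vx]; have vw : v != w.
        by have := card_edge_of x; rewrite -vx cards2; case: eqP.
      case: (set2_eq vw vx) => [] [-> ->]; first by exists x.
      by exists (e x); rewrite ?l_f ?eK.
    move=> /dart[x xv xa] /dart[y yv yb]; subst a b.
    have yx : y \in porbit (e * f) x by apply: lorb; rewrite xv.
    suff : y \in [set z | (l z == v) && connect (triangle map_complex v) (l (f x)) (l (f z))].
      by rewrite inE => /andP[].
    apply: stable_porbit yx; last by rewrite inE xv eqxx connect0.
    move=> z; rewrite !inE ln => /andP[/eqP zv cz]; rewrite zv eqxx /=.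
    apply: connect_trans cz (connect1 _).
    rewrite permM; apply/triangleP; exists (e z).
    rewrite /triangle_of (l_f z) (l_f (e z)) eK zv; apply/setP => w; rewrite !inE.
    by case: (w == v); case: (w == l (e z)).
- split; first by have [x _] := card_gt0P D0; case: (l x) => i; apply: leq_trans.
  move=> u v; have [x <-] := lsurj u; have [y <-] := lsurj v.
  suff : y \in [set z | connect (fun a b => [set a; b] \in map_complex) (l x) (l z)] by rewrite inE.
  have cE z : [set l z; l (e z)] \in map_complex by rewrite -l_f; apply: edge_of_in.
  rewrite (con [set z | _]) ?inE //.
  + by apply/set0Pn; exists x; rewrite inE connect0.
  + by move=> z; rewrite !inE => cz; apply: connect_trans cz (connect1 _).
  + by move=> z; rewrite !inE l_f => cz; apply: connect_trans cz (connect1 _).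
- exists (fun a b c => [exists x, [&& l x == a, l (f x) == b & l (f (f x)) == c]]); split.
  + by move=> a b c /existsP[x /and3P[/eqP<- /eqP<- /eqP<-]].
  + move=> a b c /existsP[x /and3P[/eqP<- /eqP<- /eqP<-]]; apply/existsP; exists (f x).
    by rewrite f3 !eqxx.
  + move=> a b c /triangleP[x abc].
    have : a \in triangle_of x by rewrite -abc !inE eqxx.
    case/mem_triangle_of => y _ [ay]; rewrite -abc => yE.
    have c3 : #|[set a; b; c]| = 3 by rewrite -yE card_triangle_of.
    have c2' (u w : 'I_m) : #|[set u; w]| != 3 by rewrite cards2; case: (u != w).
    have ba : b != a by apply: contra_eqN c3 => /eqP->; rewrite setUid.
    have ca : c != a by apply: contra_eqN c3 => /eqP->; rewrite setUAC setUid.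
    have bc : b != c by apply: contra_eqN c3 => /eqP->; rewrite -setUA setUid.
    have hb : b \in triangle_of y by rewrite yE !inE eqxx orbT.
    have hc : c \in triangle_of y by rewrite yE !inE eqxx orbT.
    move: hb hc; rewrite !inE -ay (negbTE ba) (negbTE ca) /= => /orP[] /eqP hb /orP[] /eqP hc;
      try (by rewrite hb hc eqxx in bc).
      rewrite (_ : [exists x, _] = true); last by apply/existsP; exists y; rewrite ay hb hc !eqxx.
      apply/negP => /existsP[z /and3P[/eqP za /eqP zc /eqP zb]].
      by apply: (not_reversed (x := z) (y := y)); rewrite ?za ?zc ?zb.
    rewrite addbC (_ : [exists x, _] = true); last by apply/existsP; exists y; rewrite ay hb hc !eqxx.
    apply/negP => /existsP[z /and3P[/eqP za /eqP zc /eqP zb]].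
    by apply: (not_reversed (x := z) (y := y)); rewrite ?za ?zc ?zb.
  + move=> a b c d /existsP[x /and3P[/eqP xa /eqP xb /eqP<-]] /existsP[y /and3P[/eqP ya /eqP yb /eqP<-]].
    by have -> : x = y by apply: l_inj; rewrite ?xa // -!l_f xb.
- rewrite /euler_characteristic faces1 faces2 faces3.
  have c1 : #|[set [set v] | v : 'I_m]| = cyc (e * f).
    rewrite (card_porbits_label ln lorb) (card_imset _ set1_inj); apply: eq_card => v.
    by have [x <-] := lsurj v; rewrite inE imset_f.
  have c2 : 2 * #|[set edge_of x | x : D]| = #|D|.
    apply: card_fibers => x; have -> : [set y | edge_of y == edge_of x] = [set x; e x].
      apply/setP => y; rewrite !inE; apply/eqP/orP => [/edge_of_inj[->|->]|[]/eqP->].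
      - by left. - by right. - by []. - by rewrite edge_of_e.
    by rewrite cards2 eq_sym ex.
  have cf x : #|[set x; f x; f (f x)]| = 3.
    rewrite cards3 //; first by apply: contraNneq (l_neq1 x) => <-.
      by apply: contraNneq (l_neq1 (f x)) => <-.
    by apply: contraNneq (l_neq2 x) => ->.
  have c3 : 3 * #|[set triangle_of x | x : D]| = #|D|.
    apply: card_fibers => x; rewrite -(cf x); congr #|pred_of_set _|.
    apply/setP => y; rewrite inE; apply/eqP/idP => [/esym/triangle_of_inj//|].
    by rewrite !inE => /orP[/orP[]|] /eqP->; rewrite ?triangle_of_f.
  have c4 : 3 * cyc f = #|D|.
    apply: card_porbits_const => x; rewrite -(cf x); congr #|pred_of_set _|.
    apply/setP => y; apply/idP/idP => [|].
      apply: stable_porbit; last by rewrite !inE eqxx.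
      by move=> z; rewrite !inE => /orP[/orP[]|] /eqP->; rewrite ?f3 eqxx ?orbT.
    rewrite !inE => /orP[/orP[]|] /eqP->; rewrite ?porbit_id ?perm_in_porbit //.
    exact/porbit_stable/perm_in_porbit.
  move: c1 c2 c3 c4 euler; move: #|[set [set v] | v : 'I_m]| #|[set edge_of _ | _ in _]| #|[set triangle_of _ | _ in _]| => V E F.
  move: (cyc _) (cyc _) #|D| => n1 n2 n3; clear; lia.
Qed.

End Triangulation.

End LabelledComplexes.

(** * Routing edges in the second barycentric subdivision *)

Module Routing.

Import Defs.
Import Adjacency Maps Detachment SparseMaps Subdivision LabelledComplexes.

Import GroupScope.
Local Open Scope nat_scope.

Section Labels.
Variables (D T : finType) (t : D -> T) (x0 : D).
Let L := [set t x | x in D].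
Let Lx x : t x \in L. Proof. exact: imset_f. Qed.
(** Vertices of a complex are ordinals, so the labels have to be numbered. *)
Definition label_rank x := enum_rank_in (Lx x0) (t x).
Lemma label_rank_eq x y : label_rank x = label_rank y <-> t x = t y.
Proof. by split=> [|e]; [apply: enum_rank_in_inj | rewrite /label_rank e]. Qed.
Lemma label_rank_surj v : exists x, label_rank x = v.
Proof.
have /imsetP[x _ e] : enum_val v \in L := enum_valP v.
by exists x; rewrite /label_rank -e enum_valK_in.
Qed.
End Labels.

Section Simple.
Variables (D : finType) (e f : {perm D}) (g : nat).
Hypothesis Mf : is_map e f g.
Hypothesis neqV : forall x, e x \notin porbit (e * f) x.
Hypothesis neqF : forall x, e x \notin porbit f x.
Hypothesis injVF : forall x y, y \in porbit f x -> y \in porbit (e * f) x -> y = x.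
Let eK : involutive e. Proof. by case: Mf. Qed.
Notation e' := (sd_e Mf).
Notation f' := (sd_f D).
Notation lab := (sd_label e f).

Lemma porbit_e x y : y \in porbit e x -> y = x \/ y = e x.
Proof.
move=> yx; suff /set2P[->|->] : y \in [set x; e x] by [left|right].
apply: stable_porbit yx; last by rewrite set21.
by move=> z /set2P[]->; rewrite ?eK !inE eqxx ?orbT.
Qed.

Lemma porbit_ef x : porbit (e * f)%g (e (f^-1%g x)) = porbit (e * f)%g x.
Proof.
apply/eqP; rewrite eq_porbit_mem porbit_sym.
by have := perm_in_porbit (e * f) (e (f^-1%g x)); rewrite permM eK permKV.
Qed.

Lemma porbit_fe x : porbit (e * f)%g (e x) = porbit (e * f)%g (f x).
Proof. by rewrite -[in RHS]porbit_ef permK. Qed.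

Lemma sd_label_neq x : lab (e' x) != lab x.
Proof. by rewrite sdE; case: x => [[d []] [[]|]]. Qed.

(** Two darts with the same ends join cells of the same two kinds; a coincidence is excluded by
    [neqV] for vertex and edge, [neqF] for edge and face, [injVF] for face and vertex. *)
Lemma sd_label_inj x y : lab x = lab y -> lab (e' x) = lab (e' y) -> x = y.
Proof.
have pe a b : porbit e a = porbit e b -> b = a \/ b = e a.
  by move=> /eqP; rewrite eq_porbit_mem porbit_sym => /porbit_e.
have peV a b : porbit e a = porbit e b -> porbit (e * f)%g a = porbit (e * f)%g b -> a = b.
  move=> /pe[->//|->] /eqP; by rewrite eq_porbit_mem porbit_sym (negbTE (neqV a)).
have peF a b : porbit e a = porbit e b -> porbit f a = porbit f b -> a = b.
  move=> /pe[->//|->] /eqP; by rewrite eq_porbit_mem porbit_sym (negbTE (neqF a)).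
have pVF a b : porbit f a = porbit f b -> porbit (e * f)%g a = porbit (e * f)%g b -> a = b.
  move=> /eqP + /eqP; rewrite !eq_porbit_mem => h1 h2; exact: injVF.
have ee a : porbit e (e a) = porbit e a by apply/eqP; rewrite eq_porbit_mem perm_in_porbit.
rewrite !sdE; case: x => [[d []] [[]|]]; case: y => [[d' []] [[]|]] //= [h1] [h2].
- by rewrite (peF _ _ h1 h2).
- by rewrite !porbit_ef in h2; rewrite (pVF _ _ h1 h2).
- by rewrite !ee in h2; rewrite (peV _ _ h2 h1).
- by rewrite !porbit_fe in h1; have /perm_inj -> := pVF _ _ h2 h1.
- by rewrite (peF _ _ h2 h1).
- have : e d = e d' by apply: peV => //; rewrite !ee.
  by move/perm_inj->.
Qed.

Lemma sd_label_opp x : lab (f' (f' (e' x))) != lab (f' (f' x)).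
Proof.
have nf d : porbit f (e d) != porbit f d by rewrite eq_porbit_mem neqF.
have nv d : porbit (e * f)%g (e d) != porbit (e * f)%g d by rewrite eq_porbit_mem neqV.
have ne d : porbit e (f^-1%g d) != porbit e d.
  rewrite eq_porbit_mem; apply/negP => /porbit_e[h|h].
    have fd : f d = d by rewrite -{1}h permKV.
    have := neqV (e d); rewrite eK; have := perm_in_porbit (e * f) (e d).
    by rewrite permM eK fd => ->.
  by have := neqF d; rewrite -h -porbitV perm_in_porbit.
rewrite !sdE !sdF; case: x => [[d []] [[]|]] //=; rewrite xpair_eqE /=.
- exact: nv.
- exact: ne.
- exact: nf.
- by have := ne (f d); rewrite permK eq_sym.
- by rewrite eq_sym; apply: nv.
- exact: nf.
Qed.

Lemma sd_f3 x : f' (f' (f' x)) = x.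
Proof. by rewrite !sdF; case: x => [[d b] [[]|]]. Qed.

(** [neqV], [neqF] and [injVF] can fail for a general map, but every barycentric subdivision
    satisfies them ([sd_neqV], [sd_neqF], [sd_injVF]). Hence the second subdivision is always a
    simplicial complex. *)
Lemma simple_complex (x0 : sdart D) :
  orientable_surface_of_genus (map_complex f' (label_rank lab x0)) g.
Proof.
have lr := label_rank_eq lab x0.
apply: (map_complex_surface (sd_map Mf)).
- exact: sd_f3.
- by move=> x; apply/lr/sd_label_n.
- by move=> x y /lr; apply: sd_label_orbit.
- exact: label_rank_surj.
- by move=> x; apply/eqP => /lr/eqP; rewrite (negbTE (sd_label_neq x)).
- by move=> x y /lr h1 /lr h2; apply: sd_label_inj.
- by move=> x; apply/eqP => /lr/eqP; rewrite (negbTE (sd_label_opp x)).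
Qed.

End Simple.

Section Double.
Variables (D : finType) (e f : {perm D}) (g : nat).
Hypothesis Mf : is_map e f g.
Let eK : involutive e. Proof. by case: Mf. Qed.
Notation e1 := (sd_e Mf).
Notation f1 := (sd_f D).
Notation lab := (sd_label e f).

Lemma sd_label_porbit x y : y \in porbit (e1 * f1) x -> lab y = lab x.
Proof.
move=> yx; suff : y \in [set z | lab z == lab x] by rewrite inE => /eqP.
by apply: stable_porbit yx; rewrite ?inE // => z; rewrite !inE sd_label_n.
Qed.

Lemma sd_f_porbit x y : y \in porbit f1 x -> y.1 = x.1.
Proof.
move=> yx; suff : y \in [set z : sdart D | z.1 == x.1] by rewrite inE => /eqP.
apply: stable_porbit yx; rewrite ?inE // => z; rewrite !inE sdF.
by case: z => [[d b] o].
Qed.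

Lemma sd_neqV x : e1 x \notin porbit (e1 * f1) x.
Proof. by apply/negP => /sd_label_porbit/eqP; rewrite (negbTE (sd_label_neq Mf x)). Qed.

Lemma sd_neqF x : e1 x \notin porbit f1 x.
Proof.
apply/negP => /sd_f_porbit/eqP; rewrite sdE.
by case: x => [[d []] [[]|]] /=; rewrite xpair_eqE andbF.
Qed.

Lemma sd_injVF x y : y \in porbit f1 x -> y \in porbit (e1 * f1) x -> y = x.
Proof.
move=> /sd_f_porbit + /sd_label_porbit.
by case: x => [[d []] [[]|]]; case: y => [[d' []] [[]|]] //= [->].
Qed.

Let M1 := sd_map Mf.

(* Every edge of the map becomes a path of length 4 in the second barycentric
   subdivision: nV d, nH d, nE d = nE (e d), nH (e d), nV (e d). *)
Lemma route_darts : exists m (K : {set {set 'I_m}}) (nV nH nE : D -> 'I_m),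
  [/\ orientable_surface_of_genus K g,
      forall d, [/\ [set nV d; nH d] \in K, [set nH d; nE d] \in K & nE (e d) = nE d],
      forall d d', (nV d == nV d') = (d' \in porbit (e * f) d),
      injective nH /\ (forall d d', nE d = nE d' -> d' = d \/ d' = e d) &
      forall d d', [/\ nV d != nH d', nV d != nE d' & nH d != nE d']].
Proof.
have [D0 _ _ _ _] := Mf; have [d0 _] := card_gt0P D0.
pose x0 : sdart (sdart D) := ((d0, true, None), true, None).
pose lab2 := sd_label e1 f1.
pose l := label_rank lab2 x0.
have lr x y : l x = l y <-> lab2 x = lab2 y := label_rank_eq lab2 x0 x y.
have edge x : [set l x; l (sd_f (sdart D) x)] \in map_complex (sd_f (sdart D)) l.
  by rewrite /map_complex in_setU in_setU (imset_f (edge_of (sd_f _) l)) ?orbT.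
(* [VE d] runs from the origin of [d] to the middle of its edge; its origin, midpoint and end give
   the nodes [nV d], [nH d], [nE d]. *)
pose VE d : sdart D := (d, true, None).
pose xV d : sdart (sdart D) := (VE d, true, None).
pose xH d : sdart (sdart D) := (VE d, false, None).
pose xE d : sdart (sdart D) := (VE d, false, Some true).
have HH d : l (sd_f (sdart D) (xV d)) = l (xH d) by apply/lr; rewrite sdF.
have HE d : l (sd_f (sdart D) (xH d)) = l (xE d) by apply/lr; rewrite sdF.
have lV d : lab2 (xV d) = (None, porbit (e1 * f1)%g (VE d)) by [].
have lH d : lab2 (xH d) = (Some true, porbit e1 (VE d)) by [].
have lE d : lab2 (xE d) = (None, porbit (e1 * f1)%g (e d, false, None)) by rewrite /lab2 /= sdE.
exists _, (map_complex (sd_f (sdart D)) l), (l \o xV), (l \o xH), (l \o xE); split.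
- by apply: (simple_complex M1); [apply: sd_neqV | apply: sd_neqF | apply: sd_injVF].
- move=> d; rewrite /= -{1}HH -{1}HE !edge; split=> //.
  apply/lr; rewrite !lE eK; congr pair; apply/eqP; rewrite eq_porbit_mem.
  by apply: sd_label_orbit => /=; congr pair; apply/eqP; rewrite eq_porbit_mem perm_in_porbit.
- move=> d d'; apply/eqP/idP => [/lr|h].
    rewrite !lV => -[] /eqP; rewrite eq_porbit_mem porbit_sym => /sd_label_porbit /= [] /eqP.
    by rewrite eq_porbit_mem.
  apply/lr; rewrite !lV; congr pair; apply/eqP; rewrite eq_porbit_mem; apply: sd_label_orbit => /=.
  by congr pair; apply/eqP; rewrite eq_porbit_mem.
- split; last first.
  + move=> d d' /lr; rewrite !lE => -[] /eqP; rewrite eq_porbit_mem porbit_sym => /sd_label_porbit /= [] /eqP.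
    rewrite eq_porbit_mem => h; have /(porbit_e Mf) : d' \in porbit e d.
      have h1 := porbit_trans (perm_in_porbit e d) h.
      by have h2 := perm_in_porbit e (e d'); rewrite eK in h2; apply: porbit_trans h1 h2.
    by case; [left|right].
  move=> d d' /lr; rewrite !lH => -[] /eqP; rewrite eq_porbit_mem => /(porbit_e M1)[[]//|].
  by rewrite sdE => -[].
- move=> d d'; split; apply/eqP => /lr; rewrite ?lV ?lH ?lE //.
  move=> -[] /eqP; rewrite eq_porbit_mem => /sd_label_porbit; by [].
Qed.

(** Each adjacent pair picks one edge, with [c v u] the reverse of [c u v]; as branch sets are
    single vertices, all paths at [u] start from the same node. *)
Lemma route n (r : rel 'I_n) B : model e f r setT B -> tight e f setT B ->
  symmetric r -> irreflexive r ->
  exists m (K : {set {set 'I_m}}) (V : 'I_n -> 'I_m) (H E : 'I_n -> 'I_n -> 'I_m),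
  [/\ orientable_surface_of_genus K g,
      forall u v, r u v -> [/\ [set V u; H u v] \in K, [set H u v; E u v] \in K & E u v = E v u],
      injective V,
      forall u v u' v', r u v -> r u' v' -> (H u v = H u' v' -> u = u' /\ v = v') /\
        (E u v = E u' v' -> u = u' /\ v = v' \/ u = v' /\ v = u') &
      forall u a b c d, r a b -> r c d -> [/\ V u != H a b, V u != E a b & H a b != E c d]].
Proof.
move=> [B0 Bn Bd Bc Br] Bt rC rI.
have [m [K [nV [nH [nE [sK nK nV_eq [nH_inj nE_eq] ndisj]]]]]] := route_darts.
have [D0 _ _ _ _] := Mf; have [d0 _] := card_gt0P D0.
pose P u v := [pred x | (x \in B u) && (e x \in B v)].
pose ch u v := odflt d0 [pick x | P u v x].
have chP u v : r u v -> ch u v \in B u /\ e (ch u v) \in B v.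
  move=> ruv; rewrite /ch; case: pickP => [x /andP[]//|h].
  by have [x xu xv] := Br u v (in_setT _) (in_setT _) ruv; have := h x; rewrite /= xu xv.
pose c (u v : 'I_n) := if u < v then ch u v else e (ch v u).
have cP u v : r u v -> c u v \in B u /\ e (c u v) \in B v.
  rewrite /c; case: ifP => _ ruv; first exact: chP.
  by rewrite eK; move: ruv; rewrite rC => /chP[].
have ce u v : r u v -> c v u = e (c u v).
  have [->|uv] := eqVneq u v; first by rewrite rI.
  rewrite /c => _; case: (ltnP u v) => h; first by rewrite ltnNge (ltnW h).
  have -> : v < u by rewrite ltn_neqAle h andbT (inj_eq val_inj) eq_sym.
  by rewrite eK.
have cinj u v u' v' : r u v -> r u' v' -> c u v = c u' v' -> u = u' /\ v = v'.
  move=> /cP[h1 h2] /cP[h3 h4] h; split.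
    by apply: Bd (in_setT _) (in_setT _) h1 _; rewrite h.
  by apply: Bd (in_setT _) (in_setT _) h2 _; rewrite h.
pose ro u := odflt d0 [pick x in B u].
have roP u : ro u \in B u.
  rewrite /ro; case: pickP => // h; have /set0Pn[x xu] := B0 u (in_setT _).
  by have := h x; rewrite xu.
have Vro u v : r u v -> nV (ro u) = nV (c u v).
  move=> /cP[h _]; apply/eqP; rewrite nV_eq; exact: Bt (in_setT _) (roP u) h.
exists m, K, (nV \o ro), (fun u v => nH (c u v)), (fun u v => nE (c u v)); split=> //.
- move=> u v ruv; have [h1 h2 h3] := nK (c u v); split=> //=; first by rewrite (Vro u v).
  by rewrite (ce u v) // h3.
- move=> u v /= /eqP; rewrite nV_eq => h; apply: Bd (in_setT _) (in_setT _) _ (roP v).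
  by apply: stable_porbit (roP u) h => z; apply: Bn (in_setT _).
- move=> u v u' v' h1 h2; split; first by move=> /nH_inj/cinj; apply.
  move=> /nE_eq[/esym/cinj|]; first by move=> /(_ h1 h2); left.
  rewrite -ce // => /esym/cinj h; right; rewrite rC in h1; by have [-> ->] := h h1 h2.
- move=> u a b a' b' h1 h2 /=.
  by have [? ? _] := ndisj (ro u) (c a b); have [_ _ ?] := ndisj (c a b) (c a' b').
Qed.

End Double.

End Routing.

(** * Oriented triangles of a surface *)

Module OrientedTriangles.

Import Defs.
Import Adjacency Maps Detachment SparseMaps Subdivision LabelledComplexes.

Import GroupScope.
Local Open Scope nat_scope.

Section Oriented.
Variables (m : nat) (K : {set {set 'I_m}}) (g : nat).
Hypothesis sK : orientable_surface_of_genus K g.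
Variable o : 'I_m -> 'I_m -> 'I_m -> bool.
Hypothesis o_tri : forall a b c, o a b c -> triangle K a b c.
Hypothesis o_rot : forall a b c, o a b c -> o b c a.
Hypothesis tri_o : forall a b c, triangle K a b c -> o a b c (+) o a c b.
Hypothesis o_fun : forall a b c d, o a b c -> o a b d -> c = d.

Lemma o_neq a b c : o a b c -> [/\ a != b, b != c & c != a].
Proof.
have c2' (u w : 'I_m) : #|[set u; w]| != 3 by rewrite cards2; case: (u != w).
move=> /o_tri/andP[/eqP c3 _]; split; apply: contra_eqN c3 => /eqP->.
- by rewrite setUid.
- by rewrite -setUA setUid.
- by rewrite setUAC setUid.
Qed.

Lemma o_in a b c : o a b c -> [set a; b; c] \in K.
Proof. by move=> /o_tri/andP[]. Qed.

Lemma o_not_rev a b c : o a b c -> ~~ o a c b.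
Proof. by move=> h; have := tri_o (o_tri h); rewrite h. Qed.

Lemma sub_in (s t : {set 'I_m}) : t \in K -> s \subset t -> s != set0 -> s \in K.
Proof. by case: sK => -[[_ _ h] _ _ _] _ _ _; apply: h. Qed.

Lemma o_edge a b c : o a b c -> [set a; b] \in faces_of_size K 2.
Proof.
move=> h; have [ab _ _] := o_neq h; rewrite inE cards2 ab andbT.
apply: sub_in (o_in h) _ _; first exact: subsetUl.
by apply/set0Pn; exists a; rewrite set21.
Qed.

Lemma in_tri_o (a b c : 'I_m) : a != b -> b != c -> c != a -> [set a; b; c] \in K ->
  o a b c \/ o a c b.
Proof.
move=> ab bc ca abc; have /tri_o : triangle K a b c by rewrite /triangle cards3.
by case: (o a b c) => /= h; [left|right].
Qed.

(** The second triangle at the edge ab must induce the opposite direction: otherwise [o_fun] would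
    identify it with the first. *)
Lemma o_rev a b c : o a b c -> exists d, o b a d.
Proof.
move=> h; have [ab bc ca] := o_neq h; case: sK => -[_ _ two _] _ _ _.
have := two _ (o_edge h); set T := finset _ => T2.
have abcT : [set a; b; c] \in T.
  by rewrite !inE o_in // cards3 // eqxx /=; apply: subsetUl.
have /set0Pn[t] : T :\ [set a; b; c] != set0.
  by rewrite -card_gt0; move: T2; rewrite (cardsD1 [set a; b; c] T) abcT add1n => -[->].
rewrite !inE => /and3P[tn /andP[tK /eqP t3] abt].
have at_ : a \in t by apply: (subsetP abt); rewrite set21.
have bt : b \in t by apply: (subsetP abt); rewrite set22.
have /set0Pn[d] : t :\: [set a; b] != set0.
  by rewrite -card_gt0 cardsD (setIidPr abt) cards2 ab t3.
rewrite !inE negb_or => /andP[/andP[da db] dt].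
have tE : [set a; b; d] = t.
  apply/eqP; rewrite eqEcard t3 cards3 // 1?eq_sym // andbT.
  by apply/subsetP => z; rewrite !inE => /orP[/orP[]|] /eqP->.
rewrite eq_sym in db; have [h'|h'] : o a b d \/ o a d b by apply: in_tri_o => //; rewrite tE.
  by rewrite -(o_fun h h') in tE; rewrite tE eqxx in tn.
by exists d; do 2 apply: o_rot.
Qed.

Definition opp a b := odflt a [pick c | o a b c].

Lemma opp_eq a b c : o a b c -> opp a b = c.
Proof.
move=> h; rewrite /opp; case: pickP => [d hd|/(_ c)]; last by rewrite h.
exact: o_fun hd h.
Qed.

Lemma o_opp a b c : o a b c -> o b a (opp b a).
Proof. by move=> /o_rev[d h]; rewrite (opp_eq h). Qed.

Lemma edge_o (p q : 'I_m) : p != q -> [set p; q] \in K -> exists c, o p q c.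
Proof.
move=> pq pqK; case: sK => -[_ pure _ _] _ _ _.
have [t] := pure _ pqK; rewrite inE => /andP[tK /eqP t3] pqt.
have pt : p \in t by apply: (subsetP pqt); rewrite set21.
have qt : q \in t by apply: (subsetP pqt); rewrite set22.
have /set0Pn[d] : t :\: [set p; q] != set0.
  by rewrite -card_gt0 cardsD (setIidPr pqt) cards2 pq t3.
rewrite !inE negb_or => /andP[/andP[dp dq] dt].
have tE : [set p; q; d] = t.
  apply/eqP; rewrite eqEcard t3 cards3 // 1?eq_sym // andbT.
  by apply/subsetP => z; rewrite !inE => /orP[/orP[]|] /eqP->.
rewrite eq_sym in dq; have [h'|h'] : o p q d \/ o p d q by apply: in_tri_o => //; rewrite tE.
  by exists d.
by have /o_rev := o_rot (o_rot h').
Qed.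

Lemma vertex_o (p : 'I_m) : exists b c, o p b c.
Proof.
case: sK => -[[_ sing _] pure _ _] _ _ _.
have [t] := pure _ (sing p); rewrite inE sub1set => /andP[tK /eqP t3] pt.
have /set0Pn[b] : t :\: [set p] != set0.
  by rewrite -card_gt0; move: t3; rewrite (cardsD1 p t) pt add1n => -[->].
rewrite !inE => /andP[bp bt].
have [c h] : exists c, o p b c.
  apply: edge_o; first by rewrite eq_sym.
  apply: sub_in tK _ _; first by apply/subsetP => z /set2P[]->.
  by apply/set0Pn; exists p; rewrite set21.
by exists b, c.
Qed.

Definition triples := [set t : 'I_m * 'I_m * 'I_m | o t.1.1 t.1.2 t.2].

Lemma o_same_set a b c a' b' c' : o a b c -> o a' b' c' ->
  [set a; b; c] = [set a'; b'; c'] ->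
  [\/ (a', b', c') = (a, b, c), (a', b', c') = (b, c, a) | (a', b', c') = (c, a, b)].
Proof.
move=> h h' e; have [ab bc ca] := o_neq h'.
have key x y z : o x y z -> [set a'; b'; c'] = [set x; y; z] -> a' = x -> (a', b', c') = (x, y, z).
  move=> xyz e' ax; subst x; have [ay yz za] := o_neq xyz.
  have : b' \in [set a'; y; z] by rewrite -e' !inE eqxx orbT.
  have : c' \in [set a'; y; z] by rewrite -e' !inE eqxx !orbT.
  rewrite !inE (eq_sym b') (negbTE ab) (negbTE ca) /= => /orP[] /eqP cE /orP[] /eqP bE; subst;
    rewrite ?eqxx // in bc.
  by have := o_not_rev xyz; rewrite h'.
have : a' \in [set a; b; c] by rewrite e !inE eqxx.
rewrite !inE => /orP[/orP[]|] /eqP ae; [apply: Or31|apply: Or32|apply: Or33]; apply: key => //.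
- exact: o_rot.
- by rewrite -e; apply/setP => z; rewrite !inE; case: (z == a); case: (z == b); case: (z == c).
- by do 2 apply: o_rot.
- by rewrite -e; apply/setP => z; rewrite !inE; case: (z == a); case: (z == b); case: (z == c).
Qed.

Lemma card_fibers_in (D T : finType) (A : {set D}) (h : D -> T) k :
  {in A, forall x, #|[set y in A | h y == h x]| = k} -> k * #|[set h x | x in A]| = #|A|.
Proof.
move=> hk; rewrite -[RHS]sum1_card mulnC -sum_nat_const (partition_big_imset h) /=.
apply: eq_bigr => _ /imsetP[x xA ->]; rewrite -(hk x xA) -sum1_card.
by apply: eq_bigl => y; rewrite !inE.
Qed.

(** Each triangle carries three oriented triples, and each edge starts two, one per direction;
    Euler's formula then takes this form without fractions. *)
Lemma card_triples : 6 * m + 12 * g = #|triples| + 12.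
Proof.
case: (sK) => -[[_ sing _] pure _ _] _ _ eul.
have F1 : #|faces_of_size K 1| = m.
  have -> : faces_of_size K 1 = [set [set v] | v : 'I_m].
    apply/setP => s; rewrite !inE; apply/andP/imsetP => [[_ /cards1P[v ->]]|[v _ ->]]; first by exists v.
    by rewrite sing cards1.
  by rewrite (card_imset _ set1_inj) card_ord.
have F3 : 3 * #|faces_of_size K 3| = #|triples|.
  have -> : faces_of_size K 3 = [set [set t.1.1; t.1.2; t.2] | t in triples].
    apply/setP => s; rewrite inE; apply/andP/imsetP => [[sKs /eqP s3]|[[[a b] c]]]; last first.
      by rewrite inE /= => h ->; have [? ? ?] := o_neq h; rewrite o_in // cards3.
    have /card_gt0P[p ps] : 0 < #|s| by rewrite s3.
    have /card_gt0P[q] : 0 < #|s :\ p| by move: s3; rewrite (cardsD1 p s) ps; lia.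
    rewrite !inE => /andP[qp qs].
    have /set0Pn[d] : s :\: [set p; q] != set0.
      rewrite -card_gt0 cardsD s3 subn_gt0 (leq_ltn_trans (subset_leq_card (subsetIr _ _))) //.
      by rewrite cards2; case: (p != q).
    rewrite !inE negb_or => /andP[/andP[dp dq] ds].
    have tE : [set p; q; d] = s.
      apply/eqP; rewrite eqEcard s3 cards3 // 1?eq_sym // andbT.
      by apply/subsetP => z; rewrite !inE => /orP[/orP[]|] /eqP->.
    rewrite eq_sym in qp; rewrite eq_sym in dq.
    have [h|h] : o p q d \/ o p d q by apply: in_tri_o => //; rewrite tE.
      by exists (p, q, d); rewrite ?inE.
    by exists (p, d, q); rewrite ?inE //= -tE setUAC.
  apply: card_fibers_in => -[[a b] c]; rewrite inE /= => h; have [ab bc ca] := o_neq h.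
  have -> : [set y in triples | [set y.1.1; y.1.2; y.2] == [set a; b; c]] =
     [set (a, b, c); (b, c, a); (c, a, b)].
    apply/setP => -[[a' b'] c']; rewrite !inE /=; apply/andP/orP => [[h' /eqP e]|].
      by case: (o_same_set h h' (esym e)) => ->; rewrite eqxx ?orbT; [left|left|right].
    case=> [/orP[]|] /eqP[-> -> ->]; first by rewrite h.
      rewrite o_rot //; split=> //; apply/eqP/setP => z; rewrite !inE.
      by case: (z == a); case: (z == b); case: (z == c).
    rewrite (o_rot (o_rot h)); split=> //; apply/eqP/setP => z; rewrite !inE.
    by case: (z == a); case: (z == b); case: (z == c).
  by rewrite cards3 // !xpair_eqE ?(negbTE ab) ?(negbTE bc) ?(negbTE ca).
have F2 : 2 * #|faces_of_size K 2| = #|triples|.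
  have -> : faces_of_size K 2 = [set [set t.1.1; t.1.2] | t in triples].
    apply/setP => s; apply/idP/imsetP => [|[[[a b] c]]]; last first.
      by rewrite inE /= => h ->; apply: o_edge h.
    rewrite inE => /andP[sKs /cards2P[p [q [pq sE]]]]; subst s.
    by have [c h] := edge_o pq sKs; exists (p, q, c); rewrite ?inE.
  apply: card_fibers_in => -[[a b] c]; rewrite inE /= => h; have [ab bc ca] := o_neq h.
  have h2 := o_opp h.
  have -> : [set y in triples | [set y.1.1; y.1.2] == [set a; b]] = [set (a, b, c); (b, a, opp b a)].
    apply/setP => -[[a' b'] c']; rewrite !inE /=; apply/andP/orP => [[h' /eqP e]|].
      have [ab' _ _] := o_neq h'; case: (set2_eq ab' e) => [] [? ?]; subst a' b'.
        by left; rewrite (o_fun h h').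
      by right; rewrite (opp_eq h').
    case=> /eqP[-> -> ->]; first by rewrite h eqxx.
    by rewrite h2 setUC eqxx.
  by rewrite cards2 !xpair_eqE (negbTE ab).
move: eul; rewrite /euler_characteristic; lia.
Qed.

End Oriented.

End OrientedTriangles.

(** * The lattice map of a triangulated surface *)

Module Lattice.

Import Defs.
Import Adjacency Maps Detachment SparseMaps Subdivision LabelledComplexes OrientedTriangles.

Import GroupScope.
Local Open Scope nat_scope.

(** The period divides 6 and is none of 1, 2, 3. *)
Lemma card_porbit6 (D : finType) (s : {perm D}) x :
  s (s (s (s (s (s x))))) = x -> s x != x -> s (s x) != x -> s (s (s x)) != x ->
  #|porbit s x| = 6.
Proof.
move=> s6 s1 s2 s3; pose r := [:: x; s x; s (s x); s (s (s x)); s (s (s (s x))); s (s (s (s (s x))))].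
have -> : porbit s x = [set y in r].
  apply/setP => y; apply/idP/idP => [|].
    apply: stable_porbit; last by rewrite !inE eqxx.
    move=> z; rewrite !inE => /orP[|/orP[|/orP[|/orP[|/orP[|]]]]] /eqP->; by rewrite ?s6 eqxx ?orbT.
  rewrite !inE => /orP[|/orP[|/orP[|/orP[|/orP[|]]]]] /eqP->; by do ?apply: porbit_stable; rewrite ?porbit_id.
have s4 : s (s (s (s x))) != x.
  by apply: contraNneq s2 => h; rewrite -[X in _ == X]s6 h.
have s5 : s (s (s (s (s x)))) != x.
  by apply: contraNneq s1 => h; rewrite -[X in _ == X]s6 h.
by rewrite cardsE (card_uniqP _) //= !inE !(inj_eq perm_inj) !negb_or !(eq_sym x) s1 s2 s3 s4 s5.
Qed.

Lemma card_by_orbits (D : finType) (s : {perm D}) (C : {set D}) k :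
  (forall x y, y \in porbit s x -> (y \in C) = (x \in C)) ->
  (forall x, x \notin C -> #|porbit s x| = k) ->
  #|D| + k * #|[set porbit s x | x in C]| = k * cyc s + #|C|.
Proof.
move=> cst ck; set O := [set porbit s x | x in C].
have sub : O \subset porbits s by apply/subsetP => _ /imsetP[x _ ->]; apply: imset_f.
have sumE (T : finType) (A : {set T}) : \sum_x (x \in A : nat) = #|A|.
  by rewrite -sum1_card [RHS]big_mkcond /=; apply: eq_bigr => x _; case: (x \in A).
have h1 : #|~: C| = \sum_(Y in porbits s) k * (Y \in ~: O).
  rewrite -sumE (sum_porbits s); apply: eq_bigr => _ /imsetP[x _ ->].
  have -> : (porbit s x \in ~: O) = (x \notin C).
    rewrite in_setC; congr negb; apply/imsetP/idP => [[y yC /eqP]|xC]; last by exists x.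
    by rewrite eq_porbit_mem => /cst ->.
  rewrite (eq_bigr (fun=> (x \notin C : nat))); last by move=> y /cst <-; rewrite in_setC.
  rewrite sum_nat_const; have [xC|xC] := boolP (x \in C); first by rewrite !muln0.
  by rewrite ck // !muln1.
have h2 : \sum_(Y in porbits s) (Y \in ~: O : nat) = cyc s - #|O|.
  rewrite -cardsDS // -sumE big_mkcond; apply: eq_bigr => Y _; rewrite !inE andbC.
  by case: (Y \in porbits s).
rewrite -big_distrr /= h2 in h1; have := cardsC C; have := subset_leq_card sub.
rewrite h1 -/(cyc s) => h3 h4; by rewrite -h4 -addnA -mulnDr subnK // addnC.
Qed.

Section Lattice.
Variables (m : nat) (K : {set {set 'I_m}}) (g : nat).
Hypothesis sK : orientable_surface_of_genus K g.
Variable o : 'I_m -> 'I_m -> 'I_m -> bool.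
Hypothesis o_tri : forall a b c, o a b c -> triangle K a b c.
Hypothesis o_rot : forall a b c, o a b c -> o b c a.
Hypothesis tri_o : forall a b c, triangle K a b c -> o a b c (+) o a c b.
Hypothesis o_fun : forall a b c d, o a b c -> o a b d -> c = d.
Variable N : nat.
Hypothesis N_gt0 : 0 < N.
Variables p0 q0 r0 : 'I_m.
Hypothesis opqr : o p0 q0 r0.

Let oppE : forall a b c, o a b c -> opp o a b = c := opp_eq o_fun.
Let o_opp' : forall a b c, o a b c -> o b a (opp o b a) := o_opp sK o_tri o_rot tri_o o_fun.
Let neqo : forall a b c, o a b c -> [/\ a != b, b != c & c != a] := o_neq o_tri.

(* Each triangle abc of K is cut into N^2 small triangles, whose corners have
   barycentric coordinates (i, j, k) / N.  A dart runs along a small triangle; it is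
   given by its origin, by the frame (a, b, c) in which it is parallel to ab, and by
   a boolean that tells whether the small triangle points upwards; it leads to
   (i - 1, j + 1, k) in that case and to (i + 1, j - 1, k) otherwise. *)
Definition raw := (bool * ('I_m * 'I_m * 'I_m) * (nat * nat * nat))%type.

(** The small triangle must fit: upwards its other corners are (i - 1, j + 1, k) and (i - 1, j, k +
    1), downwards (i + 1, j - 1, k) and (i + 1, j, k - 1). *)
Definition valid (r : raw) : bool := let: (u, (a, b, c), (i, j, k)) := r in
  [&& o a b c, i + j + k == N & if u then 0 < i else (0 < j) && (0 < k)].

Definition raw_f (r : raw) : raw := let: (u, (a, b, c), (i, j, k)) := r in
  if u then (true, (b, c, a), (j.+1, k, i.-1)) else (false, (b, c, a), (j.-1, k, i.+1)).

(** With [k = 0] an upward dart lies on the side ab, and its reverse belongs to the triangle across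
    this side. Otherwise reversing stays in the triangle and exchanges upward and downward. *)
Definition raw_e (r : raw) : raw := let: (u, (a, b, c), (i, j, k)) := r in
  if u then
    if 0 < k then (false, (a, b, c), (i.-1, j.+1, k))
    else (true, (b, a, opp o b a), (j.+1, i.-1, k))
  else (true, (a, b, c), (i.+1, j.-1, k)).

(** [raw_f] after [raw_e], simplified: turning around a lattice point only permutes its
    coordinates. *)
Definition raw_n (r : raw) : raw := let: (u, (a, b, c), (i, j, k)) := r in
  if u then
    if 0 < k then (false, (b, c, a), (j, k, i))
    else (true, (a, opp o b a, b), (i, k, j))
  else (true, (b, c, a), (j, k, i)).

Lemma valid_f r : valid r -> valid (raw_f r).
Proof. by case: r => [[[] [[a b] c]] [[i j] k]] /and3P[oabc /eqP h1 h2] /=; rewrite (o_rot oabc); lia. Qed.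

Lemma valid_e r : valid r -> valid (raw_e r).
Proof.
case: r => [[[] [[a b] c]] [[i j] k]] /and3P[oabc /eqP h1 h2] /=; last by rewrite oabc; lia.
by case: ifP => h3 /=; rewrite ?oabc ?(o_opp' oabc); lia.
Qed.

Lemma raw_eK r : valid r -> raw_e (raw_e r) = r.
Proof.
case: r => [[[] [[a b] c]] [[i j] k]] /and3P[oabc /eqP h1 h2] /=.
  have -> : i = i.-1.+1 by lia.
  case: ifP => h3 //=; rewrite h3; have e1 := o_opp' oabc.
  by rewrite (oppE oabc).
have -> : 0 < k by lia.
by have -> : j = j.-1.+1 by lia.
Qed.

Lemma raw_f3 r : valid r -> raw_f (raw_f (raw_f r)) = r.
Proof.
case: r => [[[] [[a b] c]] [[i j] k]] /and3P[oabc /eqP h1 h2] /=.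
  by have -> : i = i.-1.+1 by lia.
by have [-> ->] : j = j.-1.+1 /\ k = k.-1.+1 by lia.
Qed.

Lemma raw_fe r : valid r -> raw_f (raw_e r) = raw_n r.
Proof.
case: r => [[[] [[a b] c]] [[i j] k]] /and3P[oabc /eqP h1 h2] /=.
  have -> : i = i.-1.+1 by lia.
  by case: ifP.
by have -> : j = j.-1.+1 by lia.
Qed.

Lemma raw_e_neq r : valid r -> raw_e r != r.
Proof.
case: r => [[[] [[a b] c]] [[i j] k]] /and3P[oabc _ _] //=.
have [ab _ _] := neqo oabc; case: ifP => _; apply/eqP => -[] // ba.
by rewrite ba eqxx in ab.
Qed.

Definition box := (bool * ('I_m * 'I_m * 'I_m) * ('I_N.+1 * 'I_N.+1 * 'I_N.+1))%type.
Definition unbox (x : box) : raw := let: (u, t, (i, j, k)) := x in (u, t, (val i, val j, val k)).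
Definition ldart : finType := {x : box | valid (unbox x)}.
Definition rawof (x : ldart) : raw := unbox (val x).

Lemma rawof_valid x : valid (rawof x). Proof. exact: (valP x). Qed.

Lemma rawof_inj : injective rawof.
Proof.
move=> [x hx] [y hy]; rewrite /rawof /= => e; apply: val_inj => /=; move: e.
case: x {hx} => [[u t] [[i j] k]]; case: y {hy} => [[u' t'] [[i' j'] k']] /=.
by move=> [-> -> /val_inj -> /val_inj -> /val_inj ->].
Qed.

Definition rebox (r : raw) : box := let: (u, t, (i, j, k)) := r in (u, t, (inord i, inord j, inord k)).

Lemma reboxK r : valid r -> unbox (rebox r) = r.
Proof.
by case: r => [[u [[a b] c]] [[i j] k]] /and3P[_ /eqP h1 _]; rewrite /= !inordK //; lia.
Qed.

Lemma valid0 : valid (true, (p0, q0, r0), (N, 0, 0)).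
Proof. by rewrite /= opqr N_gt0 !addn0 eqxx. Qed.

Lemma valid_rebox r : valid r -> valid (unbox (rebox r)).
Proof. by move=> h; rewrite reboxK. Qed.

(** Made total by a default, which valid arguments never reach. *)
Definition mk (r : raw) : ldart := insubd (exist (fun x => valid (unbox x)) _ (valid_rebox valid0)) (rebox r).

Lemma rawof_mk r : valid r -> rawof (mk r) = r.
Proof. by move=> h; rewrite /rawof /mk insubdK ?reboxK // unfold_in reboxK. Qed.

Lemma mk_rawof x : mk (rawof x) = x.
Proof. by apply: rawof_inj; rewrite rawof_mk ?rawof_valid. Qed.

Lemma lat_eK : involutive (fun x => mk (raw_e (rawof x))).
Proof.
move=> x; have h := rawof_valid x; have h' := valid_e h.
by rewrite rawof_mk // raw_eK // mk_rawof.
Qed.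

Lemma lat_f_inj : injective (fun x => mk (raw_f (rawof x))).
Proof.
move=> x y /(congr1 rawof); have hx := rawof_valid x; have hy := rawof_valid y.
rewrite !rawof_mk ?valid_f // => /(congr1 (raw_f \o raw_f)) /=.
by rewrite !raw_f3 // => /rawof_inj.
Qed.

Definition lat_e : {perm ldart} := perm (inv_inj lat_eK).
Definition lat_f : {perm ldart} := perm lat_f_inj.

Lemma rawof_e x : rawof (lat_e x) = raw_e (rawof x).
Proof. by rewrite permE rawof_mk // valid_e // rawof_valid. Qed.
Lemma rawof_f x : rawof (lat_f x) = raw_f (rawof x).
Proof. by rewrite permE rawof_mk // valid_f // rawof_valid. Qed.
Lemma rawof_n x : rawof ((lat_e * lat_f)%g x) = raw_n (rawof x).
Proof. by rewrite permM rawof_f rawof_e raw_fe // rawof_valid. Qed.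

Lemma valid_n r : valid r -> valid (raw_n r).
Proof. by move=> h; rewrite -raw_fe // valid_f // valid_e. Qed.

Lemma mk_n r : valid r -> (lat_e * lat_f)%g (mk r) = mk (raw_n r).
Proof. by move=> h; apply: rawof_inj; rewrite rawof_n !rawof_mk // valid_n. Qed.

Definition coord_raw (r : raw) (v : 'I_m) : nat := let: (_, (a, b, c), (i, j, k)) := r in
  (v == a) * i + (v == b) * j + (v == c) * k.
Definition coord (x : ldart) := coord_raw (rawof x).

Lemma coord_n x : coord ((lat_e * lat_f)%g x) =1 coord x.
Proof.
move=> v; rewrite /coord rawof_n; have := rawof_valid x.
by case: (rawof x) => [[[] [[a b] c]] [[i j] k]] /and3P[oabc /eqP h1 h2] /=; try case: ifP => /= h3; lia.
Qed.

Notation n_orb := (porbit (lat_e * lat_f)).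

Lemma mk_n_orb r : valid r -> mk (raw_n r) \in n_orb (mk r).
Proof. by move=> h; rewrite -mk_n // perm_in_porbit. Qed.

Lemma orb_sym (D : finType) (s : {perm D}) x y : y \in porbit s x -> x \in porbit s y.
Proof. by rewrite porbit_sym. Qed.

Lemma up_orb r : valid r -> exists2 r', valid r' & [/\ r'.1.1 = true, mk r' \in n_orb (mk r)
  & coord_raw r' =1 coord_raw r].
Proof.
case: r => [[[] [[a b] c]] [[i j] k]] h.
  by exists (true, (a, b, c), (i, j, k)) => //; split=> //; rewrite porbit_id.
exists (true, (b, c, a), (j, k, i)); first exact: (valid_n h).
split=> //; first exact: (mk_n_orb h).
by move=> v /=; lia.
Qed.

(** At a corner of [K] the lattice darts turn like the triangles of [K], so the connected link of
    [a] makes them one orbit. *)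
Lemma corner_orb a b c b' c' : o a b c -> o a b' c' ->
  mk (true, (a, b', c'), (N, 0, 0)) \in n_orb (mk (true, (a, b, c), (N, 0, 0))).
Proof.
move=> h h'; have vd x y : o a x y -> valid (true, (a, x, y), (N, 0, 0)).
  by move=> hx; rewrite /= hx !addn0 eqxx.
have nx x y z : o a x y -> o x a z -> mk (true, (a, z, x), (N, 0, 0)) \in n_orb (mk (true, (a, x, y), (N, 0, 0))).
  by move=> hx hz; have := mk_n_orb (vd _ _ hx); rewrite /= (oppE hz).
have [_ _ _ link] : closed_surface K by case: sK.
have e1 := o_edge sK o_tri h; have e2 := o_edge sK o_tri h'.
suff key v : connect (triangle K a) b v -> forall w, o a v w ->
    mk (true, (a, v, w), (N, 0, 0)) \in n_orb (mk (true, (a, b, c), (N, 0, 0))).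
  by apply: key => //; apply: link.
case/connectP => s sP ->; elim/last_ind: s sP => [_ w /=|s x IH].
  by move=> hw; rewrite (o_fun hw h) porbit_id.
rewrite rcons_path last_rcons => /andP[sP tri] w hw.
have := IH sP; move: (last b s) tri => y tri {}IH.
have [hy|hy] : o a y x \/ o a x y.
  by have := tri_o tri; case: (o a y x) => /=; [left|right].
- by apply: porbit_trans (IH _ hy) _; apply: orb_sym; apply: nx hw (o_rot (o_rot hy)).
- rewrite (o_fun hw hy); have hz := o_opp' (o_rot (o_rot hy)).
  by apply: porbit_trans (IH _ hz) _; apply: nx hz (o_rot (o_rot hy)).
Qed.

Lemma coordE u a b c i j k : valid (u, (a, b, c), (i, j, k)) ->
  let w := coord_raw (u, (a, b, c), (i, j, k)) in
  [/\ w a = i, w b = j, w c = k & forall v, 0 < w v -> v \in [set a; b; c]].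
Proof.
move=> /and3P[h _ _] /=; have [ab bc ca] := neqo h.
rewrite !eqxx (eq_sym b a) (eq_sym c b) (eq_sym a c) (negbTE ab) (negbTE bc) (negbTE ca).
split; try lia; move=> v; rewrite !inE.
by case: (v == a); case: (v == b); case: (v == c).
Qed.

(** Up to rotation, a point inside a triangle has one frame and a point inside a side has two; at a
    corner [corner_orb] applies. *)
Lemma same_coord_orb r r' : valid r -> valid r' -> coord_raw r =1 coord_raw r' ->
  mk r' \in n_orb (mk r).
Proof.
move=> v1 v2 e12; have [q1 w1 [u1 o1 e1]] := up_orb v1; have [q2 w2 [u2 o2 e2]] := up_orb v2.
apply: porbit_trans o1 _; apply: (@porbit_trans _ _ _ (mk q2)); last exact: orb_sym.
have {e12 e1 e2} : coord_raw q2 =1 coord_raw q1 by move=> v; rewrite e1 e2 e12.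
clear o2; move: q1 q2 w1 w2 u1 u2 => [[u [[a b] c]] [[i j] k]] [[u' [[a' b'] c']] [[i' j'] k']].
move=> {v1 v2} v1 v2 /= uT uT'; subst u u'; set w := coord_raw (true, (a, b, c), _) => e12.
pose U x y z : raw := (true, (x, y, z), (w x, w y, w z)).
have fm x y z i0 j0 k0 : valid (true, (x, y, z), (i0, j0, k0)) ->
    coord_raw (true, (x, y, z), (i0, j0, k0)) =1 w ->
    (true, (x, y, z), (i0, j0, k0)) = U x y z /\ forall v, 0 < w v -> v \in [set x; y; z].
  move=> /coordE; set w' := coord_raw _ => -[h1 h2 h3 h] ew.
  by rewrite /U -!ew h1 h2 h3; split=> // v; rewrite -ew; apply: h.
have [E1 S1] := fm _ _ _ _ _ _ v1 (fun=> erefl); have [E2 S2] := fm _ _ _ _ _ _ v2 e12.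
rewrite {}E1 {}E2 in v1 v2 *.
have VU x y z : valid (U x y z) -> [/\ o x y z, w x + w y + w z = N & 0 < w x].
  by move=> /and3P[? /eqP ? ?].
have R2 x y z : valid (U x y z) -> 0 < w z -> mk (U z x y) \in n_orb (mk (U x y z)).
  move=> vU wz; have vn := valid_n vU; have on := mk_n_orb vU; move: vn on; rewrite /= wz => vn on.
  exact: porbit_trans on (mk_n_orb vn).
have R1 x y z t : valid (U x y z) -> w z = 0 -> o y x t -> w t = 0 ->
    mk (U x t y) \in n_orb (mk (U x y z)).
  move=> vU wz yxt wo; have := mk_n_orb vU; by rewrite /= wz (oppE yxt) /U wo.
(* Frames with the same first corner coincide, or share one more corner and the point is on their
   common side, or share no other and the point is the corner [a']. *)
have fin y z : valid (U a' y z) -> (forall v, 0 < w v -> v \in [set a'; y; z]) ->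
    mk (U a' b' c') \in n_orb (mk (U a' y z)).
  move=> vU SU; have [ox sx wx] := VU _ _ _ vU; have [ox' sx' _] := VU _ _ _ v2.
  have [n1 n2 n3] := neqo ox; have [n1' n2' n3'] := neqo ox'.
  have notrev := o_not_rev o_tri tri_o ox.
  have zero v : v != a' -> v != y -> v != z -> w v = 0.
    move=> h1 h2 h3; apply/eqP; rewrite -leqn0 leqNgt; apply/negP => /SU.
    by rewrite !inE (negbTE h1) (negbTE h2) (negbTE h3).
  have zero' v : v != a' -> v != b' -> v != c' -> w v = 0.
    move=> h1 h2 h3; apply/eqP; rewrite -leqn0 leqNgt; apply/negP => /S2.
    by rewrite !inE (negbTE h1) (negbTE h2) (negbTE h3).
  have [yb|yb] := eqVneq y b'.
    by rewrite -yb in ox' *; rewrite (o_fun ox' ox) porbit_id.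
  have [zc|zc] := eqVneq z c'.
    rewrite -zc in ox'; by rewrite (o_fun (o_rot (o_rot ox)) (o_rot (o_rot ox'))) eqxx in yb.
  have [yc|yc] := eqVneq y c'.
    rewrite -yc in ox' *.
    have zb : z != b' by apply: contraNneq notrev => ->.
    apply: R1 => //; last 2 first.
    - exact: o_rot (o_rot ox').
    - by apply: zero; rewrite 1?eq_sym // eq_sym.
    by apply: zero' => //; rewrite -yc eq_sym.
  have wy : w y = 0 by apply: zero' => //; rewrite eq_sym.
  have [zb|zb] := eqVneq z b'.
    rewrite -zb in ox' v2 *; apply: orb_sym; apply: R1 => //; last by do 2 apply: o_rot.
    by apply: zero; rewrite 1?eq_sym // -zb in n2' *; rewrite 1?eq_sym.
  have wz : w z = 0 by apply: zero'.
  have wb : w b' = 0 by apply: zero; rewrite 1?eq_sym // eq_sym.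
  have wc : w c' = 0 by apply: zero; rewrite 1?eq_sym // eq_sym.
  have wN : w a' = N by rewrite wy wz !addn0 in sx.
  by rewrite /U wy wz wb wc wN; apply: corner_orb.
have [_ _ wa'] := VU _ _ _ v2; have [oabc sabc wa] := VU _ _ _ v1.
have := S1 _ wa'; rewrite !inE => /orP[/orP[]|] /eqP ea.
- by rewrite ea in fin *; apply: fin.
- have vb : valid (U b c a) by rewrite /= (o_rot oabc) -ea wa' ea andbT; lia.
  apply: (@porbit_trans _ _ _ (mk (U b c a))); first by apply/orb_sym/R2.
  rewrite ea in fin *; apply: fin => // v /S1; rewrite !inE.
  by case: (v == a); case: (v == b); case: (v == c).
- have vc : valid (U c a b) by rewrite /= (o_rot (o_rot oabc)) -ea wa' ea andbT; lia.
  apply: (@porbit_trans _ _ _ (mk (U c a b))); first by apply: R2; rewrite // -ea.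
  rewrite ea in fin *; apply: fin => // v /S1; rewrite !inE.
  by case: (v == a); case: (v == b); case: (v == c).
Qed.

Lemma coord_orb x y : (y \in n_orb x) <-> coord x =1 coord y.
Proof.
split=> [yx v|h].
  suff : y \in [set z | coord z v == coord x v] by rewrite inE => /eqP.
  by apply: stable_porbit yx; rewrite ?inE // => z; rewrite !inE coord_n.
by rewrite -(mk_rawof x) -(mk_rawof y); apply: same_coord_orb; rewrite ?rawof_valid.
Qed.

Lemma triangle_at (t : {set 'I_m}) a : t \in K -> #|t| = 3 -> a \in t ->
  exists b c, o a b c /\ t = [set a; b; c].
Proof.
move=> tK t3 at_; have /set0Pn[b] : t :\ a != set0.
  by rewrite -card_gt0; move: t3; rewrite (cardsD1 a t) at_ add1n => -[->].
rewrite !inE => /andP[ba bt]; rewrite eq_sym in ba.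
have /set0Pn[d] : t :\: [set a; b] != set0.
  rewrite -card_gt0 cardsD t3 subn_gt0 (leq_ltn_trans (subset_leq_card (subsetIr _ _))) //.
  by rewrite cards2; case: (a != b).
rewrite !inE negb_or => /andP[/andP[da db] dt].
have tE : [set a; b; d] = t.
  apply/eqP; rewrite eqEcard t3 cards3 // 1?eq_sym // andbT.
  by apply/subsetP => z; rewrite !inE => /orP[/orP[]|] /eqP->.
rewrite eq_sym in db; have [h|h] : o a b d \/ o a d b by apply: (in_tri_o tri_o) => //; rewrite tE.
  by exists b, d.
by exists d, b; split=> //; rewrite -tE setUAC.
Qed.

Lemma sum_triangle (w : 'I_m -> nat) a b c : o a b c ->
  (forall v, 0 < w v -> v \in [set a; b; c]) -> \sum_v w v = w a + w b + w c.
Proof.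
move=> h sw; have [ab bc ca] := neqo h.
rewrite (bigD1 a) //= (bigD1 b) /=; last by rewrite eq_sym.
rewrite (bigD1 c) /=; last by rewrite ca eq_sym.
rewrite big1 ?addn0 ?addnA // => v /andP[/andP[va vb] vc].
apply/eqP; rewrite -leqn0 leqNgt; apply/negP => /sw.
by rewrite !inE (negbTE va) (negbTE vb) (negbTE vc).
Qed.

Lemma node_frame (w : 'I_m -> nat) (s : {set 'I_m}) a : \sum_v w v = N -> s \in K -> a \in s ->
  (forall v, 0 < w v -> v \in s) -> exists b c, [/\ o a b c, s \subset [set a; b; c] &
   w a + w b + w c = N].
Proof.
move=> sumw sKs as_ ws; case: (sK) => -[_ pure _ _] _ _ _.
have [t] := pure _ sKs; rewrite inE => /andP[tK /eqP t3] st.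
have [b [c [h tE]]] := triangle_at tK t3 (subsetP st _ as_).
exists b, c; split=> //; rewrite -?tE //.
by rewrite -(sum_triangle h) // => v /ws/(subsetP st); rewrite tE.
Qed.

Lemma coord_frame u a b c (w : 'I_m -> nat) : o a b c ->
  (forall v, 0 < w v -> v \in [set a; b; c]) ->
  coord_raw (u, (a, b, c), (w a, w b, w c)) =1 w.
Proof.
move=> h sw v /=; have [ab bc ca] := neqo h.
have [->|va] := eqVneq v a; first by rewrite (negbTE ab) (eq_sym a c) (negbTE ca); lia.
have [->|vb] := eqVneq v b; first by rewrite (negbTE bc); lia.
have [->|vc] := eqVneq v c; first by lia.
suff -> : w v = 0 by lia.
apply/eqP; rewrite -leqn0 leqNgt; apply/negP => /sw.
by rewrite !inE (negbTE va) (negbTE vb) (negbTE vc).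
Qed.

Lemma node_dart (w : 'I_m -> nat) : \sum_v w v = N -> [set v | 0 < w v] \in K ->
  exists x, coord x =1 w.
Proof.
move=> sumw wK; have /set0Pn[a aw] : [set v | 0 < w v] != set0.
  by case: (sK) => -[[n0 _ _] _ _ _] _ _ _; apply: contraNneq n0 => <-.
have ws v : 0 < w v -> v \in [set v | 0 < w v] by rewrite inE.
have [b [c [h st sN]]] := node_frame sumw wK aw ws.
have v1 : valid (true, (a, b, c), (w a, w b, w c)).
  by rewrite /= h sN eqxx; move: aw; rewrite inE.
exists (mk (true, (a, b, c), (w a, w b, w c))) => v.
rewrite /coord rawof_mk //; apply: coord_frame => // z /ws; exact: (subsetP st).
Qed.

(** A unit moves from [q] to [p]. In a frame where [p] follows [q] this is an upward dart; in the
    opposite frame it is a downward one, unless the third coordinate is 0, when the triangle across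
    the side is used. *)
Lemma edge_dart (w : 'I_m -> nat) p q : \sum_v w v = N -> p != q -> 0 < w q ->
  p |: [set v | 0 < w v] \in K ->
  exists x, coord x =1 w /\ forall v, coord (lat_e x) v = w v + (v == p) - (v == q).
Proof.
move=> sumw pq wq sKs; pose s := p |: [set v | 0 < w v].
have ws v : 0 < w v -> v \in s by rewrite !inE => ->; rewrite orbT.
have ps : p \in s by rewrite setU11.
have qs : q \in s by apply: ws.
have [y [z [h st sN]]] := node_frame sumw sKs qs ws.
have wt v : 0 < w v -> v \in [set q; y; z] by move=> /ws/(subsetP st).
have finish r : valid r -> coord_raw r =1 w ->
    (forall v, coord_raw (raw_e r) v = w v + (v == p) - (v == q)) ->
    exists x, coord x =1 w /\ forall v, coord (lat_e x) v = w v + (v == p) - (v == q).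
  by move=> vr cr er; exists (mk r); split=> v; rewrite /coord ?rawof_e rawof_mk.
have upcase c : o q p c -> (forall v, 0 < w v -> v \in [set q; p; c]) ->
    exists x, coord x =1 w /\ forall v, coord (lat_e x) v = w v + (v == p) - (v == q).
  move=> hc wc; have cf := coord_frame true hc wc.
  have sNc : w q + w p + w c = N by rewrite -(sum_triangle hc).
  apply: (finish (true, (q, p, c), (w q, w p, w c))) => //.
    by rewrite /= hc sNc eqxx wq.
  move=> v; have := cf v; have [n1 n2 n3] := neqo hc; move: wq; rewrite /=; clear -pq n1 n2 n3.
  have [c0|c0] := posnP (w c); rewrite /= ?c0 ?muln0.
    have [->|vp] := eqVneq v p.
      by rewrite (negbTE pq); move: (w p) (w q) => i j; lia.
    by have [->|vq] := eqVneq v q; move: (w p) (w q) => i j; [|move: (w v) => l]; lia.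
  have [->|vp] := eqVneq v p.
    by rewrite (negbTE pq) (negbTE n2); move: (w p) (w q) (w c) => i j l; lia.
  have [->|vq] := eqVneq v q.
    by rewrite (eq_sym q c) (negbTE n3); move: (w p) (w q) (w c) => i j l; lia.
  by case: (v == c); move: (w p) (w q) (w c) (w v) => i j l t; lia.
have : p \in [set q; y; z] by apply: (subsetP st).
rewrite !inE (negbTE pq) /= => /orP[] /eqP pe; first by subst y; apply: upcase h wt.
subst z; have h2 := o_rot (o_rot h); have [wy|wy] := posnP (w y).
  have h3 := o_opp' h2; apply: upcase h3 _ => v wv; have := wt v wv.
  rewrite !inE => /orP[/orP[/eqP->|/eqP vy]|->]; rewrite ?eqxx ?orbT //.
  by rewrite vy wy in wv.
have wt2 v : 0 < w v -> v \in [set p; q; y].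
  by move=> /wt; rewrite !inE; case: (v == p); case: (v == q); case: (v == y).
have cf := coord_frame false h2 wt2.
apply: (finish (false, (p, q, y), (w p, w q, w y))) => //.
  by rewrite /= h2 wq wy andbT; lia.
move=> v; have := cf v; have [_ n2 n3] := neqo h2; move: wq; rewrite /=; clear -pq n2 n3.
have [->|vp] := eqVneq v p.
  by rewrite (negbTE pq) (eq_sym p y) (negbTE n3); move: (w p) (w q) (w y) => i j k; lia.
have [->|vq] := eqVneq v q.
  by rewrite (negbTE n2); move: (w p) (w q) (w y) => i j k; lia.
by case: (v == y); move: (w p) (w q) (w y) (w v) => i j k l; lia.
Qed.

(** Six small triangles meet at a lattice point inside a triangle, and three from each side at a
    point inside an edge; only corners of [K] can have another valency. *)
Lemma card_noncorner_orb x : ~~ [exists v, coord x v == N] -> #|n_orb x| = 6.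
Proof.
have base r : valid r -> ~~ [exists v, coord_raw r v == N] -> r.1.1 = true -> #|n_orb (mk r)| = 6.
  have go r0' : valid r0' -> raw_n (raw_n (raw_n (raw_n (raw_n (raw_n r0'))))) = r0' ->
      raw_n r0' != r0' -> raw_n (raw_n r0') != r0' -> raw_n (raw_n (raw_n r0')) != r0' ->
      #|n_orb (mk r0')| = 6.
    move=> v0 h6 h1 h2 h3.
    have v1 := valid_n v0; have v2 := valid_n v1; have v3 := valid_n v2.
    have v4 := valid_n v3; have v5 := valid_n v4.
    have mi q : valid q -> q != r0' -> mk q != mk r0'.
      by move=> vq; apply: contraNneq => /(congr1 rawof); rewrite !rawof_mk // => ->.
    by apply: card_porbit6; rewrite !mk_n ?h6 //; apply: mi.
  have edge a b c i j : o a b c -> 0 < i -> 0 < j -> i + j = N ->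
      #|n_orb (mk (true, (a, b, c), (i, j, 0)))| = 6.
    move=> h i0 j0 ij; have h' := o_opp' h; have [n1 n2 n3] := neqo h; have [n1' n2' n3'] := neqo h'.
    apply: go; rewrite /= ?h ?addn0 ?ij ?eqxx ?i0 ?j0 //= ?(oppE h) ?i0 ?j0 //.
      by apply/eqP => -[e _ _]; rewrite e eqxx in n3'.
    by apply/eqP => -[e _ _]; rewrite e eqxx in n1.
  case: r => [[u [[a b] c]] [[i j] k]] v0 nc /= uT; subst u; move: (v0) => /and3P[h /eqP sN i0].
  have [n1 n2 n3] := neqo h.
  have [k0|k0] := posnP k.
    subst k; have [j0|j0] := posnP j; last by apply: edge; rewrite // -sN addn0.
    subst j; case/existsP: nc; exists a; have [-> _ _ _] := coordE v0.
    by rewrite -sN !addn0.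
  have [j0|j0] := posnP j.
    subst j; have o1 := mk_n_orb v0; have o2 := mk_n_orb (valid_n v0).
    rewrite /= k0 in o1 o2; have o3 := porbit_trans o1 o2.
    rewrite -eq_porbit_mem in o3; rewrite -(eqP o3).
    by apply: edge => //; [do 2 apply: o_rot | rewrite -sN addn0 addnC].
  apply: go => //=; do 5 rewrite ?k0 ?i0 ?j0 /=; rewrite //.
  by apply/eqP => -[e _ _]; rewrite e eqxx in n3.
move=> nc; have [q vq [uq oq cq]] := up_orb (rawof_valid x).
rewrite mk_rawof in oq; have e := oq; rewrite -eq_porbit_mem in e; rewrite -(eqP e).
apply: base => //; apply: contra nc => /existsP[v h]; apply/existsP; exists v.
by rewrite /coord -cq.
Qed.

Let corners := [set x | [exists v, coord x v == N]].

Lemma corner_form x : x \in corners -> exists2 t, t \in triples o & x = mk (true, t, (N, 0, 0)).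
Proof.
rewrite inE => /existsP[v /eqP cv]; have := rawof_valid x; have := mk_rawof x.
move: cv; rewrite /coord; case: (rawof x) => [[u [[a b] c]] [[i j] k]] cv xE vr.
have [ha hb hc hs] := coordE vr; case/and3P: (vr) => h /eqP sN hu.
have := hs v; rewrite cv => /(_ N_gt0); rewrite !inE => /orP[/orP[]|] /eqP ve; subst v.
- have [iN [j0 k0]] : i = N /\ j = 0 /\ k = 0 by rewrite ha in cv; lia.
  subst i j k; move: hu xE; case: u {vr cv ha hb hc hs} => // _ xE.
  by exists (a, b, c); rewrite ?inE.
- by move: hu; case: u {vr xE ha hc hs} cv hb => cv hb; rewrite hb in cv; lia.
- by move: hu; case: u {vr xE ha hb hs} cv hc => cv hc; rewrite hc in cv; lia.
Qed.

Lemma valid_corner t : t \in triples o -> valid (true, t, (N, 0, 0)).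
Proof. by case: t => [[a b] c]; rewrite inE /= => ->; rewrite !addn0 eqxx. Qed.

Lemma coord_corner t v : t \in triples o -> coord (mk (true, t, (N, 0, 0))) v = (v == t.1.1) * N.
Proof.
move=> ht; rewrite /coord rawof_mk ?valid_corner //; case: t ht => [[a b] c] _ /=; lia.
Qed.

Lemma corner_mem t : t \in triples o -> mk (true, t, (N, 0, 0)) \in corners.
Proof. by move=> ht; rewrite inE; apply/existsP; exists t.1.1; rewrite coord_corner // eqxx mul1n. Qed.

Lemma card_corners : #|corners| = #|triples o|.
Proof.
have inj : {in triples o &, injective (fun t => mk (true, t, (N, 0, 0)))}.
  by move=> t t' ht ht' /(congr1 rawof); rewrite !rawof_mk ?valid_corner // => -[].
rewrite -(card_in_imset inj); apply: eq_card => x; apply/idP/imsetP => [/corner_form//|[t ht ->]].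
exact: corner_mem.
Qed.

Lemma card_corner_orbs : #|[set n_orb x | x in corners]| = m.
Proof.
have ve v : [exists t in triples o, t.1.1 == v].
  have [b [c h]] := vertex_o sK o_tri o_rot tri_o o_fun v.
  by apply/exists_inP; exists (v, b, c); rewrite ?inE.
pose tv v := odflt (p0, q0, r0) [pick t in triples o | t.1.1 == v].
have tvP v : tv v \in triples o /\ (tv v).1.1 = v.
  rewrite /tv; case: pickP => [t /andP[? /eqP]//|h].
  by have /exists_inP[t ht hv] := ve v; have := h t; rewrite /= ht hv.
have inj : injective (fun v => n_orb (mk (true, tv v, (N, 0, 0)))).
  move=> v v' /eqP; rewrite eq_porbit_mem => /coord_orb/(_ v).
  have [h1 h2] := tvP v; have [h1' h2'] := tvP v'.
  rewrite !coord_corner // h2 h2' eqxx; case: eqVneq => //= _; lia.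
rewrite -[RHS]card_ord -(card_imset _ inj); apply: eq_card => O; apply/imsetP/imsetP.
  move=> [x /corner_form[t ht ->] ->]; exists t.1.1 => //; apply/eqP; rewrite eq_porbit_mem.
  apply/coord_orb => z; have [h1 h2] := tvP t.1.1; by rewrite !coord_corner // h2.
move=> [v _ ->]; exists (mk (true, tv v, (N, 0, 0))) => //; apply: corner_mem.
by case: (tvP v).
Qed.

(** Orbits off the corners have 6 darts; the [m] corners carry one dart per oriented triple. *)
Lemma card_ldart : #|ldart| + 6 * m = 6 * cyc (lat_e * lat_f) + #|triples o|.
Proof.
have cst x y : y \in n_orb x -> (y \in corners) = (x \in corners).
  move=> /coord_orb h; rewrite !inE; apply/existsP/existsP => -[v hv]; exists v; by rewrite ?h // -h.
have nc x : x \notin corners -> #|n_orb x| = 6 by rewrite inE; apply: card_noncorner_orb.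
by rewrite -card_corners -(card_by_orbits cst nc) card_corner_orbs.
Qed.

Lemma card_lat_f : 3 * cyc lat_f = #|ldart|.
Proof.
apply: card_porbits_const => x.
have f3 : lat_f (lat_f (lat_f x)) = x.
  by apply: rawof_inj; rewrite !rawof_f raw_f3 // rawof_valid.
have -> : porbit lat_f x = [set x; lat_f x; lat_f (lat_f x)].
  apply/setP => y; apply/idP/idP => [|].
    apply: stable_porbit; last by rewrite !inE eqxx.
    by move=> z; rewrite !inE => /orP[/orP[]|] /eqP->; rewrite ?f3 eqxx ?orbT.
  rewrite !inE => /orP[/orP[]|] /eqP->; rewrite ?porbit_id ?perm_in_porbit //.
  exact/porbit_stable/perm_in_porbit.
have ne z : lat_f z != z.
  apply/eqP => /(congr1 rawof); rewrite rawof_f; have := rawof_valid z.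
  case: (rawof z) => [[[] [[a b] c]] [[i j] k]] /and3P[/neqo[ab _ _] _ _] [ba]; by rewrite ba eqxx in ab.
rewrite cards3 //; first by rewrite eq_sym ne.
  by rewrite eq_sym ne.
by have := ne (lat_f (lat_f x)); rewrite f3 eq_sym.
Qed.

(** Within a triangle a dart can be carried to the corner [(N, 0, 0)], lowering first [j], then [k];
    corners are then linked along the edges of [K]. *)
Lemma lat_connected (S : {set ldart}) : S != set0 -> (forall x, x \in S -> lat_e x \in S) ->
  (forall x, x \in S -> lat_f x \in S) -> S = setT.
Proof.
move=> /set0Pn[x0 x0S] eS fS.
pose P r := mk r \in S.
have Pf r : valid r -> P r -> P (raw_f r).
  by move=> vr /fS; rewrite /P permE rawof_mk.
have Pe r : valid r -> P r -> P (raw_e r).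
  by move=> vr /eS; rewrite /P permE rawof_mk.
have Pf' r : valid r -> P (raw_f r) -> P r.
  move=> vr h; rewrite -(raw_f3 vr); have v1 := valid_f vr; exact: (Pf _ (valid_f v1) (Pf _ v1 h)).
have Pe' r : valid r -> P (raw_e r) -> P r.
  by move=> vr h; rewrite -(raw_eK vr); apply: Pe h; apply: valid_e.
have nS x y : y \in n_orb x -> x \in S -> y \in S.
  by move=> yx xS; apply: stable_porbit xS yx => z zS; rewrite permM; apply/fS/eS.
have vU a b c i j k : o a b c -> 0 < i -> i + j + k = N -> valid (true, (a, b, c), (i, j, k)).
  by move=> h i0 sN; rewrite /= h sN eqxx.
have step a b c i j k : o a b c -> 0 < i -> 0 < j -> i + j + k = N ->
    (P (true, (a, b, c), (i, j, k)) <-> P (true, (a, b, c), (i, j.-1, k.+1))).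
  move=> h i0 j0 sN; pose r : raw := (true, (a, b, c), (i, j, k)); have v0 : valid r by apply: vU.
  have v1 := valid_f v0; have v2 := valid_f v1; have v3 := valid_e v2; have v4 := valid_f v3.
  have <- : raw_e (raw_f (raw_e (raw_f (raw_f r)))) = (true, (a, b, c), (i, j.-1, k.+1)).
    by rewrite /= j0 /= prednK.
  by split=> [/(Pf _ v0)/(Pf _ v1)/(Pe _ v2)/(Pf _ v3)/(Pe _ v4)|/(Pe' _ v4)/(Pf' _ v3)/(Pe' _ v2)/(Pf' _ v1)/(Pf' _ v0)].
have step2 a b c i k : o a b c -> 0 < i -> 0 < k -> i + k = N ->
    (P (true, (a, b, c), (i, 0, k)) <-> P (true, (a, b, c), (i.+1, 0, k.-1))).
  move=> h i0 k0 sN.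
  have va : valid (true, (a, b, c), (i, 0, k)) by apply: vU; rewrite ?addn0.
  have vb : valid (true, (a, b, c), (i.+1, 0, k.-1)) by apply: vU => //; lia.
  have := @step b c a 1 k i.-1 (o_rot h) isT k0; rewrite prednK // => /(_ _) st.
  have {}st := st ltac:(lia).
  split=> [/(Pf _ va)/st hh|/(Pf _ vb)/st hh]; [exact: Pf' vb hh | exact: Pf' va hh].
have toN a b c i j k : o a b c -> 0 < i -> i + j + k = N ->
    (P (true, (a, b, c), (i, j, k)) <-> P (true, (a, b, c), (N, 0, 0))).
  move=> h; elim: j k => [|j IH] k i0 sN; last first.
    rewrite step //=; apply: IH => //; lia.
  elim: k i i0 sN => [|k IH] i i0 sN; first by rewrite -sN !addn0.
  rewrite step2 //=; last by lia.
  by apply: IH => //; lia.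
pose C a := forall b c, o a b c -> P (true, (a, b, c), (N, 0, 0)).
have Ca a b c : o a b c -> P (true, (a, b, c), (N, 0, 0)) -> C a.
  by move=> h hP b' c' h'; apply: nS hP; apply: corner_orb.
have Cnext a b c : o a b c -> C a -> C b.
  move=> h /(_ _ _ h) hP; apply: (Ca b c a (o_rot h)).
  have v0 : valid (true, (a, b, c), (N, 0, 0)) by apply: vU; rewrite ?addn0.
  by have := Pf _ v0 hP; rewrite toN //; [apply: o_rot | lia].
have [a Caa] : exists a, C a.
  have := rawof_valid x0; have := x0S; rewrite -{1}[x0]mk_rawof.
  case: (rawof x0) => [[u [[a b] c]] [[i j] k]] h0 vr; exists a; case/and3P: (vr) => h /eqP sN hu.
  apply: (Ca a b c h); case: u h0 vr hu => h0 vr hu; first by rewrite -(toN a b c i j k).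
  have : P (raw_e (false, (a, b, c), (i, j, k))) by apply: Pe.
  by rewrite /= toN //; lia.
have Call v : C v.
  case: (sK) => _ [_ /(_ a v)/connectP[s sP ->]] _ _.
  elim: s a Caa sP => //= y s IH a Caa /andP[ay sP]; apply: (IH y) => //.
  have [<-//|ne] := eqVneq a y.
  have [c hc] := edge_o sK o_tri o_rot tri_o o_fun ne ay; exact: Cnext hc Caa.
apply/setP => x; rewrite inE -[x]mk_rawof; have := rawof_valid x.
case: (rawof x) => [[u [[b c] d]] [[i j] k]] vr; case/and3P: (vr) => h /eqP sN hu.
case: u vr hu => vr hu; first by apply/toN => //; apply: Call.
apply: (Pe' _ vr); rewrite /= toN //; [exact: Call | lia].
Qed.

Lemma coord_sum x : \sum_v coord x v = N.
Proof.
rewrite /coord; have := rawof_valid x; case: (rawof x) => [[u [[a b] c]] [[i j] k]] vx.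
have [ha hb hc hs] := coordE vx; case/and3P: vx => h /eqP sN _.
by rewrite (sum_triangle h hs) ha hb hc.
Qed.

(** [card_lat_f], [card_ldart] and [card_triples] combine to Euler's formula, and [N] does not
    enter. *)
Lemma lat_map : is_map lat_e lat_f g.
Proof.
split.
- by apply/card_gt0P; exists (mk (true, (p0, q0, r0), (N, 0, 0))).
- by move=> x; apply: rawof_inj; rewrite !rawof_e raw_eK // rawof_valid.
- move=> x; apply/eqP => /(congr1 rawof); rewrite rawof_e => /eqP.
  by rewrite (negbTE (raw_e_neq (rawof_valid x))).
- exact: lat_connected.
- have h1 := card_lat_f; have h2 := card_ldart.
  have h3 := card_triples sK o_tri o_rot tri_o o_fun; lia.
Qed.

End Lattice.

End Lattice.

(** * Models from overlapping connected pieces *)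

Module Assembly.

Import Maps.

Import GroupScope.
Local Open Scope nat_scope.

Lemma connect_stable (T : finType) (R : rel T) (P : pred T) a d :
  (forall x y, P x -> R x y -> P y) -> connect R a d -> P a -> P d.
Proof.
move=> st /connectP[s sP ->]; elim: s a sP => //= y s IH a /andP[ay sP] Pa.
by apply: IH sP _; apply: st Pa ay.
Qed.

Section Assemble.
Variables (D : finType) (e f : {perm D}) (n : nat) (r : rel 'I_n).
Hypothesis eK : involutive e.
Hypotheses (rS : symmetric r) (rI : irreflexive r).

Definition vertex_closed (S : {set D}) := forall x, x \in S -> (e * f)%g x \in S.
Definition map_connected (S : {set D}) := forall T : {set D}, T \subset S -> T != set0 ->
  vertex_closed T -> (forall x, x \in T -> e x \in S -> e x \in T) -> T = S.

Variables (P : 'I_n -> {set D}) (Q : 'I_n -> 'I_n -> {set D}).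
Hypothesis P0 : forall u, P u != set0.
Hypothesis Pn : forall u, vertex_closed (P u).
Hypothesis Pc : forall u, map_connected (P u).
Hypothesis Qs : forall u v, Q u v = Q v u.
Hypothesis Qn : forall u v, r u v -> vertex_closed (Q u v).
Hypothesis Qc : forall u v, r u v -> map_connected (Q u v).
Hypothesis PP : forall u v x, x \in P u -> x \in P v -> u = v.
Hypothesis PQ : forall u v w x, r v w -> x \in P u -> x \in Q v w -> u = v \/ u = w.
Hypothesis QQ : forall u v u' v' x, r u v -> r u' v' -> x \in Q u v -> x \in Q u' v' ->
  u = u' /\ v = v' \/ u = v' /\ v = u'.
Hypothesis PQ0 : forall u v, r u v -> exists2 x, x \in P u & x \in Q u v.

Lemma closed_orbit S x y : vertex_closed S -> y \in porbit (e * f)%g x -> (y \in S) = (x \in S).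
Proof.
move=> cS yx; apply/idP/idP => h; last exact: stable_porbit yx.
have xy : x \in porbit (e * f)%g y by rewrite porbit_sym.
exact: stable_porbit xy.
Qed.

Let step u v := [rel a b | (b \in Q u v :\: P v) && ((b \in porbit (e * f)%g a) || (b == e a))].

(* The part of the edge piece Q u v that can be reached from P u without entering P v. *)
Let arm u v := [set d | [exists a in P u :&: Q u v, connect (step u v) a d]].

Lemma arm_start u v a : a \in P u -> a \in Q u v -> a \in arm u v.
Proof. by move=> aP aQ; rewrite inE; apply/exists_inP; exists a; rewrite ?inE ?aP. Qed.

Lemma arm_sub u v x : r u v -> x \in arm u v -> (x \in Q u v) && (x \notin P v).
Proof.
move=> uv; rewrite inE => /exists_inP[a]; rewrite inE => /andP[aP aQ] ax.
apply: (@connect_stable _ _ (fun x => (x \in Q u v) && (x \notin P v)) _ _ _ ax).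
  by move=> y z _ /= /andP[]; rewrite inE andbC.
by rewrite aQ; apply/negP => /(PP aP) uv'; rewrite uv' rI in uv.
Qed.

Lemma arm_step u v x y : step u v x y -> x \in arm u v -> y \in arm u v.
Proof.
move=> xy; rewrite [x \in _]inE [y \in _]inE => /exists_inP[a ha ax]; apply/exists_inP.
by exists a => //; apply: connect_trans ax _; apply: connect1.
Qed.

Lemma arm_closed u v : r u v -> vertex_closed (arm u v).
Proof.
move=> uv x xC; have /andP[xQ xP] := arm_sub uv xC.
apply: arm_step xC; rewrite /= perm_in_porbit andbT inE Qn // andbT.
by rewrite (closed_orbit (@Pn v) (perm_in_porbit _ _)).
Qed.

(** If the arm never pointed into [P v], it would exhaust the connected piece [Q u v], which meets
    [P v]. *)
Lemma arm_exit u v : r u v -> exists2 x, x \in arm u v & e x \in P v.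
Proof.
move=> uv; have [/exists_inP[x xC xe]|/exists_inPn none] := boolP [exists x in arm u v, e x \in P v].
  by exists x.
have CQ : arm u v = Q u v.
  apply: (Qc uv); last 2 first.
  - exact: arm_closed.
  - move=> x xC xQ; apply: (arm_step _ xC) => /=; rewrite inE eqxx orbT andbT xQ andbT.
    exact: none.
  - by apply/subsetP => x /(arm_sub uv)/andP[].
  - by have [a aP aQ] := PQ0 uv; apply/set0Pn; exists a; apply: arm_start.
have vu : r v u by rewrite rS.
have [a aP aQ] := PQ0 vu; rewrite Qs -CQ in aQ.
by have /andP[_] := arm_sub uv aQ; rewrite aP.
Qed.

(** Each edge piece serves the smaller of its ends only, and stays outside [P v]; this keeps the
    branch sets disjoint. *)
Definition branch u := [set d | (d \in P u) || [exists v, [&& r u v, u < v & d \in arm u v]]].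

Lemma branchP u x : reflect (x \in P u \/ exists v, [/\ r u v, u < v & x \in arm u v])
  (x \in branch u).
Proof.
rewrite inE; apply: (iffP orP) => -[]; try by left.
  by move=> /existsP[v /and3P[? ? ?]]; right; exists v.
by move=> [v [? ? ?]]; right; apply/existsP; exists v; apply/and3P.
Qed.

Lemma assemble_model : model e f r setT branch.
Proof.
have PB u x : x \in P u -> x \in branch u by move=> xP; apply/branchP; left.
have AB u v x : r u v -> u < v -> x \in arm u v -> x \in branch u.
  by move=> uv lt xA; apply/branchP; right; exists v.
split.
- by move=> u _; have /set0Pn[x xP] := P0 u; apply/set0Pn; exists x; apply: PB.
- move=> u x _ /branchP[xP|[v [uv lt xA]]]; first exact/PB/Pn.
  exact/(AB _ v)/arm_closed.
- move=> u v x _ _ /branchP[xu|[w [uw ltu xu]]] /branchP[xv|[z [vz ltv xv]]].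
  + exact: PP xu xv.
  + have /andP[xQ xP] := arm_sub vz xv; case: (PQ vz xu xQ) => // uz.
    by rewrite -uz xu in xP.
  + have /andP[xQ xP] := arm_sub uw xu; case: (PQ uw xv xQ) => // vw.
    by rewrite -vw xv in xP.
  + have /andP[xQ _] := arm_sub uw xu; have /andP[xQ' _] := arm_sub vz xv.
    case: (QQ uw vz xQ xQ') => [[]//|[uz wv]].
    by rewrite uz wv in ltu; have := ltn_trans ltu ltv; rewrite ltnn.
- move=> u T _ TB T0 Tn Te.
  (* A connecting path can be followed backwards in [T], so a part that meets an arm also meets
     [P u]. *)
  have back v x : r u v -> u < v -> x \in arm u v -> x \in T -> exists2 a, a \in T & a \in P u.
    move=> uv lt; rewrite inE => /exists_inP[a]; rewrite inE => /andP[aP aQ] ax xT.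
    exists a => //; apply/negPn/negP => aT.
    suff : (x \in arm u v) && (x \notin T) by rewrite xT andbF.
    apply: (@connect_stable _ _ (fun x => (x \in arm u v) && (x \notin T)) _ _ _ ax); last by rewrite arm_start.
    move=> y z /andP[yA yT] yz; rewrite (arm_step yz yA) /=; apply: contra yT => zT.
    move: yz => /= /andP[_ /orP[yz|/eqP zE]]; first by rewrite -(closed_orbit Tn yz).
    by have -> : y = e z; [rewrite zE eK | apply: Te; rewrite // zE eK; apply: AB yA].
  have [a aT aP] : exists2 a, a \in T & a \in P u.
    have /set0Pn[x xT] := T0; have /branchP[xP|[v [uv lt xA]]] := subsetP TB _ xT.
      by exists x.
    exact: back xA xT.
  have PT : P u \subset T.
    apply/setIidPr; apply: Pc; first exact: subsetIr.
    - by apply/set0Pn; exists a; rewrite inE aT.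
    - by move=> x; rewrite !inE => /andP[xT xP]; rewrite Tn ?Pn.
    - by move=> x; rewrite !inE => /andP[xT xP] ex; rewrite ex andbT Te ?PB.
  apply/eqP; rewrite eqEsubset TB; apply/subsetP => x /branchP[/(subsetP PT)//|[v [uv lt]]].
  rewrite inE => /exists_inP[b]; rewrite inE => /andP[bP bQ] bx.
  suff /andP[] : (x \in arm u v) && (x \in T) by [].
  apply: (@connect_stable _ _ (fun x => (x \in arm u v) && (x \in T)) _ _ _ bx); last by rewrite arm_start //= (subsetP PT).
  move=> y z /andP[yA yT] yz; have zA := arm_step yz yA; rewrite zA /=.
  move: yz => /= /andP[_ /orP[yz|/eqP zE]]; first by rewrite (closed_orbit Tn yz).
  by rewrite zE Te // -zE; apply: AB zA.
- move=> u v _ _ uv; have vu : r v u by rewrite rS.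
  case: (ltngtP u v) => [lt|lt|/val_inj uv']; last by rewrite uv' rI in uv.
    by have [x xA xe] := arm_exit uv; exists x; [apply: AB xA | apply: PB].
  by have [x xA xe] := arm_exit vu; exists (e x); [apply: PB | rewrite eK; apply: AB xA].
Qed.

End Assemble.

End Assembly.

(** * Closure properties of the class *)

Module DrawableGraphs.

Import Defs.
Import Adjacency EdgeOperations SparseGraphs PendantStructures Counting Maps Detachment SparseMaps Subdivision LeafAddition.

Import GroupScope.
Local Open Scope nat_scope.

Section Drawable.
Variables (k n : nat).
Implicit Types G H : graph n.

Definition drawable G := exists (D : finType) (e f : {perm D}) B g,
  [/\ g <= k, is_map e f g & model e f (adj G) setT B].

Lemma sub_model (D : finType) (e f : {perm D}) (r r' : rel 'I_n) (A A' : {set 'I_n}) B :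
  A' \subset A -> (forall u v, u \in A' -> v \in A' -> r' u v -> r u v) ->
  model e f r A B -> model e f r' A' B.
Proof.
move=> /subsetP AA rr [m1 m2 m3 m4 m5]; split.
- by move=> u /AA; apply: m1.
- by move=> u x /AA; apply: m2.
- by move=> u v x /AA uA /AA; apply: m3.
- by move=> u S /AA; apply: m4.
- by move=> u v uA vA uv; apply: m5; [exact: AA | exact: AA | exact: rr].
Qed.

Lemma sub_drawable G H : (forall u v, adj H u v -> adj G u v) -> drawable G -> drawable H.
Proof.
move=> HG [D [e [f [B [g [gk Mf mod]]]]]]; exists D, e, f, B, g; split=> //.
by apply: sub_model mod => // u v _ _; apply: HG.
Qed.

(** Every vertex needs a branch set, isolated ones included. If [x] has none, the subdivided map
    supplies the centre of a face at [u]; this serves a new leaf as well as the vertex freed by a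
    contraction. *)
Lemma leaf_drawable H (D : finType) (e f : {perm D}) (r : rel 'I_n) B g x u : g <= k -> is_map e f g ->
  irreflexive r -> model e f r [set~ x] B -> u != x ->
  (forall a b, a != x -> b != x -> adj H a b -> r a b) -> (forall a, adj H x a -> a = u) ->
  drawable H.
Proof.
move=> gk Mf rI mod ux Hr Hx; have [f' [Mf' mod' tight']] := tighten Mf mod.
have xA : x \notin [set~ x] by rewrite !inE eqxx.
have uA : u \in [set~ x] by rewrite !inE.
have HrA a b : a \in [set~ x] -> b \in [set~ x] -> adj H a b -> r a b by rewrite !inE; apply: Hr.
have HxA a : a \in [set~ x] -> adj H x a || adj H a x -> a = u.
  by move=> _; rewrite (adjC H a) orbb; apply: Hx.
have [B' modB'] := leaf_model Mf' mod' tight' rI uA xA HrA HxA (adjxx H x).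
exists (sdart D), (sd_e Mf'), (sd_f D), B', g; split=> //; first exact: sd_map.
by apply: sub_model modB' => //; apply/subsetP => v _; rewrite !inE orbN.
Qed.

Lemma isolate_drawable G x : drawable G -> drawable (isolate G x).
Proof.
apply: sub_drawable => u v; rewrite -!in_nb nb_isolate; case: ifP => _; rewrite !inE //.
by case/andP.
Qed.

Lemma add_leaf_drawable G x u : isolated G x -> x != u -> drawable G -> drawable (add_edge G x u).
Proof.
move=> /eqP xG xu [D [e [f [B [g [gk Mf mod]]]]]]; have ux : u != x by rewrite eq_sym.
have mod' : model e f (adj G) [set~ x] B by apply: sub_model mod => //; apply: subsetT.
apply: (leaf_drawable gk Mf (adjxx G) mod' ux) => [a b ax bx|a].
  rewrite -!in_nb nb_add_edge // (negbTE ax); case: eqVneq => [->|_] //.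
  by rewrite !inE (negbTE bx).
by rewrite -in_nb nb_add_edge // eqxx xG !inE orbF => /eqP.
Qed.

(** [B x] and [B y] are united along the edge between them; [x] then gets a new branch set from
    [leaf_drawable]. *)
Lemma contract_drawable G x y : adj G x y -> drawable G -> drawable (contract G x y).
Proof.
move=> Gxy [D [e [f [B [g [gk Mf mod]]]]]]; have xy := adj_neq Gxy.
have yx : y != x by rewrite eq_sym.
have [B0 Bn Bd Bc Br] := mod; have [_ eK _ _ _] := Mf.
pose B' v := if v == y then B x :|: B y else B v.
have B'y : B' y = B x :|: B y by rewrite /B' eqxx.
have B'N v : v != y -> B' v = B v by rewrite /B' => /negbTE->.
have contr u v : u != x -> v != x -> u != y -> v != y -> adj (contract G x y) u v -> adj G u v.
  move=> ux vx uy vy; rewrite -!in_nb nb_contract // (negbTE ux) (negbTE uy).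
  by case: ifP => _; rewrite !inE ?(negbTE vy) /= => /andP[].
have contry v : v != x -> v != y -> adj (contract G x y) y v -> adj G x v || adj G y v.
  by move=> vx vy; rewrite -!in_nb nb_contract // (negbTE yx) eqxx !inE vx vy /= orbC.
have mod' : model e f (adj (contract G x y)) [set~ x] B'.
  split.
  - move=> u _; have [->|uy] := eqVneq u y; last by rewrite B'N // B0 ?inE.
    by rewrite B'y; have /set0Pn[d dx] := B0 x (in_setT _); apply/set0Pn; exists d; rewrite inE dx.
  - move=> u d _; have [->|uy] := eqVneq u y; last by rewrite B'N //; apply: Bn; rewrite inE.
    by rewrite B'y !inE => /orP[] h; rewrite (Bn _ _ (in_setT _) h) ?orbT.
  - move=> u v d; rewrite !inE => ux vx.
    have sep w z : w != x -> w != y -> d \in B w -> d \in B x :|: B y -> w = z.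
      move=> wx wy dw; rewrite inE => /orP[] h; have := Bd _ _ _ (in_setT _) (in_setT _) dw h.
        by move=> e1; rewrite e1 eqxx in wx.
      by move=> e1; rewrite e1 eqxx in wy.
    have [->|uy] := eqVneq u y; have [->|vy] := eqVneq v y; rewrite ?B'y ?B'N //.
    + by move=> h1 h2; apply/esym/(sep v y).
    + by move=> h1 h2; apply: (sep u y).
    + by apply: Bd; rewrite inE.
  - move=> u S; rewrite !inE => ux; have [->|uy] := eqVneq u y; last first.
      by rewrite B'N //; apply: Bc; rewrite inE.
    rewrite B'y => SB S0 Sn Se.
    have part w d : (w == x) || (w == y) -> d \in S -> d \in B w -> B w \subset S.
      move=> wxy dS dw; apply/setIidPr; apply: Bc; rewrite ?inE //; first exact: subsetIr.
      - by apply/set0Pn; exists d; rewrite inE dS.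
      - by move=> z; rewrite !inE => /andP[zS zw]; rewrite Sn ?Bn ?inE.
      - move=> z; rewrite !inE => /andP[zS zw] ez; rewrite ez andbT Se // inE.
        by case/orP: wxy ez => /eqP-> ->; rewrite ?orbT.
    have [d dx edy] := Br _ _ (in_setT _) (in_setT _) Gxy.
    have xS : B x \subset S -> B y \subset S.
      move=> xS; apply: (part y (e d)); rewrite ?eqxx ?orbT //.
      by rewrite Se ?(subsetP xS) // inE edy orbT.
    have yS : B y \subset S -> B x \subset S.
      move=> yS; apply: (part x d); rewrite ?eqxx //.
      by rewrite -[d]eK Se ?(subsetP yS) // eK inE dx.
    apply/eqP; rewrite eqEsubset SB subUset; have /set0Pn[z zS] := S0.
    have := subsetP SB z zS; rewrite inE => /orP[] zB.
      by have := part x z _ zS zB; rewrite eqxx => /(_ isT) h; rewrite h xS.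
    by have := part y z _ zS zB; rewrite eqxx orbT => /(_ isT) h; rewrite h yS.
  - move=> u v; rewrite !inE => ux vx uv; have uNv := adj_neq uv.
    have [uy|uy] := eqVneq u y.
      rewrite uy in uv uNv *; rewrite eq_sym in uNv; rewrite B'y B'N //.
      have /orP[h|h] := contry v vx uNv uv; have [d du dv] := Br _ _ (in_setT _) (in_setT _) h;
        by exists d; rewrite // inE du ?orbT.
    have [vy|vy] := eqVneq v y.
      rewrite vy adjC in uv *; rewrite B'y B'N //.
      have /orP[h|h] := contry u ux uy uv; have [d du dv] := Br _ _ (in_setT _) (in_setT _) h;
        by exists (e d); rewrite // eK inE du ?orbT.
    rewrite !B'N //; apply: Br; rewrite ?inE //; exact: contr.
apply: (leaf_drawable gk Mf (adjxx (contract G x y)) mod' yx) => // a.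
by rewrite -in_nb nb_contract // eqxx inE.
Qed.

Lemma drawable_sparse G A : drawable G -> degsum G A <= (20 + 12 * k) * #|A|.
Proof.
move=> [D [e [f [B [g [gk Mf mod]]]]]].
have modA : model e f (adj G) A B by apply: sub_model mod => //; apply: subsetT.
apply: (@leq_trans ((20 + 12 * g) * #|A|)); last by rewrite leq_mul2r leq_add2l leq_mul2l gk !orbT.
apply: leq_trans (model_sparse Mf modA (adjC G) (adjxx G)); apply: leq_sum => u uA.
by apply: subset_leq_card; apply/subsetP => v; rewrite !inE andbC.
Qed.

Lemma pendant_mate G t : pendant G t -> exists2 H, (forall u v, adj H u v -> adj G u v) &
  ~ isomorphic G H /\ Dom G = Dom H.
Proof.
case: t => [[[[x1 x2] y1] y2] u] /and5P[un /eqP Ny1 /eqP Ny2 /eqP Nx2 /eqP Nx1].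
have x12 : adj G x1 x2 by rewrite -in_nb Nx1 !inE eqxx orbT.
exists (del_edge G x1 x2); first by move=> a b; rewrite adj_del_edge => /andP[].
split; first exact: del_edge_not_isomorphic.
apply/esym; apply: (Dom_del_edge x12 Ny1 Ny2).
  by move: un; rewrite /= !inE !negb_or => /and5P[_ /and3P[h _ _] _ _ _]; rewrite eq_sym.
by move: un; rewrite /= !inE !negb_or => /and5P[/and4P[_ _ h _] _ _ _ _]; rewrite eq_sym.
Qed.

End Drawable.

End DrawableGraphs.

From mathcomp Require Import ring lra.
From mathcomp Require Import all_classical all_reals all_analysis.

(** * Topological embeddings from routed edges *)

Module Drawing.

Import Defs.
Import Adjacency.

Import Order.TTheory GRing.Theory Num.Theory.
Import numFieldNormedType.Exports.
Local Open Scope ring_scope.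

Section Continuity.
Variables (R : realType) (T : topologicalType).
Implicit Types g h : T -> R.

Lemma continuous_comb m (I : finType) (phi : I -> T -> R) (c : I -> 'rV[R]_m) :
  (forall i, continuous (phi i)) -> continuous (fun x => \sum_i phi i x *: c i).
Proof.
move=> cphi; apply: continuous_big; first exact: add_continuous.
by move=> i _ x; apply: cvgZr_tmp; apply: cphi.
Qed.

Lemma continuous_affine (a b : R) g : continuous g -> continuous (fun x => a * g x - b).
Proof.
move=> cg x; apply: cvgB; last exact: cvg_cst.
by apply: cvgM; [exact: cvg_cst | exact: cg].
Qed.

Lemma continuous_max0 g : continuous g -> continuous (fun x => Num.max (g x) 0 : R).
Proof. by move=> cg x; apply: (@continuous_max R T g (fun=> 0)); [exact: cg | exact: cvg_cst]. Qed.

Lemma continuous_min2 g h : continuous g -> continuous h -> continuous (fun x => Num.min (g x) (h x) : R).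
Proof. by move=> cg ch x; apply: (@continuous_min R T g h); [exact: cg | exact: ch]. Qed.

Lemma continuous_half g : continuous g -> continuous (fun x => g x / 2).
Proof. by move=> cg x; apply: cvgM; [exact: cg | exact: cvg_cst]. Qed.

Lemma continuous_add (V : normedModType R) (g h : T -> V) :
  continuous g -> continuous h -> continuous (fun x => g x + h x).
Proof. by move=> cg ch x; apply: cvgD; [exact: cg | exact: ch]. Qed.

Lemma continuous_const (V : normedModType R) (c : V) : continuous (fun _ : T => c).
Proof. by move=> x; exact: cvg_cst. Qed.

End Continuity.

Lemma realization_segment (R : realType) m (K : {set {set 'I_m}}) p q (a b : R) :
  simplicial_complex K -> [set p; q]%SET \in K -> 0 <= a -> 0 <= b -> a + b = 1 ->
  realization R K (a *: delta_mx 0 p + b *: delta_mx 0 q).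
Proof.
move=> [_ _ down] pqK a0 b0 ab; set x := (X in realization R K X).
have sx : \sum_i x 0 i = 1.
  rewrite -ab; under eq_bigr => i _ do rewrite !mxE eqxx /=.
  rewrite big_split /= -!mulr_sumr (bigD1 p) //= big1 => [|i /negbTE ->//].
  by rewrite eqxx addr0 mulr1 (bigD1 q) //= big1 => [|i /negbTE ->//]; rewrite eqxx addr0 mulr1.
split=> //; first by move=> i; rewrite !mxE eqxx /= addr_ge0 // mulr_ge0.
apply: (down _ _ pqK).
  apply/fintype.subsetP => i; rewrite !inE !mxE eqxx /=.
  by case: (i == p) => //; case: (i == q) => //; rewrite !mulr0 addr0 eqxx.
apply/negP => /eqP s0; have : \sum_i x 0 i = 0.
  apply: big1 => i _; apply/eqP; have : i \notin finset (fun i => x 0 i != 0) by rewrite s0 inE.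
  by rewrite inE negbK.
by rewrite sx => /eqP; rewrite oner_eq0.
Qed.

Section Drawing.
Variables (R : realType) (n m : nat) (G : graph n) (K : {set {set 'I_m}}).
Variables (V : 'I_n -> 'I_m) (H E : 'I_n -> 'I_n -> 'I_m).
Hypothesis sK : simplicial_complex K.
Hypothesis VHE : forall u v, adj G u v ->
  [/\ [set V u; H u v]%SET \in K, [set H u v; E u v]%SET \in K & E u v = E v u].
Hypothesis Vinj : injective V.
Hypothesis HEinj : forall u v u' v', adj G u v -> adj G u' v' ->
  (H u v = H u' v' -> u = u' /\ v = v') /\
  (E u v = E u' v' -> u = u' /\ v = v' \/ u = v' /\ v = u').
Hypothesis VHEneq : forall u a b c d, adj G a b -> adj G c d ->
  [/\ V u != H a b, V u != E a b & H a b != E c d].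

(* The edge uv is drawn along V u, H u v, E u v, H v u, V v, which are reached when
   the coordinate of u is 1, 3/4, 1/2, 1/4, 0. *)
Let atV (x : 'rV[R]_n) u : R := Num.max (4 * x 0 u - 3) 0.
Let atH (x : 'rV[R]_n) u v : R := if adj G u v then Num.max (Num.min (4 * x 0 u - 2) (4 * x 0 v - 0)) 0 else 0.
(** Halved because the node [E u v = E v u] receives the terms of both orders. *)
Let atE (x : 'rV[R]_n) u v : R := if adj G u v then Num.max (Num.min (4 * x 0 u - 1) (4 * x 0 v - 1)) 0 / 2 else 0.

Let pt w : 'rV[R]_m := delta_mx 0 w.

Definition drawing (x : 'rV[R]_n) : 'rV[R]_m :=
  \sum_u atV x u *: pt (V u) + \sum_p atH x p.1 p.2 *: pt (H p.1 p.2)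
   + \sum_p atE x p.1 p.2 *: pt (E p.1 p.2).

Lemma continuous_drawing : continuous drawing.
Proof.
have ca (a b : R) u : continuous (fun x : 'rV[R]_n => a * x 0 u - b).
  by apply: continuous_affine; exact: (@coord_continuous R 1 n 0 u).
apply: continuous_add; first apply: continuous_add; apply: continuous_comb => i.
- exact/continuous_max0/ca.
- have c b u v : continuous (fun x : 'rV[R]_n =>
      if b then Num.max (Num.min (4 * x 0 u - 2) (4 * x 0 v - 0)) 0 else 0 : R).
    by case: b; [apply/continuous_max0/continuous_min2; apply: ca | exact: continuous_const].
  exact: (c (adj G i.1 i.2)).
- have c b u v : continuous (fun x : 'rV[R]_n =>
      if b then Num.max (Num.min (4 * x 0 u - 1) (4 * x 0 v - 1)) 0 / 2 else 0 : R).
    case: b; last exact: continuous_const.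
    by apply/continuous_half/continuous_max0/continuous_min2; apply: ca.
  exact: (c (adj G i.1 i.2)).
Qed.

Lemma drawing_vertex (x : 'rV[R]_n) u : x 0 u = 1 -> (forall z, z != u -> x 0 z = 0) -> drawing x = pt (V u).
Proof.
move=> xu xz; rewrite /drawing (bigD1 u) //= big1 => [|z zu]; last first.
  by rewrite /atV xz // max_r ?scale0r //; lra.
rewrite {1}/atV xu max_l; last by lra.
have -> : 4 * 1 - 3 = 1 :> R by lra.
rewrite big1 => [|[a b] _ /=]; last first.
  rewrite /atH; case: ifP => ab; last by rewrite scale0r.
  rewrite max_r ?scale0r // ge_min; have [aE|au] := eqVneq a u.
    by rewrite (xz b) ?mulr0 ?subr0 ?lexx ?orbT // -aE eq_sym; apply: adj_neq ab.
  by rewrite xz //; apply/orP; left; lra.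
rewrite big1 => [|[a b] _ /=]; last first.
  rewrite /atE; case: ifP => ab; last by rewrite scale0r.
  rewrite max_r ?mul0r ?scale0r // ge_min; have [aE|au] := eqVneq a u.
    by rewrite (xz b) -1?aE 1?eq_sym ?(adj_neq ab) //; apply/orP; right; lra.
  by rewrite xz //; apply/orP; left; lra.
by rewrite scale1r !addr0.
Qed.

Lemma drawing_edge (x : 'rV[R]_n) u v : adj G u v -> x 0 u + x 0 v = 1 -> 0 <= x 0 v -> x 0 v <= x 0 u ->
  (forall z, z != u -> z != v -> x 0 z = 0) ->
  drawing x = if 3 <= 4 * x 0 u then (4 * x 0 u - 3) *: pt (V u) + (4 * x 0 v) *: pt (H u v)
    else (4 * x 0 u - 2) *: pt (H u v) + (4 * x 0 v - 1) *: pt (E u v).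
Proof.
move=> uv s1 v0 vu xz; have uNv : u != v := adj_neq uv.
have half z : z != u -> x 0 z <= 1 / 2.
  move=> zu; have [->|zv] := eqVneq z v; first by lra.
  by rewrite xz //; lra.
rewrite /drawing (bigD1 u) //= big1 ?addr0 => [|z zu]; last first.
  by rewrite /atV max_r ?scale0r //; have := half z zu; lra.
rewrite (bigD1 (u, v)) //= big1 ?addr0 => [|[a b] /= ne]; last first.
  rewrite /atH; case: ifP => ab; last by rewrite scale0r.
  rewrite max_r ?scale0r // ge_min; have [aE|au] := eqVneq a u.
    rewrite (xz b) ?mulr0 ?subr0 ?lexx ?orbT // -?aE 1?eq_sym ?(adj_neq ab) //.
    by apply: contraNneq ne => ->; rewrite aE.
  by apply/orP; left; have := half a au; lra.
rewrite (bigD1 (u, v)) //= (bigD1 (v, u)) /=; last by rewrite xpair_eqE eq_sym (negbTE uNv).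
rewrite big1 ?addr0 => [|[a b] /= /andP[ne1 ne2]]; last first.
  rewrite /atE; case: ifP => ab; last by rewrite scale0r.
  have aNb := adj_neq ab.
  rewrite max_r ?mul0r ?scale0r // ge_min.
  have [aE|au] := eqVneq a u.
    rewrite (xz b); last by apply: contraNneq ne1 => ->; rewrite aE.
      by apply/orP; right; lra.
    by rewrite -aE eq_sym.
  have [aE|av] := eqVneq a v.
    rewrite (xz b); last by rewrite -aE eq_sym.
      by apply/orP; right; lra.
    by apply: contraNneq ne2 => ->; rewrite aE.
  by rewrite xz //; apply/orP; left; lra.
have [_ _ <-] := VHE uv; rewrite -scalerDl /atE /atH /atV uv adjC uv [Num.min (_ * x 0 v - 1) _]minC.
rewrite -mulrDl -mulr2n -[Num.max _ _ *+ 2]mulr_natr mulfK ?pnatr_eq0 // subr0.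
rewrite [Num.min (_ - 1) _]min_r; last by lra.
case: ifP => h.
  rewrite [Num.max (4 * x 0 u - 3) 0]max_l; last by lra.
  rewrite [Num.max (4 * x 0 v - 1) 0]max_r; last by lra.
  rewrite min_r; last by lra.
  rewrite max_l; last by lra.
  by rewrite scale0r addr0.
rewrite [Num.max (4 * x 0 u - 3) 0]max_r; last by lra.
rewrite [Num.max (4 * x 0 v - 1) 0]max_l; last by lra.
rewrite min_l; last by lra.
rewrite max_l; last by lra.
by rewrite scale0r add0r.
Qed.

(** The point of the graph that is drawn at the node [w]. Extended linearly as [posM], it gives a
    left inverse of [drawing], whence injectivity. *)
Let pos w : 'rV[R]_n :=
  if [pick u | V u == w] is Some u then delta_mx 0 u else
  if [pick p | adj G p.1 p.2 && (H p.1 p.2 == w)] is Some p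
    then (3 / 4) *: delta_mx 0 p.1 + (1 / 4) *: delta_mx 0 p.2 else
  if [pick p | adj G p.1 p.2 && (E p.1 p.2 == w)] is Some p
    then (1 / 2) *: delta_mx 0 p.1 + (1 / 2) *: delta_mx 0 p.2 else 0.

Lemma pos_V u : pos (V u) = delta_mx 0 u.
Proof. by rewrite /pos; case: pickP => [z /eqP/Vinj->//|/(_ u)]; rewrite eqxx. Qed.

Lemma pos_H u v : adj G u v -> pos (H u v) = (3 / 4) *: delta_mx 0 u + (1 / 4) *: delta_mx 0 v.
Proof.
move=> uv; rewrite /pos; case: pickP => [z /eqP e|_].
  by have [] := VHEneq z uv uv; rewrite e eqxx.
case: pickP => [[a b] /= /andP[ab /eqP e]|/(_ (u, v))]; last by rewrite /= uv eqxx.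
by have [/(_ e)[-> ->] _] := HEinj ab uv.
Qed.

Lemma pos_E u v : adj G u v -> pos (E u v) = (1 / 2) *: delta_mx 0 u + (1 / 2) *: delta_mx 0 v.
Proof.
move=> uv; rewrite /pos; case: pickP => [z /eqP e|_].
  by have [_] := VHEneq z uv uv; rewrite e eqxx.
case: pickP => [[a b] /= /andP[ab /eqP e]|_].
  by have [_ _] := VHEneq u ab uv; rewrite e eqxx.
case: pickP => [[a b] /= /andP[ab /eqP e]|/(_ (u, v))]; last by rewrite /= uv eqxx.
have [_ /(_ e)[[-> ->]//|[-> ->]]] := HEinj ab uv; exact: addrC.
Qed.

Let posM : 'M[R]_(m, n) := \matrix_w pos w.

Lemma pt_posM w : pt w *m posM = pos w.
Proof. by rewrite -rowE rowK. Qed.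

(** The larger coordinate of an edge point is put first, so that only half of each edge has to be
    computed. *)
Lemma graph_point (x : 'rV[R]_n) : realization R (graph_complex G) x ->
  (exists u, x 0 u = 1 /\ forall z, z != u -> x 0 z = 0) \/
  exists u v, [/\ adj G u v, x 0 u + x 0 v = 1, 0 <= x 0 v, x 0 v <= x 0 u &
    forall z, z != u -> z != v -> x 0 z = 0].
Proof.
move=> [x0 s1]; set s := finset _ => sG.
have xs z : z \notin s -> x 0 z = 0 by rewrite inE negbK => /eqP.
move: sG; rewrite inE => /orP[/cards1P[u sE]|].
  left; exists u; have xz z : z != u -> x 0 z = 0 by move=> zu; apply: xs; rewrite sE inE.
  by split=> //; rewrite -s1 (bigD1 u) //= big1 ?addr0.
move=> se; right; have s2 : #|s| == 2%N by have := forallP (edges_card2 G) s; rewrite se.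
have /cards2P[u [v [uv sE]]] := s2; have auv : adj G u v by rewrite /adj -sE.
have xz z : z != u -> z != v -> x 0 z = 0.
  by move=> zu zv; apply: xs; rewrite sE !inE negb_or zu.
have s3 : x 0 u + x 0 v = 1.
  rewrite -s1 (bigD1 u) //= (bigD1 v) /=; last by rewrite eq_sym.
  by rewrite big1 ?addr0 // => z /andP[]; apply: xz.
case: (leP (x 0 v) (x 0 u)) => h; first by exists u, v; split.
exists v, u; rewrite adjC addrC; split=> //; first exact: ltW.
by move=> z zv zu; apply: xz.
Qed.

Lemma drawingK (x : 'rV[R]_n) : realization R (graph_complex G) x -> drawing x *m posM = x.
Proof.
move=> /graph_point[[u [xu xz]]|[u [v [uv s1 v0 vu xz]]]].
  rewrite (drawing_vertex xu xz) pt_posM pos_V; apply/rowP => z; rewrite !mxE eqxx /=.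
  by have [->|zu] := eqVneq z u; rewrite ?xu ?xz.
rewrite (drawing_edge uv s1 v0 vu xz); have uNv := adj_neq uv.
have xE : x = x 0 u *: delta_mx 0 u + x 0 v *: delta_mx 0 v.
  apply/rowP => z; rewrite !mxE eqxx /=; have [->|zu] := eqVneq z u.
    by rewrite (negbTE uNv) mulr1 mulr0 addr0.
  by have [->|zv] := eqVneq z v; rewrite ?mulr0 ?mulr1 ?add0r // xz.
rewrite [RHS]xE; case: ifP => h; rewrite mulmxDl -!scalemxAl !pt_posM ?pos_V ?pos_H ?pos_E //.
  rewrite scalerDr !scalerA addrA -scalerDl; congr (_ *: _ + _ *: _); lra.
rewrite !scalerDr !scalerA addrACA -!scalerDl; congr (_ *: _ + _ *: _); lra.
Qed.

Lemma drawing_embedding : embeds_in R G K.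
Proof.
exists drawing; split.
- exact/continuous_subspaceT/continuous_drawing.
- by move=> x y /set_mem hx /set_mem hy exy; rewrite -(drawingK hx) exy drawingK.
move=> _ [x /graph_point[[u [xu xz]]|[u [v [uv s1 v0 vu xz]]]] <-].
  rewrite (drawing_vertex xu xz).
  have -> : pt (V u) = 1 *: delta_mx 0 (V u) + 0 *: delta_mx 0 (V u).
    by rewrite scale1r scale0r addr0.
  apply: realization_segment => //; last by rewrite addr0.
  by rewrite finset.setUid; case: sK.
have [VH HE _] := VHE uv.
rewrite (drawing_edge uv s1 v0 vu xz); case: ifP => h.
  by apply: realization_segment => //; lra.
by apply: realization_segment => //; lra.
Qed.

End Drawing.

End Drawing.

(** * From connected point sets to connected sets of lattice points *)

Module LatticeNodes.

Import Defs.
Import Adjacency Maps Assembly Drawing.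

Import Order.TTheory GRing.Theory Num.Theory.
Import numFieldNormedType.Exports.
Local Open Scope ring_scope.

Lemma open_norm_lt (R : realType) (T : topologicalType) (g : T -> R) (c : R) : continuous g ->
  open [set x | `|g x| < c]%classic.
Proof.
move=> cg; rewrite openE => z gz; apply: (cvgr_lt `|g z|) => //.
by apply: cvg_norm; apply: cg.
Qed.

Lemma open_forall (T : topologicalType) (I : finType) (P : I -> set T) : (forall i, open (P i)) ->
  open [set x | forall i, P i x]%classic.
Proof.
move=> oP; rewrite openE => z Pz; apply: filter_forall => i.
by apply: open_nbhs_nbhs; split; [exact: oP | exact: Pz].
Qed.

Section Nodes.
Variables (R : realType) (m : nat) (K : {set {set 'I_m}}).
Hypothesis sK : simplicial_complex K.
Hypothesis dimK : forall s, s \in K -> (#|s| <= 3)%N.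
Variable N : nat.
Hypothesis N_gt0 : (0 < N)%N.
Implicit Types (z : 'rV[R]_m) (w : 'I_m -> nat).

(** The strict bound makes this an open condition on [z], so that connectedness of a point set can
    pass to its nodes. *)
Definition near_node w z := forall i, `|N%:R * z 0 i - (w i)%:R| < 1.

Lemma near_node_supp w z : near_node w z -> finset (fun v => (0 < w v)%N) \subset finset (fun i => z 0 i != 0).
Proof.
move=> wz; apply/fintype.subsetP => i; rewrite !inE => wi; apply: contraTneq (wz i) => ->.
by rewrite mulr0 sub0r normrN ger0_norm ?ler0n // -leNgt ler1n.
Qed.

(** Rounding the coordinates one by one would spoil their sum; rounding the partial sums down and
    taking differences keeps the sum [N] and errs by less than 1. *)
Lemma near_node_exists z : realization R K z ->
  exists w, [/\ (\sum_v w v)%N = N, near_node w z & finset (fun v => (0 < w v)%N) \in K].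
Proof.
move=> [z0 z1 zK]; pose S j : R := \sum_(i < m | (i < j)%N) N%:R * z 0 i.
pose F j := Num.truncn (S j).
have S0 j : 0 <= S j by apply: sumr_ge0 => i _; rewrite mulr_ge0.
have SS (i : 'I_m) : S i.+1 = S i + N%:R * z 0 i.
  rewrite /S (bigD1 i) //= addrC; congr (_ + _); apply: eq_bigl => j.
  by rewrite ltnS ltn_neqAle andbC.
have Fm : F m = N.
  rewrite /F; have -> : S m = N%:R.
    by rewrite /S -mulr_sumr (eq_bigl predT) ?z1 ?mulr1 // => i; rewrite ltn_ord.
  exact: natrK.
have F0 : F 0%N = 0%N by rewrite /F /S big_pred0 ?truncn0.
have Fmono : {homo F : x y / (x <= y)%N}.
  move=> x y xy; apply: le_truncn; rewrite /S [X in _ <= X](bigID (fun i : 'I_m => (i < x)%N)) /=.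
  rewrite [X in X + _](eq_bigl (fun i : 'I_m => (i < x)%N)); last first.
    by move=> i; have [ix|//] := ltnP i x; rewrite ?andbF // (leq_trans ix xy).
  by rewrite lerDl sumr_ge0 // => i _; rewrite mulr_ge0.
pose w (i : 'I_m) := (F i.+1 - F i)%N.
have sw : (\sum_v w v)%N = N by rewrite -(big_mkord xpredT (fun i => F i.+1 - F i)%N) telescope_sumn // Fm F0 subn0.
have nw : near_node w z.
  move=> i; rewrite /w natrB ?Fmono //.
  have /andP[h1 h2] := truncn_itv (S0 i); have /andP[h3 h4] := truncn_itv (S0 i.+1).
  rewrite -/(F i) -/(F i.+1) SS -!natr1 in h1 h2 h3 h4 *.
  by rewrite ltr_norml; apply/andP; split; lra.
exists w; split=> //; have [_ _ down] := sK; apply: (down _ _ zK (near_node_supp nw)).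
apply/negP => /eqP w0; move: N_gt0; rewrite -sw big1 // => i _.
have : i \notin finset (fun v => (0 < w v)%N) by rewrite w0 inE.
by rewrite inE lt0n negbK => /eqP.
Qed.

(** The nodes differ by at most 1 in each coordinate, with as many increases as decreases, on a
    support of at most 3 vertices; so there is at most one of each. *)
Lemma near_node2 w w' z : realization R K z -> near_node w z -> near_node w' z ->
  (\sum_v w v)%N = N -> (\sum_v w' v)%N = N ->
  w =1 w' \/ exists p q, [/\ p != q, (0 < w q)%N, (p |: finset (fun v => (0 < w v)%N))%SET \in K &
    forall v, w' v = (w v + (v == p) - (v == q))%N].
Proof.
move=> [_ _ zK] nw nw' sw sw'; set s := finset _ in zK.
have le1 u u' : near_node u z -> near_node u' z -> forall i, (u i <= u' i + 1)%N.
  move=> h h' i; have := h i; have := h' i; rewrite !ltr_norml => /andP[h1 h2] /andP[h3 h4].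
  have : (u i < u' i + 2)%N by rewrite -(ltr_nat R) natrD; lra.
  lia.
have d1 := le1 _ _ nw nw'; have d2 := le1 _ _ nw' nw.
pose U := finset (fun i => (w i < w' i)%N); pose L := finset (fun i => (w' i < w i)%N).
have supp u : near_node u z -> forall i, (0 < u i)%N -> i \in s.
  by move=> /near_node_supp/fintype.subsetP h i ui; apply: h; rewrite inE.
have Us : U \subset s.
  by apply/fintype.subsetP => i; rewrite inE => h; apply: (supp _ nw'); apply: leq_ltn_trans h.
have Ls : L \subset s.
  by apply/fintype.subsetP => i; rewrite inE => h; apply: (supp _ nw); apply: leq_ltn_trans h.
have wi i : (w' i + (i \in L) = w i + (i \in U))%N by have := d1 i; have := d2 i; rewrite !inE; lia.
have sumE (A : {set 'I_m}) : (\sum_i (i \in A))%N = #|A|.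
  by rewrite -sum1_card [RHS]big_mkcond /=; apply: eq_bigr => i _; case: (i \in A).
have UL : #|U| = #|L|.
  have : (\sum_i (w' i + (i \in L)) = \sum_i (w i + (i \in U)))%N by apply: eq_bigr => i _.
  by rewrite !big_split /= sw sw' !sumE => /addnI.
have disj : U :&: L = finset.set0 by apply/setP => i; rewrite !inE; lia.
have U1 : (#|U| <= 1)%N.
  have : (#|U :|: L| <= 3)%N.
    by apply: leq_trans (dimK zK); apply: subset_leq_card; rewrite finset.subUset Us.
  by rewrite cardsU disj cards0; lia.
have [U0|U0] := posnP #|U|.
  left => i; have := wi i; rewrite (cards0_eq U0) (cards0_eq (etrans (esym UL) U0)) !inE.
  by rewrite !addn0.
right; have /cards1P[p Up] : #|U| == 1%N by rewrite eqn_leq U1.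
have /cards1P[q Lq] : #|L| == 1%N by rewrite -UL eqn_leq U1.
have pU : p \in U by rewrite Up inE.
have qL : q \in L by rewrite Lq inE.
have wq : (0 < w q)%N by move: qL; rewrite inE; lia.
exists p, q; split=> //.
- by apply: contraTneq pU => ->; move: qL; rewrite !inE -leqNgt => /ltnW.
- have [_ _ down] := sK; apply: (down _ _ zK).
    by rewrite finset.subUset finset.sub1set (fintype.subsetP Us) // near_node_supp.
  by apply/set0Pn; exists p; rewrite !inE eqxx.
- move=> v; have : (w' v + (v == q) = w v + (v == p))%N by have := wi v; rewrite Up Lq !inE.
  lia.
Qed.

Lemma open_near_node w : open [set z | near_node w z]%classic.
Proof.
apply: open_forall => i; apply: open_norm_lt.
by apply: continuous_affine; exact: (@coord_continuous R 1 m 0 i).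
Qed.

Variables (D : finType) (e f : {perm D}) (coord : D -> 'I_m -> nat).
Hypothesis coord_sum : forall x, (\sum_v coord x v)%N = N.
Hypothesis coord_orb : forall x y, y \in porbit (e * f)%g x <-> coord x =1 coord y.
Hypothesis node_dart : forall w, (\sum_v w v)%N = N -> finset (fun v => (0 < w v)%N) \in K ->
  exists x, coord x =1 w.
Hypothesis edge_dart : forall w p q, (\sum_v w v)%N = N -> p != q -> (0 < w q)%N ->
  (p |: finset (fun v => (0 < w v)%N))%SET \in K ->
  exists x, coord x =1 w /\ forall v, coord (e x) v = (w v + (v == p) - (v == q))%N.

Definition nodes (Z : set 'rV[R]_m) : {set D} :=
  finset (fun x => `[< exists2 z, Z z & near_node (coord x) z >]).

Lemma nodesP Z x : reflect (exists2 z, Z z & near_node (coord x) z) (x \in nodes Z).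
Proof. by rewrite inE; apply: asboolP. Qed.

Lemma near_node_eq w w' z : w =1 w' -> near_node w z -> near_node w' z.
Proof. by move=> ww' h i; rewrite -ww'; apply: h. Qed.

Lemma nodes_closed Z : vertex_closed e f (nodes Z).
Proof.
move=> x /nodesP[z Zz xz]; apply/nodesP; exists z => //.
by apply: near_node_eq xz; apply/coord_orb/perm_in_porbit.
Qed.

Lemma nodes_cover Z z : (Z `<=` realization R K)%classic -> Z z ->
  exists2 x, x \in nodes Z & near_node (coord x) z.
Proof.
move=> ZK Zz; have [w [sw nw wK]] := near_node_exists (ZK _ Zz).
have [x xw] := node_dart sw wK; have nx : near_node (coord x) z.
  by apply: near_node_eq nw => i; rewrite xw.
by exists x => //; apply/nodesP; exists z.
Qed.

(** The points near [T] and those near the other nodes are open in [Z] and cover it. By [near_node2]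
    and [edge_dart] no point is near both, so connectedness of [Z] leaves no other nodes. *)
Lemma nodes_connected Z : (Z `<=` realization R K)%classic -> connected Z ->
  map_connected e f (nodes Z).
Proof.
move=> ZK cZ T TZ T0 Tn Te.
pose near_set (S : {set D}) := (\bigcup_(x in [set x | x \in S]) [set z | near_node (coord x) z])%classic.
have oN S : open (near_set S) by apply: bigcup_open => x _; exact: open_near_node.
have excl z x x' : Z z -> x \in T -> near_node (coord x) z -> x' \in nodes Z ->
    near_node (coord x') z -> x' \in T.
  move=> Zz xT nx x'Z nx'.
  have [same|[p [q [pq wq pK st]]]] := near_node2 (ZK _ Zz) nx nx' (coord_sum x) (coord_sum x').
    by rewrite (closed_orbit Tn (x := x)) //; apply/coord_orb.
  have [y [yx ey]] := edge_dart (coord_sum x) pq wq pK.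
  have yT : y \in T by rewrite (closed_orbit Tn (x := x)) //; apply/coord_orb => v; rewrite yx.
  have eyx' : x' \in porbit (e * f)%g (e y) by apply/coord_orb => v; rewrite ey st.
  rewrite (closed_orbit Tn eyx'); apply: Te => //.
  by rewrite -(closed_orbit (@nodes_closed Z) eyx').
have B0 : (Z `&` near_set T !=set0)%classic.
  have /set0Pn[x xT] := T0; have /nodesP[z Zz xz] := fintype.subsetP TZ _ xT.
  by exists z; split=> //; exists x.
have BZ := cZ (Z `&` near_set T)%classic B0.
have {}BZ : (Z `&` near_set T)%classic = Z.
  apply: BZ; first by exists (near_set T).
  exists (~` near_set (nodes Z :\: T))%classic; first exact: open_closedC.
  apply/seteqP; split=> z [Zz h]; split=> //.
    move=> [x' /=]; rewrite inE => /andP[x'T x'Z] nx'; case: h => x xT nx.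
    by rewrite (excl z x x') in x'T.
  have [x xZ nx] := nodes_cover ZK Zz; exists x => //=.
  by apply/negPn/negP => xT; apply: h; exists x => //=; rewrite inE xT.
apply/eqP; rewrite finset.eqEsubset TZ; apply/fintype.subsetP => x' x'Z.
have /nodesP[z Zz nx'] := x'Z; have : (Z `&` near_set T)%classic z by rewrite BZ.
by move=> [_ [x xT nx]]; apply: excl Zz xT nx x'Z nx'.
Qed.

End Nodes.

Section Topology.
Variable R : realType.

Lemma star_connected n (A : set 'rV[R]_n) c : A c ->
  (forall x t, A x -> 0 <= t -> t <= 1 -> A ((1 - t) *: c + t *: x)) -> connected A.
Proof.
move=> Ac star; pose ray x := [set (1 - t) *: c + t *: x | t in `[(0 : R), 1]]%classic.
have -> : A = (\bigcup_(x in A) ray x)%classic.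
  apply/seteqP; split=> [x Ax|y [x Ax [t /= + <-]]].
    exists x => //; exists 1; first by rewrite /= in_itv /= ler01 lexx.
    by rewrite subrr scale0r scale1r add0r.
  by rewrite in_itv /= => /andP[t0 t1]; apply: star.
apply: bigcup_connected.
  exists c => x Ax; exists 0; first by rewrite /= in_itv /= ler01 lexx.
  by rewrite subr0 scale1r scale0r addr0.
move=> x Ax; apply: connected_continuous_connected; first exact: segment_connected.
apply: continuous_subspaceT; apply: continuous_add => t.
  by apply: cvgZr_tmp; apply: cvgB; [exact: cvg_cst | exact: cvg_id].
by apply: cvgZr_tmp; exact: cvg_id.
Qed.

Lemma continuous_sum_coord n : continuous (fun x : 'rV[R]_n => \sum_i x 0 i).
Proof.
apply: continuous_big; first exact: add_continuous.
by move=> i _; exact: (@coord_continuous R 1 n 0 i).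
Qed.

(** The realization is a finite union of closed faces inside the unit cube. *)
Lemma realization_compact n (K : {set {set 'I_n}}) : simplicial_complex K ->
  compact (realization R K).
Proof.
move=> [_ _ down].
pose face (s : {set 'I_n}) := ([set x : 'rV[R]_n | \sum_i x 0 i = 1] `&`
  (\bigcap_(i in [set i | True]) [set x : 'rV[R]_n | 0 <= x 0 i]) `&`
  \bigcap_(i in [set i | i \notin s]) [set x : 'rV[R]_n | x 0 i = 0])%classic.
have cl_pre (g : 'rV[R]_n -> R) B : continuous g -> closed B -> closed (g @^-1` B)%classic.
  by move=> cg; apply: preimage_closed => x _; exact: cg.
have cc (i : 'I_n) : continuous (fun x : 'rV[R]_n => x 0 i) by exact: coord_continuous.
have E : realization R K = (\bigcup_(s in [set s | s \in K]) face s)%classic.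
  apply/seteqP; split=> [x [x0 x1 xK]|x [s sK [[x1 x0] xs]]].
    exists (finset (fun i => x 0 i != 0)) => //; split; first by split=> // i _; apply: x0.
    by move=> i /=; rewrite inE negbK => /eqP.
  split=> // [i|]; first exact: x0.
  apply: (down _ _ sK).
    by apply/fintype.subsetP => i; rewrite inE => /eqP xi; apply/negPn/negP => /xs.
  apply/negP => /eqP s0; have : \sum_i x 0 i = 0.
    apply: big1 => i _; apply/eqP; have : i \notin finset (fun i => x 0 i != 0) by rewrite s0 inE.
    by rewrite inE negbK.
  by rewrite x1 => /eqP; rewrite oner_eq0.
apply: (subclosed_compact _ (@rV_compact _ n (fun=> `[(0 : R), 1]%classic) (fun=> @segment_compact R 0 1))).
  rewrite E; apply: closed_bigcup; first exact: finite_finset.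
  move=> s _; apply: closedI; first apply: closedI.
  - exact/(cl_pre _ [set y | y = 1]%classic)/closed_eq/continuous_sum_coord.
  - by apply: closed_bigI => i _; apply: (cl_pre _ [set y | 0 <= y]%classic); [exact: cc | exact: closed_ge].
  - by apply: closed_bigI => i _; apply: (cl_pre _ [set y | y = 0]%classic); [exact: cc | exact: closed_eq].
move=> x [x0 x1 _] i /=; rewrite in_itv /= x0 /= -x1 (bigD1 i) //= lerDl.
by apply: sumr_ge0 => j _; apply: x0.
Qed.

(** Otherwise the points with a distant partner of almost equal image cluster at some [p] of [X].
    The partners stay far from [p], but the image of the far part of [X] is closed and avoids
    [f p]. *)
Lemma inverse_uniform n m (X : set 'rV[R]_n) (f : 'rV[R]_n -> 'rV[R]_m) (eps : R) : 0 < eps ->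
  compact X -> {within X, continuous f}%classic -> (forall x y, X x -> X y -> f x = f y -> x = y) ->
  exists2 delta : R, 0 < delta & forall x y, X x -> X y ->
    (forall j, `|f x 0 j - f y 0 j| < delta) -> forall i, `|x 0 i - y 0 i| < eps.
Proof.
move=> eps0 cX cf finj; apply: contrapT => none.
pose bad (d : R) := [set x | X x /\ exists y, [/\ X y, forall j, `|f x 0 j - f y 0 j| < d &
  exists i, eps <= `|x 0 i - y 0 i|]]%classic.
have bad0 d : 0 < d -> (bad d !=set0)%classic.
  move=> d0; apply: contrapT => b0; apply: none; exists d => // x y Xx Xy h i.
  rewrite ltNge; apply/negP => le; apply: b0; exists x; split=> //; exists y; split=> //.
  by exists i.
pose F := filter_from [set d : R | 0 < d]%classic bad.
have FF : ProperFilter F.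
  apply: filter_from_proper => //; apply: filter_from_filter; first by exists 1 => /=.
  move=> d d' /= d0 d'0; exists (Num.min d d'); first by rewrite /= lt_min d0.
  move=> x [Xx [y [Xy h gap]]]; split; split=> //; exists y; split=> // j.
    by apply: lt_le_trans (h j) _; rewrite ge_min lexx.
  by apply: lt_le_trans (h j) _; rewrite ge_min lexx orbT.
have FX : F X by exists 1 => //= x [].
have [p [Xp clp]] := cX F FF FX.
pose far := (X `&` ~` ball p (eps / 2))%classic.
have cfar : compact far.
  by apply: compact_closedI => //; apply/open_closedC/ball_open.
have clfar : closed (f @` far)%classic.
  apply: compact_closed; first exact: norm_hausdorff.
  apply: continuous_compact => //; apply: continuous_subspaceW cf; by move=> x [].
have pfar : ~ (f @` far)%classic (f p).
  move=> [y [Xy ny] fy]; apply: ny; rewrite (finj _ _ Xy Xp fy).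
  by apply: ballxx; lra.
have /nbhs_ballP[eta /= eta0 etaB] : nbhs (f p) (~` (f @` far))%classic.
  by apply: open_nbhs_nbhs; split=> //; exact: closed_openC.
have cp := (subspace_continuousP X f).1 cf p Xp.
have h1 : nbhs p [set x | X x -> ball (f p) (eta / 2) (f x)]%classic.
  by apply: (cp (ball (f p) (eta / 2))); apply: nbhsx_ballx; lra.
have h2 : nbhs p (ball p (eps / 2)) by apply: nbhsx_ballx; lra.
have Fbad : F (bad (eta / 2)) by exists (eta / 2) => //=; lra.
have [x [[Xx [y [Xy xy [i gap]]]] [hx1 [_ hx2]]]] := clp _ _ Fbad (filterI h1 h2).
have [_ fx] := hx1 Xx.
apply: (etaB (f y)); last first.
  exists y => //; split=> // -[_ /(_ 0 i) py]; have px := hx2 0 i.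
  move: py px; rewrite /ball /= => py px.
  move: gap; rewrite leNgt => /negP; apply.
  rewrite -[x 0 i](subrK (p 0 i)) -addrA; apply: le_lt_trans (ler_normD _ _) _.
  by rewrite (distrC (x 0 i)); lra.
split=> // a j; rewrite !ord1; have := fx 0 j; rewrite /ball /= => fpx.
rewrite -[f p 0 j](subrK (f x 0 j)) -addrA; apply: le_lt_trans (ler_normD _ _) _.
by have := xy j; lra.
Qed.

End Topology.

End LatticeNodes.

(** * Vertex and edge pieces of the realization of a graph *)

Module Pieces.

Import Defs.
Import Adjacency Maps LabelledComplexes Assembly Drawing LatticeNodes.

Import Order.TTheory GRing.Theory Num.Theory.
Import numFieldNormedType.Exports.
Local Open Scope ring_scope.

Section Pieces.
Variables (R : realType) (n : nat) (G : graph n).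
Let X : set 'rV[R]_n := realization R (graph_complex G).

Lemma graph_complex_simplicial : simplicial_complex (graph_complex G).
Proof.
split=> [|v|s t].
- rewrite inE cards0 /=; apply/negP => h.
  by have := forallP (edges_card2 G) finset.set0; rewrite h cards0.
- by rewrite inE cards1.
- rewrite !inE => /orP[t1|te] st s0.
    have : (#|s| <= 1)%N by rewrite -(eqP t1) subset_leq_card.
    by rewrite leq_eqVlt ltnS leqn0 cards_eq0 (negbTE s0) orbF => ->.
  have t2 : #|t| = 2%N by apply/eqP; have := forallP (edges_card2 G) t; rewrite te.
  have := subset_leq_card st; rewrite t2 leq_eqVlt => /orP[s2|].
    by have -> : s = t; [apply/eqP; rewrite eqEcard st t2 (eqP s2) | rewrite te orbT].
  by rewrite ltnS leq_eqVlt ltnS leqn0 cards_eq0 (negbTE s0) orbF => ->.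
Qed.

(** The segment stays in the face of [x], as the support of [c] lies in that of [x]; this makes the
    pieces below star-shaped. *)
Lemma realization_star (c x : 'rV[R]_n) (t : R) : (forall i, 0 <= c 0 i) -> \sum_i c 0 i = 1 ->
  (forall i, c 0 i != 0 -> x 0 i != 0) -> X x -> 0 <= t -> t <= 1 -> X ((1 - t) *: c + t *: x).
Proof.
move=> c0 c1 cx [x0 x1 xG] t0 t1; have [_ _ down] := graph_complex_simplicial.
pose y : 'rV[R]_n := (1 - t) *: c + t *: x; rewrite -/y.
have yE i : y 0 i = (1 - t) * c 0 i + t * x 0 i by rewrite !mxE.
have y1 : \sum_i y 0 i = 1.
  by under eq_bigr => i _ do rewrite yE; rewrite big_split /= -!mulr_sumr c1 x1; lra.
split=> //.
  by move=> i; rewrite yE addr_ge0 // mulr_ge0 // subr_ge0.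
apply: (down _ _ xG).
  apply/fintype.subsetP => i; rewrite !inE yE; apply: contra_neq => xi; rewrite xi mulr0 addr0.
  by have [->|/cx] := eqVneq (c 0 i) 0; rewrite ?mulr0 // xi eqxx.
apply/negP => /eqP s0; have : \sum_i y 0 i = 0.
  apply: big1 => i _; apply/eqP; have : i \notin finset (fun i => y 0 i != 0) by rewrite s0 inE.
  by rewrite inE negbK.
by rewrite y1 => /eqP; rewrite oner_eq0.
Qed.

(** Constants: 2/3 + 2/3 - 1/8 > 1 separates vertex pieces, 1/4 > 1/8 keeps the ends of an edge
    visible from close points, and the point with coordinates 2/3 and 1/3 lies in both kinds of
    piece. *)
Definition vertex_piece u : set 'rV[R]_n := [set x | X x /\ 2 / 3 <= x 0 u]%classic.
Definition edge_piece u v : set 'rV[R]_n := [set x | [/\ X x, 1 / 4 <= x 0 u & 1 / 4 <= x 0 v]]%classic.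

Lemma edge_pieceC u v : edge_piece u v = edge_piece v u.
Proof. by apply/seteqP; split=> x []. Qed.

Let delta u : 'rV[R]_n := delta_mx 0 u.
Lemma deltaE u i : delta u 0 i = (i == u)%:R.
Proof. by rewrite mxE eqxx. Qed.

Lemma delta_sum u : \sum_i delta u 0 i = 1.
Proof.
by rewrite (bigD1 u) //= deltaE eqxx big1 ?addr0 // => i; rewrite deltaE => /negbTE->.
Qed.

Lemma delta_X u : X (delta u).
Proof.
have -> : delta u = 1 *: delta_mx 0 u + 0 *: delta_mx 0 u by rewrite scale1r scale0r addr0.
apply: realization_segment => //; [exact: graph_complex_simplicial | | by rewrite addr0].
by rewrite finset.setUid inE cards1.
Qed.

Lemma edge_X u v (a b : R) : adj G u v -> 0 <= a -> 0 <= b -> a + b = 1 -> X (a *: delta u + b *: delta v).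
Proof.
move=> uv a0 b0 ab; apply: realization_segment => //; first exact: graph_complex_simplicial.
by rewrite inE -/(adj G u v) uv orbT.
Qed.

Lemma edgeE u v (a b : R) i : (a *: delta u + b *: delta v) 0 i = a * (i == u)%:R + b * (i == v)%:R.
Proof. by rewrite mxE [X in X + _]mxE [X in _ + X]mxE !deltaE. Qed.

Lemma coord_add_le1 (x : 'rV[R]_n) u v : X x -> u != v -> x 0 u + x 0 v <= 1.
Proof.
move=> [x0 x1 _] uv; rewrite -x1 (bigD1 u) //= (bigD1 v) /=; last by rewrite eq_sym.
by rewrite addrA lerDl sumr_ge0.
Qed.

Lemma coord_third0 (x : 'rV[R]_n) u v w : X x -> u != v -> x 0 u != 0 -> x 0 v != 0 ->
  w != u -> w != v -> x 0 w = 0.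
Proof.
move=> [_ _]; set s := finset _ => sG uv xu xv wu wv; apply/eqP/negPn/negP => xw.
have s2 : (#|s| <= 2)%N.
  move: sG; rewrite inE => /orP[/eqP->//|se].
  by have := forallP (edges_card2 G) s; rewrite se => /eqP->.
have : (#|[set u; v; w]%SET| <= #|s|)%N.
  apply: subset_leq_card; apply/fintype.subsetP => i; rewrite !inE => /orP[/orP[]|] /eqP->//.
by rewrite cards3 // 1?eq_sym // leqNgt ltnS s2.
Qed.

Lemma vertex_piece_delta u : vertex_piece u (delta u).
Proof. by split; [exact: delta_X | rewrite deltaE eqxx mulr1n; lra]. Qed.

Lemma vertex_piece_connected u : connected (vertex_piece u).
Proof.
apply: (star_connected (c := delta u)); first exact: vertex_piece_delta.
move=> x t [Xx xu] t0 t1; split.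
  apply: realization_star => //; first by move=> i; rewrite deltaE ler0n.
    exact: delta_sum.
  move=> i; rewrite deltaE; have [->|iu] := eqVneq i u; last by rewrite mulr0n eqxx.
  by move=> _; apply/eqP; lra.
by rewrite mxE [X in X + _]mxE [X in _ + X]mxE deltaE eqxx mulr1n; nra.
Qed.

Lemma edge_piece_connected u v : adj G u v -> connected (edge_piece u v).
Proof.
move=> uv; have uNv := adj_neq uv; have vNu : v != u by rewrite eq_sym.
pose c := (1 / 2) *: delta u + (1 / 2) *: delta v.
have h2 : (1 / 2 : R) + 1 / 2 = 1 by lra.
have Xc : X c by apply: edge_X => //; lra.
have cu : c 0 u = 1 / 2 by rewrite edgeE eqxx (negbTE uNv) mulr1n mulr0n; lra.
have cv : c 0 v = 1 / 2 by rewrite edgeE eqxx (negbTE vNu) mulr1n mulr0n; lra.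
apply: (star_connected (c := c)); first by split=> //; lra.
move=> x t [Xx xu xv] t0 t1; split.
- have [c0 c1 _] := Xc; apply: realization_star => // i; rewrite edgeE.
  have [->|iu] := eqVneq i u; first by move=> _; apply/eqP; lra.
  by have [->|iv] := eqVneq i v; [move=> _; apply/eqP; lra | rewrite !mulr0n !mulr0 addr0 eqxx].
- by rewrite mxE [X in X + _]mxE [X in _ + X]mxE cu; nra.
- by rewrite mxE [X in X + _]mxE [X in _ + X]mxE cv; nra.
Qed.

Definition close (x y : 'rV[R]_n) := forall i, `|x 0 i - y 0 i| < 1 / 8.

Lemma closeP x y : close x y -> forall i, x 0 i < y 0 i + 1 / 8 /\ y 0 i < x 0 i + 1 / 8.
Proof. by move=> h i; have := h i; rewrite ltr_norml => /andP[]; split; lra. Qed.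

Lemma close_vertex_vertex x y u v : close x y -> vertex_piece u x -> vertex_piece v y -> u = v.
Proof.
move=> /closeP c [Xx xu] [Xy yv]; apply/eqP/negPn/negP => uv.
by have := coord_add_le1 Xx uv; have := c v; lra.
Qed.

Lemma close_vertex_edge x y u v w : adj G v w -> close x y -> vertex_piece u x -> edge_piece v w y ->
  u = v \/ u = w.
Proof.
move=> vw /closeP c [Xx xu] [Xy yv yw]; have [|uv] := eqVneq u v; first by left.
have [|uw] := eqVneq u w; first by right.
have := coord_third0 Xy (adj_neq vw) _ _ uv uw; have := c u.
have -> : y 0 v != 0 by apply/eqP; lra.
have -> : y 0 w != 0 by apply/eqP; lra.
by move=> [h _] /(_ isT isT) y0; rewrite y0 in h; exfalso; lra.
Qed.

Lemma close_edge_edge x y u v u' v' : adj G u v -> adj G u' v' -> close x y -> edge_piece u v x ->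
  edge_piece u' v' y -> u = u' /\ v = v' \/ u = v' /\ v = u'.
Proof.
move=> uv uv' /closeP c [Xx xu xv] [Xy yu yv]; have n1 := adj_neq uv; have n2 := adj_neq uv'.
have mem a : 1 / 4 <= x 0 a -> a = u' \/ a = v'.
  move=> xa; have [|au] := eqVneq a u'; first by left.
  have [|av] := eqVneq a v'; first by right.
  have := coord_third0 Xy n2 _ _ au av; have := c a.
  have -> : y 0 u' != 0 by apply/eqP; lra.
  have -> : y 0 v' != 0 by apply/eqP; lra.
  by move=> [h _] /(_ isT isT) y0; rewrite y0 in h; exfalso; lra.
case: (mem u xu) (mem v xv) => [eu|eu] [ev|ev]; [|by left|by right|];
  by rewrite eu ev eqxx in n1.
Qed.

End Pieces.

End Pieces.

(** * From embeddings to models *)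

Module EmbeddedModels.

Import Defs.
Import Adjacency Maps LabelledComplexes Routing OrientedTriangles Lattice Assembly Drawing LatticeNodes Pieces.

Import Order.TTheory GRing.Theory Num.Theory.
Import numFieldNormedType.Exports.
Local Open Scope ring_scope.

(** For large [N], a node shared by two pieces comes from close points of the graph, so that pieces
    share nodes only if they belong together; [assemble_model] then turns them into branch sets. *)
Lemma embeds_model (R : realType) n m (G : graph n) (K : {set {set 'I_m}}) g :
  orientable_surface_of_genus K g -> embeds_in R G K ->
  exists (D : finType) (e f : {perm D}) B, is_map e f g /\ model e f (adj G) finset.setT B.
Proof.
move=> sK [h [hc hinj hK]]; set X := realization R (graph_complex G) in hc hinj hK.
have [[cK pure _ _] [m0 _] [ o [ o_tri o_rot tri_o o_fun]] _] := sK.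
have dimK s : s \in K -> (#|s| <= 3)%N.
  move=> /pure[t]; rewrite inE => /andP[_ /eqP<-]; exact: subset_leq_card.
have [delta d0 hd] : exists2 delta : R, 0 < delta & forall x y, X x -> X y ->
    (forall j, `|h x 0 j - h y 0 j| < delta) -> forall i, `|x 0 i - y 0 i| < 1 / 8.
  have e8 : 0 < 1 / 8 :> R by lra.
  have cX : compact X by apply/realization_compact/graph_complex_simplicial.
  by apply: (inverse_uniform e8 cX hc) => x y Xx Xy; apply: hinj; rewrite inE.
(* Two image points near the same node differ by less than [2 / N < delta] in each coordinate. *)
pose N := (Num.truncn (2 / delta)).+1.
have N2 : 2 < delta * N%:R by rewrite -ltr_pdivrMl // mulrC truncnS_gt.
have N_gt0 : (0 < N)%N by [].
have [q0 [r0 opqr]] := vertex_o sK o_tri o_rot tri_o o_fun (Ordinal m0).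
pose e := lat_e sK o_tri o_rot tri_o o_fun N_gt0 opqr; pose f := lat_f o_rot N_gt0 opqr.
have cO x y : y \in porbit (e * f)%g x <-> coord x =1 coord y.
  exact: (coord_orb sK o_tri o_rot tri_o o_fun N_gt0 opqr).
have nD w := @node_dart m K g sK o o_tri tri_o N N_gt0 _ _ _ opqr w.
have eD w p q : (\sum_v w v)%N = N -> p != q -> (0 < w q)%N ->
    (p |: finset (fun v => (0 < w v)%N))%SET \in K ->
    exists x, coord x =1 w /\ forall v, coord (e x) v = (w v + (v == p) - (v == q))%N.
  exact: (edge_dart sK o_tri o_rot tri_o o_fun N_gt0 opqr).
have Mf : is_map e f g := lat_map sK o_tri o_rot tri_o o_fun N_gt0 opqr.
have cS x := coord_sum o_tri N_gt0 opqr x.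
pose P u := nodes N (@coord m o N) (h @` vertex_piece G u)%classic.
pose Q u v := nodes N (@coord m o N) (h @` edge_piece G u v)%classic.
have PX u : (h @` vertex_piece G u `<=` realization R K)%classic.
  by move=> _ [x [Xx _] <-]; apply: hK; exists x.
have QX u v : (h @` edge_piece G u v `<=` realization R K)%classic.
  by move=> _ [x [Xx _ _] <-]; apply: hK; exists x.
have PN u x : x \in P u -> exists2 y, vertex_piece G u y & near_node N (coord x) (h y).
  by move=> /nodesP[_ [y hy <-] ny]; exists y.
have QN u v x : x \in Q u v -> exists2 y, edge_piece G u v y & near_node N (coord x) (h y).
  by move=> /nodesP[_ [y hy <-] ny]; exists y.
have cl w x y : X x -> X y -> near_node N w (h x) -> near_node N w (h y) -> close x y.
  move=> Xx Xy nx ny; apply: hd => // j; have := nx j; have := ny j.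
  rewrite !ltr_norml => /andP[a1 a2] /andP[a3 a4]; have Nr : 0 < N%:R :> R by rewrite ltr0n.
  by apply/andP; split; nra.
exists (ldart o N), e, f, (branch e f (adj G) P Q); split=> //.
have [_ eK _ _ _] := Mf.
apply: assemble_model => //.
- exact: adjC.
- exact: adjxx.
- move=> u; have [x xP _] := nodes_cover cK N_gt0 nD (PX u) (imageP h (@vertex_piece_delta R n G u)).
  by apply/set0Pn; exists x.
- by move=> u; apply: nodes_closed.
- move=> u; apply: (nodes_connected cK dimK N_gt0 cS cO nD eD (PX u)).
  apply: connected_continuous_connected; first exact: vertex_piece_connected.
  by apply: continuous_subspaceW hc => x [].
- by move=> u v; rewrite /Q edge_pieceC.
- by move=> u v _; apply: nodes_closed.
- move=> u v uv; apply: (nodes_connected cK dimK N_gt0 cS cO nD eD (@QX u v)).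
  apply: connected_continuous_connected; first exact: edge_piece_connected.
  by apply: continuous_subspaceW hc => x [].
- move=> u v x /PN[y yu ny] /PN[z zv nz].
  have Xy : X y by case: yu.
  have Xz : X z by case: zv.
  exact: (close_vertex_vertex (cl _ _ _ Xy Xz ny nz) yu zv).
- move=> u v w x vw /PN[y yu ny] /QN[z zv nz].
  have Xy : X y by case: yu.
  have Xz : X z by case: zv.
  exact: (close_vertex_edge vw (cl _ _ _ Xy Xz ny nz) yu zv).
- move=> u v u' v' x uv uv' /QN[y yu ny] /QN[z zv nz].
  have Xy : X y by case: yu.
  have Xz : X z by case: zv.
  exact: (close_edge_edge uv uv' (cl _ _ _ Xy Xz ny nz) yu zv).
- move=> u v uv; have uNv := adj_neq uv.
  (* A point common to both pieces; a node near its image lies in both sets. *)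
  pose y : 'rV[R]_n := (2 / 3) *: delta_mx 0 u + (1 / 3) *: delta_mx 0 v.
  have Xy : X y by apply: edge_X => //; lra.
  have yu : y 0 u = 2 / 3 by rewrite edgeE eqxx (negbTE uNv) mulr1n mulr0n; lra.
  have yv : y 0 v = 1 / 3 by rewrite edgeE eqxx (eq_sym v) (negbTE uNv) mulr1n mulr0n; lra.
  have Py : vertex_piece G u y by split=> //; lra.
  have Qy : edge_piece G u v y by split=> //; lra.
  have [x xP nx] := nodes_cover cK N_gt0 nD (PX u) (imageP h Py).
  by exists x => //; apply/nodesP; exists (h y) => //; exists y.
Qed.

End EmbeddedModels.

(** * The genus class and the limit *)

Import Defs.
Import Adjacency EdgeOperations SparseGraphs PendantStructures Counting Maps Routing Drawing EmbeddedModels DrawableGraphs.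
Import Order.TTheory GRing.Theory Num.Theory.
Import numFieldNormedType.Exports.
Local Open Scope ring_scope.

(** An embedding at the genus of [G] gives a model by [embeds_model]. Conversely [route] and
    [drawing] give an embedding at some [g <= k], and the least genus exists and is at most [g]. *)
Lemma genus_at_mostP (R : realType) k n (G : graph n) : genus_at_most R k G <-> drawable k G.
Proof.
split=> [[g gk [[m [K [sK emb]]] _]]|[D [e [f [B [g [gk Mf mod]]]]]]].
  have [D [e [f [B [Mf mod]]]]] := embeds_model sK emb.
  by exists D, e, f, B, g.
have [f' [Mf' mod' tight']] := tighten Mf mod.
have [m [K [V [H [E [sK VHE Vinj HE VHEneq]]]]]] := route Mf' mod' tight' (adjC G) (adjxx G).
have emb : embeds_in_genus R G g.
  exists m, K; split=> //; have [[cK _ _ _] _ _ _] := sK.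
  exact: (drawing_embedding R cK VHE Vinj HE VHEneq).
have ex : exists g, `[< embeds_in_genus R G g >] by exists g; apply/asboolP.
case: (ex_minnP ex) => g0 /asboolP emb0 least; exists g0.
  by apply: leq_trans gk; apply: least; apply/asboolP.
by split=> // g' /asboolP; apply: least.
Qed.

Lemma members_drawable (R : realType) k n (G : graph n) :
  (G \in members (genus_at_most R k) n) <-> drawable k G.
Proof.
split; first by rewrite inE => /asboolP/genus_at_mostP.
by move=> /(genus_at_mostP R) h; rewrite inE; apply/asboolP.
Qed.

(** A pendant yields a mate inside the class, as deleting an edge keeps a graph drawable. *)
Lemma unique_members_pendant_free (R : realType) k n :
  unique_members (@Dom) (genus_at_most R k) n \subset pendant_free (members (genus_at_most R k) n).
Proof.
apply/fintype.subsetP => G; rewrite inE => /andP[GC /asboolP uniqG].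
rewrite inE GC; apply/negPn/negP => /set0Pn[t]; rewrite inE => Gt; apply: uniqG.
have [H HG [niso D]] := pendant_mate Gt; exists n, H; split; last by split.
have /members_drawable dG := GC; apply/genus_at_mostP; exact: (sub_drawable HG dG).
Qed.

Lemma card_unique_members (R : realType) k : exists M, forall n, (24 <= n)%N ->
  ((n - 4) * #|unique_members (@Dom) (genus_at_most R k) n| <=
   M * #|members (genus_at_most R k) n|)%N.
Proof.
set C := genus_at_most R k.
pose c := (20 + 12 * k)%N; eexists => n n24.
apply: leq_trans (leq_mul (leqnn _) (subset_leq_card (unique_members_pendant_free R k n))) _.
apply: (@card_pendant_free n c (members C n)) => //.
- by move=> G x y /members_drawable dG xy; apply/members_drawable/contract_drawable.
- by move=> G x /members_drawable dG; apply/members_drawable/isolate_drawable.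
- by move=> G x u /members_drawable dG iG xu; apply/members_drawable/add_leaf_drawable.
- by move=> G A /members_drawable; apply: drawable_sparse.
Qed.

(** The ratio is at most [M / (n - 4)]; where [b n] is 0, it is 0 by the convention on division. *)
Lemma ratio_cvg0 (R : realType) (a b : nat -> nat) M :
  (forall n, (24 <= n)%N -> ((n - 4) * a n <= M * b n)%N) ->
  ((fun n => (a n)%:R / (b n)%:R : R) @ \oo --> (0 : R))%classic.
Proof.
move=> ab; apply/cvgrPdist_lt => eps e0.
(* From this rank on, [M / eps < n - 4]. *)
exists (maxn 24 ((Num.truncn (M%:R / eps)).+1 + 4)%N) => // n /=.
rewrite geq_max => /andP[n24 hn]; rewrite sub0r normrN ger0_norm; last first.
  by rewrite divr_ge0 ?ler0n.
have [b0|b0] := posnP (b n); first by rewrite b0 invr0 mulr0.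
rewrite ltr_pdivrMr ?ltr0n //.
have hM : M%:R < eps * (n - 4)%:R :> R.
  rewrite -ltr_pdivrMl // mulrC; apply: lt_le_trans (truncnS_gt _) _.
  rewrite ler_nat -(leq_add2r 4) subnK; first exact: hn.
  exact: (leq_trans _ n24).
have n4 : 0 < (n - 4)%:R :> R by rewrite ltr0n subn_gt0; exact: (leq_trans _ n24).
rewrite -(ltr_pM2l n4); have := ab n n24; rewrite -(ler_nat R) !natrM => h.
by apply: le_lt_trans h _; rewrite mulrA ltr_pM2r ?ltr0n // mulrC.
Qed.

Theorem theorem5p8 (R : realType) (k : nat) :
  weakly_distinguishing R Dom (genus_at_most R k).
Proof.
have [M hM] := card_unique_members R k.
exact: (@ratio_cvg0 R (fun n => #|unique_members (@Dom) (genus_at_most R k) n|)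
  (fun n => #|members (genus_at_most R k) n|) M hM).
Qed.
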